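(* Let $Z_1,\dots,Z_n$ be i.i.d. with distribution $Q$ on a measurable space $\mathcal Z$, $Z\sim Q$, let $\psi:\mathcal Z\to\mathbb R^r$ be measurable with $\int\|\psi\|^2dQ<\infty$ and $\theta=\int\psi\,dQ$. Let $m_n\to\infty$, let $u_1,u_2,\dots$ be measurable real functions on $\mathcal Z$, $u_n=(u_1,\dots,u_{m_n})^\top$, with $\int\|u_n\|^2dQ<\infty$, $\int u_n\,dQ=0$ and $W_n=\int u_nu_n^\top dQ$ nonsingular for each $n$, the sequence $(W_n)$ being regular. Let $\hat u_n$ be an estimator of $u_n$ (a random function $\mathcal Z\to\mathbb R^{m_n}$ which may depend on the sample) and $\hat W_n=\frac1n\sum_{j=1}^n\hat u_n(Z_j)\hat u_n(Z_j)^\top$. Assume (i) $\max_{1\le j\le n}\|\hat u_n(Z_j)\|=o_p(m_n^{-3/2}n^{1/2})$; (ii) $|\hat W_n-W_n|_o=o_p(m_n^{-1})$; (iii) $\frac1n\sum_{j=1}^n\big(\psi(Z_j)\hat u_n(Z_j)^\top-E[\psi(Z_j)\hat u_n(Z_j)^\top]\big)=o_p(m_n^{-1/2})$; and that there are measurable real functions $v_1,v_2,\dots$ on $\mathcal Z$ such that $v_n=(v_1,\dots,v_{m_n})^\top$ satisfies $\int\|v_n\|^2dQ<\infty$, $\int v_n\,dQ=0$, $\int v_nv_n^\top dQ$ nonsingular, $|U_n|_o=O(1)$ where $U_n=W_n^{-1/2}\big(\int v_nv_n^\top dQ\big)W_n^{-1/2}$, and (iv) $\frac1n\sum_{j=1}^nE\big(\|\hat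 u_n(Z_j)-v_n(Z_j)\|^2\big)=o(m_n^{-1})$; (v) $\frac1n\sum_{j=1}^n\hat u_n(Z_j)=\frac1n\sum_{j=1}^nv_n(Z_j)+o_p(m_n^{-1/2}n^{-1/2})$. Then, with probability tending to one, there is a unique $\hat\zeta_n\in\mathbb R^{m_n}$ with $1+\hat u_n(Z_j)^\top\hat\zeta_n>0$ for all $j$ and $\frac1n\sum_{j=1}^n\hat u_n(Z_j)/(1+\hat u_n(Z_j)^\top\hat\zeta_n)=0$, and $$\hat\theta_n=\frac1n\sum_{j=1}^n\frac{\psi(Z_j)}{1+\hat u_n(Z_j)^\top\hat\zeta_n}=\bar\psi-\bar\varphi+o_p(n^{-1/2}),$$ where $\varphi=\Pi(\psi\mid[v_\infty])$, $\bar\varphi=\frac1n\sum_j\varphi(Z_j)$, $\bar\psi=\frac1n\sum_j\psi(Z_j)$. Consequently, if $\Sigma=\mathrm{Var}(\psi(Z))-\mathrm{Var}(\varphi(Z))$ is nonsingular, then $\sqrt n(\hat\theta_n-\theta)\Rightarrow N(0,\Sigma)$.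
   Context: A sequence of $m_n\times m_n$ dispersion matrices $W_n$ is called regular if $0<\inf_n\inf_{\|a\|=1}a^\top W_na\le\sup_n\sup_{\|a\|=1}a^\top W_na<\infty$. $|A|_o$ is the spectral (operator) norm. $[v_\infty]$ is the closed linear span in $L_2(Q)$ of $v_1,v_2,\dots$ and $\Pi(\psi\mid[v_\infty])$ the componentwise orthogonal projection of $\psi$ onto it. Expectations involving $\hat u_n$ are with respect to the joint distribution of the sample. *)

(* Defs.v *)
From HB Require Import structures.
From mathcomp Require Import all_boot all_order all_algebra.
From mathcomp Require Import all_classical all_reals all_analysis.
Set Implicit Arguments. Unset Strict Implicit. Unset Printing Implicit Defensive.
Import Order.TTheory GRing.Theory Num.Theory.
Import numFieldNormedType.Exports.
Local Open Scope classical_set_scope.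
Local Open Scope ring_scope.

Section linalg.
Context {R : realType}.

Definition vnorm {k : nat} (a : 'cV[R]_k) : R := Num.sqrt (\sum_i a i 0 ^+ 2).

Definition frob {p q : nat} (A : 'M[R]_(p, q)) : R :=
  Num.sqrt (\sum_i \sum_j A i j ^+ 2).

Definition opnorm {p q : nat} (A : 'M[R]_(p, q)) : R :=
  sup [set vnorm (A *m x) | x in [set x : 'cV[R]_q | vnorm x = 1]].

Definition regular_seq (m : nat -> nat) (W : forall n, 'M[R]_(m n)) : Prop :=
  exists c C : R, 0 < c /\
    forall n (a : 'cV[R]_(m n)), vnorm a = 1 ->
      c <= (a^T *m W n *m a) 0 0 <= C.

Definition inv_sqrt_of {k : nat} (S W : 'M[R]_k) : Prop :=
  S^T = S /\ (forall a : 'cV[R]_k, a != 0 -> 0 < (a^T *m S *m a) 0 0) /\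
  S *m S = invmx W.

End linalg.

Section prob.
Context {R : realType}.

(* the vector (f_1, ..., f_k)^T(z) built from a sequence of functions
   (index 0-based: f 0 is the paper's f_1) *)
Definition colfun {T : Type} (f : nat -> T -> R) (k : nat) (z : T) : 'cV[R]_k :=
  \col_(i < k) f i z.

Definition gram {d} {T : measurableType d} (Q : probability T R)
  (f : nat -> T -> R) (k : nat) : 'M[R]_k :=
  \matrix_(i < k, l < k) fine (\int[Q]_z (f i z * f l z)%:E).

Definition meanvec {d} {T : measurableType d} (Q : probability T R) {r : nat}
  (g : T -> 'cV[R]_r) : 'cV[R]_r :=
  \col_(k < r) fine (\int[Q]_z (g z k 0)%:E).

Definition Emx {d} {T : measurableType d} (P : probability T R) {p q : nat}
  (X : T -> 'M[R]_(p, q)) : 'M[R]_(p, q) :=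
  \matrix_(i, j) fine (\int[P]_w (X w i j)%:E).

Definition covmx {d} {T : measurableType d} (Q : probability T R) {r : nat}
  (g : T -> 'cV[R]_r) : 'M[R]_r :=
  \matrix_(k, l) fine (\int[Q]_z
     ((g z k 0 - meanvec Q g k 0) * (g z l 0 - meanvec Q g l 0))%:E).

Definition iid_seq {d dT} {Om : measurableType d} {T : measurableType dT}
  (P : probability Om R) (Z : nat -> Om -> T) (Q : probability T R) : Prop :=
  (forall i, measurable_fun setT (Z i)) /\
  (forall i (A : set T), measurable A -> P (Z i @^-1` A) = Q A) /\
  (forall (J : seq nat) (A : nat -> set T), uniq J ->
     (forall i, measurable (A i)) ->
     P (\bigcap_(i in [set` J]) (Z i @^-1` A i)) =
       (\prod_(i <- J) P (Z i @^-1` A i))%E).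

(* X_n = o_p(rate_n), i.e. X_n / rate_n -> 0 in (outer) probability *)
Definition op_rate {d} {Om : measurableType d} (P : probability Om R)
  (X : nat -> Om -> R) (rate : nat -> R) : Prop :=
  forall eps delta : R, 0 < eps -> 0 < delta ->
    \forall n \near \oo, exists A : set Om,
      [/\ measurable A, [set w | eps * rate n < `|X n w|] `<=` A &
          (P A <= delta%:E)%E].

(* the events E_n hold with (inner) probability tending to one *)
Definition prob_to_one {d} {Om : measurableType d} (P : probability Om R)
  (E : nat -> set Om) : Prop :=
  forall delta : R, 0 < delta ->
    \forall n \near \oo, exists B : set Om,
      [/\ measurable B, B `<=` E n & ((1 - delta)%:E <= P B)%E].

(* h is (a version of) the orthogonal projection in L_2(Q) of g onto the
   closed linear span [v_infty] of v_1, v_2, ... (v 0 is v_1) *)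
Definition L2proj {d} {T : measurableType d} (Q : probability T R)
  (v : nat -> T -> R) (g h : T -> R) : Prop :=
  [/\ measurable_fun setT h,
      (\int[Q]_z (h z ^+ 2)%:E < +oo)%E,
      (forall i, (\int[Q]_z ((g z - h z) * v i z)%:E = 0)%E) &
      (forall eps : R, 0 < eps -> exists N (c : 'I_N -> R),
         (\int[Q]_z ((h z - \sum_(i < N) c i * v i z) ^+ 2)%:E < eps%:E)%E)].

Definition gaussian_vec {d} {T : measurableType d} (P : probability T R)
  {r : nat} (Sig : 'M[R]_r) (Y : T -> 'cV[R]_r) : Prop :=
  (forall i, measurable_fun setT (fun w => Y w i 0)) /\
  forall (t : 'cV[R]_r) (A : set R), measurable A ->
    P ((fun w => (t^T *m Y w) 0 0) @^-1` A) =
      (if (t^T *m Sig *m t) 0 0 == 0 then \d_(0 : R) A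
       else normal_prob 0 (Num.sqrt ((t^T *m Sig *m t) 0 0)) A).

Definition conv_to_gaussian {d} {Om : measurableType d} (P : probability Om R)
  {r : nat} (X : nat -> Om -> 'cV[R]_r) (Sig : 'M[R]_r) : Prop :=
  forall f : 'cV[R]_r -> R, continuous f -> (exists M : R, forall x, `|f x| <= M) ->
  forall (d' : measure_display) (T' : measurableType d') (P' : probability T' R)
         (Y : T' -> 'cV[R]_r), gaussian_vec P' Sig Y ->
    ((fun n => \int[P]_w (f (X n w))%:E) @ \oo --> \int[P']_w (f (Y w))%:E)%E.

Definition el_solution {d dT} {Om : measurableType d} {T : measurableType dT}
  (Z : nat -> Om -> T) {k : nat} (uh : Om -> T -> 'cV[R]_k) (n : nat) (w : Om)
  (zeta : 'cV[R]_k) : Prop :=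
  (forall j : 'I_n, 0 < 1 + ((uh w (Z j w))^T *m zeta) 0 0) /\
  (n%:R)^-1 *: \sum_(j < n) ((1 + ((uh w (Z j w))^T *m zeta) 0 0)^-1 *: uh w (Z j w))
    = 0.

Definition el_estimate {d dT} {Om : measurableType d} {T : measurableType dT}
  (Z : nat -> Om -> T) {r k : nat} (psi : T -> 'cV[R]_r)
  (uh : Om -> T -> 'cV[R]_k) (n : nat) (w : Om) (zeta : 'cV[R]_k) : 'cV[R]_r :=
  (n%:R)^-1 *: \sum_(j < n) ((1 + ((uh w (Z j w))^T *m zeta) 0 0)^-1 *: psi (Z j w)).

Definition smean {d dT} {Om : measurableType d} {T : measurableType dT}
  (Z : nat -> Om -> T) {r : nat} (g : T -> 'cV[R]_r) (n : nat) (w : Om) : 'cV[R]_r :=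
  (n%:R)^-1 *: \sum_(j < n) g (Z j w).

End prob.

(* Main.v *)
(** Conditions (ii) and (iv) force W_n = E(v_n v_n^T): by the law of large
    numbers each entry of hat W_n converges to the corresponding entry of both.
    On an event of probability tending to one, zeta_n is the maximizer of the
    concave function z |-> sum_j ln(1 + hat u_n(Z_j)^T z) over a ball of radius of
    order (m_n/n)^(1/2): the maximum is not attained on the boundary because
    hat W_n is close to W_n, which is bounded below. Expanding 1/(1 + t) to second
    order gives zeta_n = W_n^-1 bar v_n + o_p((m_n n)^(-1/2)) and
    hat theta_n = bar psi - E(psi v_n^T) W_n^-1 bar v_n + o_p(n^(-1/2)). Since
    W_n = E(v_n v_n^T), the correction is the sample mean of the projection of psi
    onto the span of v_1, ..., v_{m_n}, which converges in L_2(Q) to phi.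

    For the central limit theorem, E cos(t^T X_n + a) is computed by multiplying
    the one-step factors and compared with the Gaussian one. Tightness and the
    approximation of bounded continuous functions on a cube by uniformly bounded
    trigonometric polynomials, namely Bernstein polynomials in the variables
    (1 + sin(x_i/s))/2, then give weak convergence. *)
Require Import Defs.
From HB Require Import structures.
From mathcomp Require Import all_boot all_order all_algebra.
From mathcomp Require Import all_classical all_reals all_analysis.
From mathcomp Require Import measurable_realfun simple_functions.
From mathcomp Require Import ring lra.
Import Order.TTheory GRing.Theory Num.Theory.
Import numFieldNormedType.Exports.
Local Open Scope classical_set_scope.
Local Open Scope ring_scope.

(** The dimension m_n grows, so no constant may depend on it. The analysis of the likelihood is
    therefore one deterministic statement about a fixed sample, [el_expansion], whose constants see
    only bounds on quadratic forms and second moments. Its hypotheses carry a small factor eta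
    against powers of a = sqrt m_n and b = sqrt n. The powers balance: for |zeta| of order a/b, the
    quadratic remainder is at most max |x_j| times (a/b)^2, which (i) turns into eta/(ab); the error
    of hat W_n contributes (eta/a^2)(a/b), again eta/(ab), the accuracy to which zeta must be known.
    Probability enters only in checking that these finitely many inequalities hold on large events.
    Such events are only required to contain large measurable ones, so suprema over vectors and the
    solution itself raise no measurability question there.

    Independence is given for events only. It is lifted to functions by approximation with simple
    functions, one variable at a time, in place of product measures. Fourier analysis stays real:
    cosines with an arbitrary phase carry both the cosine and the sine part. *)

Section Euclid.
Context {R : realType}.

(** * Euclidean geometry of column vectors *)

Definition dot {k : nat} (a b : 'cV[R]_k) : R := \sum_i a i 0 * b i 0.

Lemma mxdotE {k : nat} (a b : 'cV[R]_k) : (a^T *m b) 0 0 = dot a b.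
Proof. by rewrite mxE; apply: eq_bigr => i _; rewrite mxE. Qed.

Section Dot.
Context {k : nat}.
Implicit Types (a b c : 'cV[R]_k) (l : R).

Lemma dotC a b : dot a b = dot b a.
Proof. by apply: eq_bigr => i _; rewrite mulrC. Qed.

Lemma dotDl a b c : dot (a + b) c = dot a c + dot b c.
Proof. by rewrite -big_split; apply: eq_bigr => i _; rewrite mxE mulrDl. Qed.

Lemma dotZl l a b : dot (l *: a) b = l * dot a b.
Proof. by rewrite mulr_sumr; apply: eq_bigr => i _; rewrite mxE mulrA. Qed.

Lemma dotDr a b c : dot a (b + c) = dot a b + dot a c.
Proof. by rewrite dotC dotDl !(dotC a). Qed.

Lemma dotZr l a b : dot a (l *: b) = l * dot a b.
Proof. by rewrite dotC dotZl dotC. Qed.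

Lemma dotNl a b : dot (- a) b = - dot a b.
Proof. by rewrite -scaleN1r dotZl mulN1r. Qed.

Lemma dotNr a b : dot a (- b) = - dot a b.
Proof. by rewrite dotC dotNl dotC. Qed.

Lemma dotBl a b c : dot (a - b) c = dot a c - dot b c.
Proof. by rewrite dotDl dotNl. Qed.

Lemma dotBr a b c : dot a (b - c) = dot a b - dot a c.
Proof. by rewrite dotDr dotNr. Qed.

Lemma dot0l a : dot 0 a = 0.
Proof. by rewrite -(scale0r a) dotZl mul0r. Qed.

Lemma dot0r a : dot a 0 = 0.
Proof. by rewrite dotC dot0l. Qed.

Lemma dot_suml (I : Type) (s : seq I) (F : I -> 'cV[R]_k) b :
  dot (\sum_(i <- s) F i) b = \sum_(i <- s) dot (F i) b.
Proof.
elim: s => [|i s IH]; first by rewrite !big_nil dot0l.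
by rewrite !big_cons dotDl IH.
Qed.

Lemma dot_delta i a : dot (delta_mx i 0) a = a i 0.
Proof.
rewrite /dot (bigD1 i) //= mxE !eqxx mul1r big1 ?addr0 // => j ji.
by rewrite mxE (negbTE ji) mul0r.
Qed.

Lemma dot_ge0 a : 0 <= dot a a.
Proof. by apply: sumr_ge0 => i _; rewrite -expr2 sqr_ge0. Qed.

Lemma vnormE a : vnorm a = Num.sqrt (dot a a).
Proof. by congr Num.sqrt; apply: eq_bigr => i _; rewrite expr2. Qed.

Lemma vnorm_ge0 a : 0 <= vnorm a.
Proof. exact: sqrtr_ge0. Qed.

Lemma vnorm_sqr a : vnorm a ^+ 2 = dot a a.
Proof. by rewrite vnormE sqr_sqrtr // dot_ge0. Qed.

Lemma vnorm_sqr_sum a : vnorm a ^+ 2 = \sum_i a i 0 ^+ 2.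
Proof. by rewrite sqr_sqrtr // sumr_ge0 // => i _; rewrite sqr_ge0. Qed.

Lemma dot_eq0 a : dot a a = 0 -> a = 0.
Proof.
move=> /eqP; rewrite psumr_eq0; last by move=> i _; rewrite -expr2 sqr_ge0.
move/allP => h; apply/colP => i; rewrite mxE.
by have := h i (mem_index_enum _); rewrite /= -expr2 sqrf_eq0 => /eqP.
Qed.

Lemma vnorm_eq0 a : vnorm a = 0 -> a = 0.
Proof. by move=> h; apply: dot_eq0; rewrite -vnorm_sqr h expr0n. Qed.

Lemma vnorm0 : vnorm (0 : 'cV[R]_k) = 0.
Proof. by rewrite vnormE dot0l sqrtr0. Qed.

Lemma vnormZ l a : vnorm (l *: a) = `|l| * vnorm a.
Proof. by rewrite !vnormE dotZl dotZr mulrA -expr2 sqrtrM ?sqr_ge0 // sqrtr_sqr. Qed.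

Lemma vnormN a : vnorm (- a) = vnorm a.
Proof. by rewrite -scaleN1r vnormZ normrN1 mul1r. Qed.

Lemma dot_le a b : dot a b <= vnorm a * vnorm b.
Proof.
have [a0|a0] := eqVneq (vnorm a) 0.
  by rewrite a0 mul0r (vnorm_eq0 _ a0) dot0l.
have [b0|b0] := eqVneq (vnorm b) 0.
  by rewrite b0 mulr0 (vnorm_eq0 _ b0) dot0r.
have pa : 0 < vnorm a by rewrite lt_def a0 vnorm_ge0.
have pb : 0 < vnorm b by rewrite lt_def b0 vnorm_ge0.
(* This square expands to [2 |a| |b| (|a| |b| - dot a b)], and both norms are positive here. *)
have := dot_ge0 (vnorm b *: a - vnorm a *: b).
rewrite !(dotBl, dotBr, dotZl, dotZr) -!vnorm_sqr (dotC b a).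
set x := vnorm a; set y := vnorm b; set d := dot a b => H.
have : 0 <= (x * y) * (x * y - d) *+ 2.
  by apply: le_trans H _; rewrite le_eqVlt; apply/orP; left; apply/eqP; ring.
by rewrite pmulrn_lge0 // pmulr_rge0 ?mulr_gt0 // subr_ge0.
Qed.

Lemma norm_dot_le a b : `|dot a b| <= vnorm a * vnorm b.
Proof.
by rewrite ler_norml dot_le andbT lerNl -dotNl -(vnormN a) dot_le.
Qed.

Lemma vnormD a b : vnorm (a + b) <= vnorm a + vnorm b.
Proof.
rewrite -(ler_pXn2r (ltn0Sn 1)) ?nnegrE ?addr_ge0 ?vnorm_ge0 //.
rewrite vnorm_sqr !(dotDl, dotDr) (dotC b a) sqrrD !vnorm_sqr.
by have := dot_le a b; lra.
Qed.

Lemma vnormB a b : vnorm (a - b) <= vnorm a + vnorm b.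
Proof. by rewrite -(vnormN b) vnormD. Qed.

Lemma vnorm_sum (I : Type) (s : seq I) (F : I -> 'cV[R]_k) :
  vnorm (\sum_(i <- s) F i) <= \sum_(i <- s) vnorm (F i).
Proof.
elim: s => [|i s IH]; first by rewrite !big_nil vnorm0.
by rewrite !big_cons (le_trans (vnormD _ _)) // lerD2l.
Qed.

Lemma coord_le_vnorm a i : `|a i 0| <= vnorm a.
Proof.
rewrite -(ler_pXn2r (ltn0Sn 1)) ?nnegrE ?vnorm_ge0 // vnorm_sqr real_normK ?num_real //.
by rewrite /dot (bigD1 i) //= -expr2 lerDl sumr_ge0 // => j _; rewrite -expr2 sqr_ge0.
Qed.

End Dot.

Lemma frob_ge0 {p q : nat} (M : 'M[R]_(p, q)) : 0 <= frob M.
Proof. exact: sqrtr_ge0. Qed.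

Lemma frob_sqr {p q : nat} (M : 'M[R]_(p, q)) : frob M ^+ 2 = \sum_i \sum_j M i j ^+ 2.
Proof.
by rewrite sqr_sqrtr // sumr_ge0 // => i _; rewrite sumr_ge0 // => j _; rewrite sqr_ge0.
Qed.

Lemma vnorm_mul_frob {p q : nat} (M : 'M[R]_(p, q)) (x : 'cV[R]_q) :
  vnorm (M *m x) <= frob M * vnorm x.
Proof.
rewrite -(ler_pXn2r (ltn0Sn 1)) ?nnegrE ?mulr_ge0 ?vnorm_ge0 ?frob_ge0 //.
rewrite exprMn frob_sqr vnorm_sqr_sum mulr_suml; apply: ler_sum => i _.
have -> : (M *m x) i 0 = dot (row i M)^T x.
  by rewrite mxE; apply: eq_bigr => j _; rewrite !mxE.
have -> : \sum_j M i j ^+ 2 = vnorm (row i M)^T ^+ 2.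
  by rewrite vnorm_sqr_sum; apply: eq_bigr => j _; rewrite !mxE.
by rewrite -exprMn -real_normK ?num_real // lerXn2r ?nnegrE ?mulr_ge0 ?vnorm_ge0 // norm_dot_le.
Qed.

(** The Frobenius norm bounds the set whose supremum is [opnorm M], so that this supremum is a
    genuine upper bound; normalizing [x] brings it into the set. *)
Lemma vnorm_mul_opnorm {p q : nat} (M : 'M[R]_(p, q)) (x : 'cV[R]_q) :
  vnorm (M *m x) <= opnorm M * vnorm x.
Proof.
have [x0|x0] := eqVneq (vnorm x) 0.
  by rewrite (vnorm_eq0 _ x0) mulmx0 !vnorm0 mulr0.
have px : 0 < vnorm x by rewrite lt_def x0 vnorm_ge0.
have nx : vnorm ((vnorm x)^-1 *: x) = 1.
  by rewrite vnormZ ger0_norm ?invr_ge0 ?vnorm_ge0 // mulVf.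
have -> : M *m x = vnorm x *: (M *m ((vnorm x)^-1 *: x)).
  by rewrite -scalemxAr scalerA divff // scale1r.
rewrite vnormZ ger0_norm ?vnorm_ge0 // mulrC ler_wpM2r ?vnorm_ge0 //.
apply: ub_le_sup; last by exists ((vnorm x)^-1 *: x).
exists (frob M) => _ [y /= ny <-].
by have := vnorm_mul_frob M y; rewrite ny mulr1.
Qed.

End Euclid.

(** * Compact balls and continuity of linear and quadratic forms *)

Section Topology.
Context {R : realType}.

Lemma cV_box_compact (k : nat) (M : R) :
  compact [set a : 'cV[R]_k | forall i, `|a i 0| <= M].
Proof.
have cb : compact [set v : 'rV[R]_k | forall i, `[- M, M]%classic (v ord0 i)].
  exact: (@rV_compact R k (fun=> `[- M, M]%classic) (fun=> @segment_compact R _ _)).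
have -> : [set a : 'cV[R]_k | forall i, `|a i 0| <= M] =
    trmx @` [set v : 'rV[R]_k | forall i, `[- M, M]%classic (v ord0 i)].
  apply/seteqP; split => [a /= ha|_ /= [v hv <-]] => [|i].
    exists a^T; last by rewrite trmxK.
    by move=> i; rewrite /= mxE in_itv /= -ler_norml.
  by have := hv i; rewrite /= mxE in_itv /= -ler_norml.
apply: continuous_compact cb.
apply: continuous_subspaceT => v A /nbhs_ballP[e /= e0 he].
apply/nbhs_ballP; exists e => //= w [_ hw]; apply: he; split => // i j.
by rewrite !mxE; exact: hw.
Qed.

Lemma continuous_sum_fun {I : Type} {T : topologicalType} (s : seq I) (f : I -> T -> R)
    (a : T) : (forall i, {for a, continuous (f i)}) ->
  {for a, continuous (fun x => \sum_(i <- s) f i x)}.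
Proof.
move=> h; elim: s => [|i s IH]; rewrite /prop_for /continuous_at.
  by under eq_fun do rewrite big_nil; rewrite big_nil; exact: cvg_cst.
by under eq_fun do rewrite big_cons; rewrite big_cons; apply: cvgD; [exact: h|exact: IH].
Qed.

Lemma continuous_1D {T : topologicalType} (f : T -> R) (a : T) :
  {for a, continuous f} -> {for a, continuous (fun x => 1 + f x)}.
Proof. by move=> h; apply: cvgD; [exact: cvg_cst|exact: h]. Qed.

Lemma dot_continuous (k : nat) (b : 'cV[R]_k) : continuous (dot b).
Proof.
move=> a; apply: continuous_sum_fun => i; apply: continuousM; first exact: cst_continuous.
exact: coord_continuous.
Qed.

Lemma dot_sqr_continuous (k : nat) : continuous (fun a : 'cV[R]_k => dot a a).
Proof.
move=> a; apply: continuous_sum_fun => i; apply: continuousM; exact: coord_continuous.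
Qed.

Lemma cV_ball_compact (k : nat) (rho : R) : 0 <= rho ->
  compact [set a : 'cV[R]_k | vnorm a <= rho].
Proof.
move=> rho0; apply: (@subclosed_compact _ _ _ _ (@cV_box_compact k rho)).
  have -> : [set a : 'cV[R]_k | vnorm a <= rho] =
      (fun a => dot a a) @^-1` [set y | y <= rho ^+ 2].
    apply/seteqP; split => a /=; rewrite -vnorm_sqr;
      by rewrite ler_pXn2r ?nnegrE ?vnorm_ge0.
  apply: preimage_closed; last exact: closed_le.
  by move=> a _; exact: dot_sqr_continuous.
by move=> a /= h i; exact: le_trans (coord_le_vnorm a i) h.
Qed.

End Topology.

(** * The empirical likelihood multiplier for fixed points [x j] *)

Section EmpiricalLikelihood.
Context {R : realType} {n k : nat} (x : 'I_n -> 'cV[R]_k).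

Let den (z : 'cV[R]_k) (j : 'I_n) := 1 + dot (x j) z.

(** The tangent bound [ln y <= y - 1] at [y = a / b]. It lets values of the log-likelihood be
    compared without differentiating it. *)
Lemma ln_concave (a b : R) : 0 < a -> 0 < b -> (b - a) / b <= ln b - ln a.
Proof.
move=> a0 b0; have ab : 0 < a / b by rewrite divr_gt0.
have := @le_ln1Dx _ (a / b - 1); rewrite addrCA subrr addr0 ln_div ?posrE //.
rewrite ltrBrDl subrr ab => /(_ isT).
have -> : (b - a) / b = 1 - a / b by field; rewrite gt_eqF.
by lra.
Qed.

(* [z] maximizes the concave function [\sum_j ln (1 + dot (x j) z)] on the ball of
   radius [rho]; an interior maximizer solves the empirical likelihood equation. *)
Lemma el_maximizer (rho : R) : 0 <= rho ->
  (forall j, rho * vnorm (x j) <= 1 / 2) ->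
  exists z, [/\ vnorm z <= rho, (forall j, 1 / 2 <= den z j) &
    forall d t0, 0 < t0 -> (forall t, 0 < t <= t0 -> vnorm (z + t *: d) <= rho) ->
      \sum_j (den z j)^-1 * dot (x j) d <= 0].
Proof.
move=> rho0 hx.
have den_ge z : vnorm z <= rho -> forall j, 1 / 2 <= den z j.
  move=> hz j; have := norm_dot_le (x j) z; rewrite ler_norml /den => /andP[h _].
  have : vnorm (x j) * vnorm z <= rho * vnorm (x j).
    by rewrite mulrC ler_wpM2r ?vnorm_ge0.
  by have := hx j; lra.
have den_gt z : vnorm z <= rho -> forall j, 0 < den z j.
  by move=> hz j; apply: lt_le_trans (den_ge z hz j); rewrite divr_gt0.
pose F z := \sum_j ln (den z j).
have cF : {within [set z | vnorm z <= rho], continuous F}.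
  apply: continuous_in_subspaceT => z; rewrite inE /= => hz.
  apply: continuous_sum_fun => j.
  apply: (@continuous_comp _ _ _ (fun y => den y j) (@ln R) z); last first.
    exact/continuous_ln/den_gt.
  by apply: continuous_1D; exact: dot_continuous.
have ne : [set z : 'cV[R]_k | vnorm z <= rho] !=set0 by exists 0; rewrite /= vnorm0.
have [z zin zmax] := compact_EVT_max ne (cV_ball_compact k rho rho0) cF.
rewrite inE /= in zin; exists z; split => // [|d t0 t0p hd]; first exact: den_ge.
rewrite leNgt; apply/negP => g0; set g := \sum_j _ in g0.
pose S := \sum_j dot (x j) d ^+ 2.
have S0 : 0 <= S by apply: sumr_ge0 => j _; rewrite sqr_ge0.
(* If the slope [g] at [z] in direction [d] were positive, a step [t] would lower it by at most
   [4 t S], as both denominators are at least 1/2. The choice of [t] makes this loss at most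
   [g / 2], so the function would still increase, against maximality; the [+ 1] avoids dividing by
   0. *)
pose t := Num.min t0 (g / (8 * (S + 1))).
have tp : 0 < t by rewrite lt_min t0p divr_gt0 // mulr_gt0 // ltr_wpDl.
have zt := hd t; rewrite tp ge_min lexx /= in zt; have {}zt := zt isT.
have dent j : den (z + t *: d) j = den z j + t * dot (x j) d.
  by rewrite /den dotDr dotZr addrA.
have /zmax : z + t *: d \in [set z | vnorm z <= rho] by rewrite inE.
rewrite -subr_le0 -sumrB => hF.
have : t * \sum_j (den (z + t *: d) j)^-1 * dot (x j) d <= 0.
  apply: le_trans hF; rewrite mulr_sumr; apply: ler_sum => j _.
  have := @ln_concave (den z j) (den (z + t *: d) j) (den_gt _ zin j) (den_gt _ zt j).
  by apply: le_trans; rewrite dent le_eqVlt; apply/orP; left; apply/eqP; ring.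
rewrite pmulr_rle0 // => hS.
have : g <= 4 * t * S.
  rewrite -[leRHS]addr0 -lerBlDl; apply: le_trans hS.
  rewrite /S mulr_sumr -sumrB; apply: ler_sum => j _.
  have p1 := den_gt _ zin j; have p2 := den_gt _ zt j.
  have h1 := den_ge _ zin j; have h2 := den_ge _ zt j.
  have -> : (den (z + t *: d) j)^-1 =
     (den z j)^-1 - t * dot (x j) d / (den z j * den (z + t *: d) j).
    by rewrite dent; field; rewrite -dent !gt_eqF.
  have : (den z j * den (z + t *: d) j)^-1 <= 4.
    rewrite -[leRHS]invrK lef_pV2 ?posrE ?mulr_gt0 //.
    by apply: le_trans (_ : 1/2 * (1/2) <= _); [lra|rewrite ler_pM].
  set q := (_ * _)^-1 => hq; set e := dot _ _.
  have : t * e ^+ 2 * q <= t * e ^+ 2 * 4.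
    by rewrite ler_wpM2l // mulr_ge0 ?sqr_ge0 // ltW.
  by rewrite /q; set p := (den z j)^-1; nra.
apply/negP; rewrite -ltNge.
have : 4 * t * S <= 4 * (g / (8 * (S + 1))) * S.
  by rewrite ler_wpM2r // ler_pM2l // ge_min lexx orbT.
move/le_lt_trans; apply.
have -> : 4 * (g / (8 * (S + 1))) * S = (g / 2) * (S / (S + 1)).
  by field; rewrite gt_eqF // ltr_wpDl.
have : S / (S + 1) <= 1 by rewrite ler_pdivrMr ?mul1r ?lerDl // ltr_wpDl.
by move=> h; have : g / 2 * (S / (S + 1)) <= g / 2 * 1;
  [rewrite ler_wpM2l //|]; lra.
Qed.

(** If the maximizer lay on the sphere, the direction [- z] would be admissible, and the slope there
    is at least [2/3 lam rho^2 - rho |mean of x| > 0], a contradiction. So it is interior, every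
    direction is admissible, and the gradient itself as direction gives [|gradient|^2 <= 0]. *)
Lemma el_exists (lam rho : R) : (0 < n)%N -> 0 < rho ->
  (forall a, lam * dot a a <= (n%:R)^-1 * \sum_j dot (x j) a ^+ 2) ->
  (forall j, rho * vnorm (x j) <= 1 / 2) ->
  3 * vnorm ((n%:R)^-1 *: \sum_j x j) < 2 * lam * rho ->
  exists z, [/\ vnorm z <= rho, (forall j, 1 / 2 <= den z j) &
    \sum_j (den z j)^-1 *: x j = 0].
Proof.
move=> n0 rho0 hlam hx hbar.
have [z [zr zd zg]] := el_maximizer rho (ltW rho0) hx.
have dp j : 0 < den z j by apply: lt_le_trans (zd j); rewrite divr_gt0.
exists z; split => //.
have zlt : vnorm z < rho.
  rewrite lt_neqAle zr andbT; apply/eqP => zrho.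
  have : \sum_j (den z j)^-1 * dot (x j) (- z) <= 0.
    apply: (zg _ 1) => // t /andP[t0 t1].
    rewrite scalerN -[z in z - _]scale1r -scalerBl vnormZ ger0_norm ?subr_ge0 //.
    by rewrite zrho ger_pMl // gerBl ltW.
  apply/negP; rewrite -ltNge.
  have nV0 : 0 < (n%:R : R)^-1 by rewrite invr_gt0 ltr0n.
  rewrite -(pmulr_rgt0 _ nV0).
  have h1 : (n%:R)^-1 * \sum_j dot (x j) z <= rho * vnorm ((n%:R)^-1 *: \sum_j x j).
    by rewrite -dot_suml -dotZl mulrC -zrho mulrC [leRHS]mulrC dot_le.
  (* With [y = dot (x j) z], [- y / (1 + y) = - y + y^2 / (1 + y)], and [1 / (1 + y) >= 2/3] because
     [y <= 1/2]. This is the origin of the factors 3 and 2 in the hypothesis on the mean. *)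
  have h2 : (n%:R)^-1 * \sum_j (2 / 3 * dot (x j) z ^+ 2 - dot (x j) z) <=
      (n%:R)^-1 * \sum_j (den z j)^-1 * dot (x j) (- z).
    rewrite ler_pM2l //; apply: ler_sum => j _.
    have p := dp j; have q := zd j.
    have y12 : dot (x j) z <= 1 / 2.
      by apply: le_trans (dot_le _ _) _; rewrite zrho mulrC.
    rewrite dotNr -subr_ge0.
    have -> : (den z j)^-1 * - dot (x j) z - (2 / 3 * dot (x j) z ^+ 2 - dot (x j) z) =
        dot (x j) z ^+ 2 * (den z j)^-1 * (1 - 2 * dot (x j) z) / 3.
      by rewrite /den in p *; field; rewrite gt_eqF.
    apply: divr_ge0 => //; apply: mulr_ge0; last by lra.
    by rewrite mulr_ge0 ?sqr_ge0 // invr_ge0 ltW.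
  apply: lt_le_trans h2; rewrite sumrB -mulr_sumr mulrBr [_ * (2 / 3 * _)]mulrCA.
  have := hlam z; rewrite -vnorm_sqr zrho => h3.
  set b := vnorm _ in h1 hbar.
  have : rho * (3 * b) < rho * (2 * lam * rho) by rewrite ltr_pM2l.
  move: h1 h3; set s1 := _^-1 * _; set s2 := _^-1 * _ => h1 h3 h4.
  by rewrite expr2 in h3; lra.
pose g := \sum_j (den z j)^-1 *: x j.
have gE : \sum_j (den z j)^-1 * dot (x j) g = dot g g.
  by rewrite {2}/g dot_suml; apply: eq_bigr => j _; rewrite dotZl.
apply: dot_eq0; apply/eqP; rewrite eq_le dot_ge0 andbT -/g -gE.
have g1 : 0 < vnorm g + 1 by rewrite ltr_wpDl ?vnorm_ge0.
(* This step length keeps [z + t g] within the ball; the [+ 1] covers [g = 0]. *)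
apply: (zg _ ((rho - vnorm z) / (vnorm g + 1))) => [|t /andP[t0]].
  by rewrite divr_gt0 // subr_gt0.
rewrite ler_pdivlMr // => ht; apply: le_trans (vnormD _ _) _.
by rewrite vnormZ ger0_norm ?(ltW t0) //; nra.
Qed.

(** Strict concavity: the difference of the two equations, paired with [z1 - z2], is a sum of the
    nonnegative terms [dot (x j) (z1 - z2)^2 / (den z1 j * den z2 j)]. They all vanish, and the
    points [x j] are assumed to determine a vector. *)
Lemma el_unique (z1 z2 : 'cV[R]_k) :
  (forall a, \sum_j dot (x j) a ^+ 2 = 0 -> a = 0) ->
  (forall j, 0 < den z1 j) -> (forall j, 0 < den z2 j) ->
  \sum_j (den z1 j)^-1 *: x j = 0 -> \sum_j (den z2 j)^-1 *: x j = 0 -> z1 = z2.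
Proof.
move=> hpos p1 p2 e1 e2; apply/eqP; rewrite -subr_eq0; apply/eqP.
have : dot (\sum_j (den z2 j)^-1 *: x j - \sum_j (den z1 j)^-1 *: x j) (z1 - z2) = 0.
  by rewrite e1 e2 subr0 dot0l.
rewrite -sumrB dot_suml => /eqP; rewrite psumr_eq0 => [/allP h|j _].
  apply: hpos; apply: big1 => j _; have := h j (mem_index_enum _).
  rewrite /= -scalerBl dotZl mulf_eq0 subr_eq0 => /orP[/eqP/invr_inj|/eqP->]; last first.
    by rewrite expr0n.
  by rewrite dotBr /den => /addrI ->; rewrite subrr expr0n.
rewrite -scalerBl dotZl.
have -> : ((den z2 j)^-1 - (den z1 j)^-1) * dot (x j) (z1 - z2) =
  dot (x j) (z1 - z2) ^+ 2 / (den z1 j * den z2 j).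
  have q1 := p1 j; have q2 := p2 j; rewrite dotBr /den in q1 q2 *.
  by field; rewrite !gt_eqF.
by rewrite divr_ge0 ?sqr_ge0 // mulr_ge0 ?ltW.
Qed.

End EmpiricalLikelihood.

(** * Averages over the sample *)

Section Averages.
Context {R : realType} {n : nat}.

Definition avg (f : 'I_n -> R) : R := (n%:R)^-1 * \sum_j f j.
Definition avgv {k : nat} (f : 'I_n -> 'cV[R]_k) : 'cV[R]_k := (n%:R)^-1 *: \sum_j f j.

Lemma ler_avg (f g : 'I_n -> R) : (forall j, f j <= g j) -> avg f <= avg g.
Proof. by move=> h; rewrite ler_wpM2l ?invr_ge0 ?ler0n // ler_sum. Qed.

Lemma avgZ (l : R) (f : 'I_n -> R) : avg (fun j => l * f j) = l * avg f.
Proof. by rewrite /avg -mulr_sumr mulrCA. Qed.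

Lemma avgD (f g : 'I_n -> R) : avg (fun j => f j + g j) = avg f + avg g.
Proof. by rewrite /avg big_split mulrDr. Qed.

Lemma avg_cst (c : R) : (0 < n)%N -> avg (fun=> c) = c.
Proof.
by move=> n0; rewrite /avg sumr_const card_ord -[c *+ n]mulr_natl mulKf // pnatr_eq0 -lt0n.
Qed.

Lemma avgv_cst (k : nat) (c : 'cV[R]_k) : (0 < n)%N -> avgv (fun=> c) = c.
Proof.
move=> n0; rewrite /avgv sumr_const card_ord -[X in _ *: X]scaler_nat scalerA mulVf ?scale1r //.
by rewrite pnatr_eq0 -lt0n.
Qed.

Lemma avgvD (k : nat) (f g : 'I_n -> 'cV[R]_k) :
  avgv (fun j => f j + g j) = avgv f + avgv g.
Proof. by rewrite /avgv big_split scalerDr. Qed.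

Lemma avgvB (k : nat) (f g : 'I_n -> 'cV[R]_k) :
  avgv (fun j => f j - g j) = avgv f - avgv g.
Proof. by rewrite /avgv sumrB scalerBr. Qed.

Lemma vnorm_avgv (k : nat) (f : 'I_n -> 'cV[R]_k) :
  vnorm (avgv f) <= avg (fun j => vnorm (f j)).
Proof.
by rewrite vnormZ ger0_norm ?invr_ge0 ?ler0n // ler_wpM2l ?invr_ge0 ?ler0n // vnorm_sum.
Qed.

Lemma dot_avgv (k : nat) (f : 'I_n -> 'cV[R]_k) b :
  dot (avgv f) b = avg (fun j => dot (f j) b).
Proof. by rewrite dotZl dot_suml. Qed.

End Averages.

(** * Deterministic second-order expansion with constants free of the dimension *)

Section Expansion.
Context {R : realType}.

(* Applied with [a = sqrt m_n], [b = sqrt n], [W = W_n], [A = E (psi v_n^T)],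
   [y] the mean of [v_n] and [p j = psi (Z_j)]. *)
Lemma el_expansion (c C Ca M : R) : 0 < c -> 0 < C -> 0 < Ca -> 0 < M ->
  exists K eta0 : R, [/\ 0 < K, 0 < eta0 &
  forall (n k r : nat) (x : 'I_n -> 'cV[R]_k) (p : 'I_n -> 'cV[R]_r)
    (W : 'M[R]_k) (A : 'M[R]_(r, k)) (y z0 : 'cV[R]_k) (a b eta : R),
    (0 < n)%N -> 1 <= a -> 0 < b -> 0 < eta <= eta0 ->
    (forall v, c * dot v v <= dot v (W *m v) <= C * dot v v) ->
    (forall v, vnorm (A *m v) <= Ca * vnorm v) ->
    W *m z0 = y ->
    (forall j, vnorm (x j) <= eta * (b / a ^+ 3)) ->
    (forall v, vnorm (avgv (fun j => dot (x j) v *: x j) - W *m v) <= eta / a ^+ 2 * vnorm v) ->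
    (forall v, vnorm (avgv (fun j => dot (x j) v *: p j) - A *m v) <= eta / a * vnorm v) ->
    vnorm (avgv x - y) <= eta / (a * b) ->
    vnorm y <= M * (a / b) ->
    avg (fun j => vnorm (p j) ^+ 2) <= M ^+ 2 ->
    exists z, [/\ (forall j, 0 < 1 + dot (x j) z),
      \sum_j (1 + dot (x j) z)^-1 *: x j = 0,
      (forall z', (forall j, 0 < 1 + dot (x j) z') ->
         \sum_j (1 + dot (x j) z')^-1 *: x j = 0 -> z' = z) &
      vnorm (avgv (fun j => (1 + dot (x j) z)^-1 *: p j) - (avgv p - A *m z0))
        <= K * eta / b]].
Proof.
move=> c0 C0 Ca0 M0.
(* In units of [a / b], [B] bounds the mean of the [x j] and [L] is the radius of the ball. With
   lower eigenvalue bound [c / 2], the existence lemma asks for [3 B < c L], and [c L = 4 B]. *)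
pose B := M + 1; pose L := 4 * B / c.
have B0 : 0 < B by rewrite /B; lra.
have L0 : 0 < L by rewrite /L !mulr_gt0 ?invr_gt0.
(* [K2] will bound [W z - y] in units of [eta / (a b)]: its terms come from the error of the
   empirical second moment, from the quadratic remainder, and from the error of the mean. *)
pose K2 := L + 2 * (C + 1) * L ^+ 2 + 1.
have C10 : 0 < C + 1 by lra.
have CL0 : 0 < (C + 1) * L ^+ 2 by rewrite mulr_gt0 // exprn_gt0.
have K20 : 0 < K2 by rewrite /K2; lra.
have ML0 : 0 < L ^+ 2 * (M ^+ 2 + (C + 1)).
  by rewrite mulr_gt0 ?exprn_gt0 // addr_gt0 // exprn_gt0.
(* The three terms bound the error of the empirical cross moment, [A (z - z0)], and the quadratic
   remainder weighted by [p]. In [eta0] below, 1 and [c / 2] keep the empirical quadratic form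
   between [c / 2] and [C + 1], and [1 / (2 L)] gives [rho |x j| <= 1/2]. *)
exists (L + Ca * (K2 / c) + L ^+ 2 * (M ^+ 2 + (C + 1))).
exists (Num.min 1 (Num.min (c / 2) (1 / (2 * L)))).
split=> [||n k r x p W A y z0 a b eta n0 a1 b0].
- by rewrite !addr_gt0 // mulr_gt0 // divr_gt0.
- by rewrite !lt_min ltr01 !divr_gt0 // mulr_gt0.
rewrite !le_min => /and4P[eta0 eta1 etac etaL] hW hA hz0 hx hWh hDh hxy hy hp.
have a0 : 0 < a by lra.
pose rho := L * (a / b).
have rho0 : 0 < rho by rewrite mulr_gt0 // divr_gt0.
have a2 : 1 <= a ^+ 2 by rewrite exprn_ege1.
have etaa : eta / a ^+ 2 <= eta.
  by rewrite ler_pdivrMr ?exprn_gt0 // ler_peMr // ltW.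
have quad v : avg (fun j => dot (x j) v ^+ 2) = dot (avgv (fun j => dot (x j) v *: x j)) v.
  by rewrite dot_avgv; congr (_ * _); apply: eq_bigr => j _; rewrite dotZl expr2.
have quadW v : `|avg (fun j => dot (x j) v ^+ 2) - dot v (W *m v)| <= eta * dot v v.
  rewrite quad (dotC v) -dotBl; apply: le_trans (norm_dot_le _ _) _.
  rewrite -vnorm_sqr expr2 mulrA ler_wpM2r ?vnorm_ge0 //.
  by apply: le_trans (hWh v) _; rewrite ler_wpM2r ?vnorm_ge0.
have quad_lo v : c / 2 * dot v v <= avg (fun j => dot (x j) v ^+ 2).
  have := quadW v; rewrite ler_norml => /andP[h _].
  have /andP[h1 _] := hW v; have := ler_wpM2r (dot_ge0 v) etac; lra.
have quad_hi v : avg (fun j => dot (x j) v ^+ 2) <= (C + 1) * dot v v.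
  have := quadW v; rewrite ler_norml => /andP[_ h].
  have /andP[_ h1] := hW v; have := ler_wpM2r (dot_ge0 v) eta1; lra.
have hxr j : rho * vnorm (x j) <= L * (eta / a ^+ 2).
  apply: le_trans (ler_wpM2l (ltW rho0) (hx j)) _.
  by rewrite le_eqVlt; apply/orP; left; apply/eqP; rewrite /rho; field; rewrite !gt_eqF.
have etaL2 : L * eta <= 1 / 2.
  by rewrite mulrC -ler_pdivlMr // (le_trans etaL) // invfM mul1r mul1r mulrC.
have hx12 j : rho * vnorm (x j) <= 1 / 2.
  by apply: le_trans (hxr j) _; apply: le_trans (_ : L * eta <= _) => //; rewrite ler_pM2l.
have hbar : vnorm (avgv x) <= B * (a / b).
  rewrite -(subrK y (avgv x)); apply: le_trans (vnormD _ _) _.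
  rewrite /B mulrDl addrC lerD // mul1r; apply: le_trans hxy _.
  rewrite ler_pdivrMr ?mulr_gt0 // (_ : a / b * (a * b) = a ^+ 2); first by lra.
  by field; rewrite gt_eqF.
have [z [zr zd zsol]] : exists z, [/\ vnorm z <= rho, (forall j, 1 / 2 <= 1 + dot (x j) z) &
    \sum_j (1 + dot (x j) z)^-1 *: x j = 0].
  apply: (el_exists x (c / 2) rho) => //.
  apply: le_lt_trans (_ : 3 * (B * (a / b)) < _); first by rewrite ler_pM2l.
  rewrite /rho /L (_ : 2 * (c / 2) * _ = 4 * (B * (a / b))); last first.
    by field; rewrite !gt_eqF.
  by rewrite ltr_pM2r ?mulr_gt0 ?invr_gt0 //; lra.
have dp j : 0 < 1 + dot (x j) z by apply: lt_le_trans (zd j); rewrite divr_gt0.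
have nV0 : 0 < (n%:R : R)^-1 by rewrite invr_gt0 ltr0n.
exists z; split => // [z' dp' zsol'|].
  apply: (el_unique x) => // v hv; apply: dot_eq0; apply/eqP.
  rewrite eq_le dot_ge0 andbT; have := quad_lo v.
  by rewrite /avg hv mulr0 pmulr_rle0 // divr_gt0.
(* The exact remainder in [1 / (1 + t) = 1 - t + t^2 / (1 + t)]; it is at most [2 t^2] because
   [1 + t >= 1/2]. *)
pose w j := dot (x j) z ^+ 2 / (1 + dot (x j) z).
have w0 j : 0 <= w j by rewrite divr_ge0 ?sqr_ge0 // ltW.
have wle j : w j <= 2 * dot (x j) z ^+ 2.
  rewrite mulrC ler_wpM2l ?sqr_ge0 // -[leRHS]invrK lef_pV2 ?posrE ?invr_gt0 //.
  by have := zd j; lra.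
have wE j : (1 + dot (x j) z)^-1 = 1 - dot (x j) z + w j.
  by rewrite /w; field; rewrite gt_eqF.
have split_avg (q : nat) (f : 'I_n -> 'cV[R]_q) :
    avgv (fun j => (1 + dot (x j) z)^-1 *: f j) =
    avgv f - avgv (fun j => dot (x j) z *: f j) + avgv (fun j => w j *: f j).
  rewrite -avgvB -avgvD; congr (_ *: _); apply: eq_bigr => j _.
  by rewrite wE scalerDl scalerBl scale1r.
have absz j : `|dot (x j) z| <= L * (eta / a ^+ 2).
  apply: le_trans (norm_dot_le _ _) _; rewrite mulrC.
  by apply: le_trans (hxr j); rewrite ler_wpM2r ?vnorm_ge0.
have zz : dot z z <= rho ^+ 2.
  by rewrite -vnorm_sqr ler_pXn2r // ?nnegrE ?vnorm_ge0 // ltW.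
have quadz : avg (fun j => dot (x j) z ^+ 2) <= (C + 1) * rho ^+ 2.
  by apply: le_trans (quad_hi z) _; rewrite ler_wpM2l //; lra.
(* One factor [|x j|] is bounded uniformly by [eta b / a^3], the other two through the quadratic
   form by a multiple of [rho^2], of order [a^2 / b^2]: the exponent 3 is what this product
   needs. *)
have rem1 : vnorm (avgv (fun j => w j *: x j)) <= 2 * (C + 1) * L ^+ 2 * (eta / (a * b)).
  apply: le_trans (vnorm_avgv _ _) _.
  apply: le_trans (_ : avg (fun j => 2 * (eta * (b / a ^+ 3)) * dot (x j) z ^+ 2) <= _).
    apply: ler_avg => j; rewrite vnormZ ger0_norm // [_ * dot _ _ ^+ 2]mulrAC.
    by rewrite ler_pM ?vnorm_ge0.
  rewrite avgZ; apply: le_trans (_ : 2 * (eta * (b / a ^+ 3)) * ((C + 1) * rho ^+ 2) <= _).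
    by rewrite ler_wpM2l // !mulr_ge0 ?invr_ge0 ?exprn_ge0 // ltW.
  by rewrite le_eqVlt; apply/orP; left; apply/eqP; rewrite /rho; field; rewrite !gt_eqF.
have Wzy : vnorm (W *m z - y) <= K2 * (eta / (a * b)).
  have e0 : avgv (fun j => dot (x j) z *: x j) = avgv x + avgv (fun j => w j *: x j).
    have := split_avg _ x; rewrite /avgv zsol scaler0 => /esym/eqP.
    by rewrite addrAC subr_eq0 => /eqP.
  have -> : W *m z - y = - (avgv (fun j => dot (x j) z *: x j) - W *m z) +
      avgv (fun j => w j *: x j) + (avgv x - y).
    by rewrite e0; apply/colP => i; rewrite !mxE; ring.
  apply: le_trans (vnormD _ _) _; rewrite /K2 [leRHS]mulrDl mul1r lerD //.
  apply: le_trans (vnormD _ _) _; rewrite [leRHS]mulrDl lerD // vnormN.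
  apply: le_trans (hWh z) _; apply: le_trans (_ : eta / a ^+ 2 * rho <= _).
    by rewrite ler_wpM2l // divr_ge0 ?exprn_ge0 // ltW.
  by rewrite le_eqVlt; apply/orP; left; apply/eqP; rewrite /rho; field; rewrite !gt_eqF.
(* Coercivity: [c |d|^2 <= dot d (W d) <= |d| |W d|] with [d = z - z0] and [W d = W z - y]. *)
have zz0 : vnorm (z - z0) <= K2 / c * (eta / (a * b)).
  rewrite mulrAC ler_pdivlMr //.
  have [->|nz] := eqVneq (vnorm (z - z0)) 0.
    by rewrite mul0r !mulr_ge0 ?invr_ge0 // ?mulr_ge0 // ltW.
  have pz : 0 < vnorm (z - z0) by rewrite lt_def nz vnorm_ge0.
  rewrite -(ler_pM2r pz) mulrAC -expr2 mulrC vnorm_sqr.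
  have /andP[h _] := hW (z - z0); apply: le_trans h _.
  rewrite mulmxBr hz0 dotC; apply: le_trans (dot_le _ _) _.
  by rewrite ler_wpM2r ?vnorm_ge0.
(* Only the mean square of [|p j|] is controlled. One factor [|dot (x j) z|] is bounded uniformly,
   and [2 |dot (x j) z| |p j| <= rho |p j|^2 + |dot (x j) z|^2 / rho] splits the rest into two
   averages of the same order [rho]. *)
have rem2 : vnorm (avgv (fun j => w j *: p j)) <= L ^+ 2 * (M ^+ 2 + (C + 1)) * (eta / b).
  apply: le_trans (vnorm_avgv _ _) _.
  apply: le_trans (_ : avg (fun j => L * (eta / a ^+ 2) * (rho * vnorm (p j) ^+ 2 +
     rho^-1 * dot (x j) z ^+ 2)) <= _).
    apply: ler_avg => j; rewrite vnormZ ger0_norm //.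
    apply: le_trans (_ : 2 * dot (x j) z ^+ 2 * vnorm (p j) <= _).
      by rewrite ler_wpM2r ?vnorm_ge0.
    rewrite -(real_normK (num_real (dot (x j) z))).
    set e := `|_|; have e0 : 0 <= e by rewrite /e.
    apply: le_trans (_ : e * (2 * e * vnorm (p j)) <= _).
      by rewrite le_eqVlt; apply/orP; left; apply/eqP; ring.
    apply: ler_pM => //; first by rewrite !mulr_ge0 ?vnorm_ge0.
      exact: absz.
    have -> : rho * vnorm (p j) ^+ 2 + rho^-1 * e ^+ 2 =
       2 * e * vnorm (p j) + rho^-1 * (rho * vnorm (p j) - e) ^+ 2.
      by field; rewrite gt_eqF.
    by rewrite lerDl mulr_ge0 ?sqr_ge0 // invr_ge0 ltW.
  rewrite avgZ avgD !avgZ.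
  apply: le_trans (_ : L * (eta / a ^+ 2) * (rho * M ^+ 2 + rho^-1 * ((C + 1) * rho ^+ 2)) <= _).
    rewrite ler_pM2l ?mulr_gt0 ?invr_gt0 ?exprn_gt0 //.
    by rewrite lerD // ler_pM2l ?invr_gt0.
  have -> : L * (eta / a ^+ 2) * (rho * M ^+ 2 + rho^-1 * ((C + 1) * rho ^+ 2)) =
     L ^+ 2 * (M ^+ 2 + (C + 1)) * (eta / b) * a^-1.
    by rewrite /rho; field; rewrite !gt_eqF.
  by rewrite ger_pMr ?invf_le1 // mulr_gt0 // divr_gt0.
rewrite split_avg.
have -> : avgv p - avgv (fun j => dot (x j) z *: p j) + avgv (fun j => w j *: p j) -
   (avgv p - A *m z0) = - (avgv (fun j => dot (x j) z *: p j) - A *m z) - A *m (z - z0) +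
   avgv (fun j => w j *: p j).
  by rewrite mulmxBr; apply/colP => i; rewrite !mxE; ring.
apply: le_trans (vnormD _ _) _; rewrite -mulrA [leRHS]mulrDl lerD //.
apply: le_trans (vnormB _ _) _; rewrite [leRHS]mulrDl vnormN lerD //.
  apply: le_trans (hDh z) _; apply: le_trans (_ : eta / a * rho <= _).
    by rewrite ler_wpM2l // divr_ge0 // ltW.
  by rewrite le_eqVlt; apply/orP; left; apply/eqP; rewrite /rho; field; rewrite !gt_eqF.
apply: le_trans (hA _) _; rewrite -mulrA ler_pM2l //; apply: le_trans zz0 _.
rewrite ler_pM2l ?divr_gt0 // ler_pM2l // lef_pV2 ?posrE ?mulr_gt0 //.
by rewrite ler_peMl // ltW.
Qed.

End Expansion.

(** * Real-valued expectations and Markov's inequality *)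

Notation integ P f := (P.-integrable setT (EFin \o f)).

Section Integration.
Context {R : realType} {d} {T : measurableType d} (P : probability T R).
Implicit Types f g : T -> R.

Lemma integ_mfun f : integ P f -> measurable_fun setT f.
Proof. by move=> /measurable_int /measurable_EFinP. Qed.

Lemma eq_integ f g : f =1 g -> integ P f -> integ P g.
Proof. by move=> /funext ->. Qed.

Lemma integ_le f g : measurable_fun setT f -> (forall x, `|f x| <= g x) ->
  integ P g -> integ P f.
Proof.
move=> mf h ig; apply: le_integrable ig => //; first exact/measurable_EFinP.
by move=> x _ /=; rewrite lee_fin (le_trans (h x)) // ler_norm.
Qed.

Lemma integ_cst (c : R) : integ P (fun=> c).
Proof. exact: finite_measure_integrable_cst. Qed.

Lemma integ_bnd f (M : R) : measurable_fun setT f -> (forall x, `|f x| <= M) ->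
  integ P f.
Proof. by move=> mf h; apply: integ_le h (integ_cst M). Qed.

Lemma integD f g : integ P f -> integ P g -> integ P (fun x => f x + g x).
Proof. by move=> h1 h2; have := integrableD measurableT h1 h2. Qed.

Lemma integZ (c : R) f : integ P f -> integ P (fun x => c * f x).
Proof. by move=> h; have := integrableZl measurableT c h. Qed.

Lemma integB f g : integ P f -> integ P g -> integ P (fun x => f x - g x).
Proof. by move=> h1 h2; have := integrableB measurableT h1 h2. Qed.

Lemma integ_sum (I : Type) (s : seq I) (F : I -> T -> R) :
  (forall i, integ P (F i)) -> integ P (fun x => \sum_(i <- s) F i x).
Proof.
move=> h; elim: s => [|i s IH].
  by apply: eq_integ (integ_cst 0) => x; rewrite big_nil.
by apply: eq_integ (integD _ _ (h i) IH) => x; rewrite big_cons.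
Qed.

Lemma eq_expect g f : f =1 g -> \int[P]_x f x = \int[P]_x g x.
Proof. by move=> /funext ->. Qed.

Lemma expectD f g : integ P f -> integ P g ->
  \int[P]_x (f x + g x) = \int[P]_x f x + \int[P]_x g x.
Proof. exact: RintegralD. Qed.

Lemma expectB f g : integ P f -> integ P g ->
  \int[P]_x (f x - g x) = \int[P]_x f x - \int[P]_x g x.
Proof. exact: RintegralB. Qed.

Lemma expectZ (c : R) f : integ P f -> \int[P]_x (c * f x) = c * \int[P]_x f x.
Proof. exact: RintegralZl. Qed.

Lemma expect_cst (c : R) : \int[P]_x c = c.
Proof. by rewrite /Rintegral integral_cst // [X in (_ * X)%E](@probability_setT _ _ _ P) mule1. Qed.

Lemma expect_sum (I : Type) (s : seq I) (F : I -> T -> R) :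
  (forall i, integ P (F i)) ->
  \int[P]_x (\sum_(i <- s) F i x) = \sum_(i <- s) \int[P]_x F i x.
Proof.
move=> h; elim: s => [|i s IH].
  rewrite big_nil; under eq_Rintegral do rewrite big_nil.
  by rewrite expect_cst.
rewrite big_cons -IH; under eq_Rintegral do rewrite big_cons.
by rewrite expectD //; exact: integ_sum.
Qed.

Lemma expect_le f g : integ P f -> integ P g -> (forall x, f x <= g x) ->
  \int[P]_x f x <= \int[P]_x g x.
Proof. by move=> h1 h2 h; apply: le_Rintegral. Qed.

Lemma expect_ge0 f : (forall x, 0 <= f x) -> 0 <= \int[P]_x f x.
Proof. by move=> h; apply: Rintegral_ge0. Qed.

Lemma expect_norm f : integ P f -> `|\int[P]_x f x| <= \int[P]_x `|f x|.
Proof. exact: le_normr_Rintegral. Qed.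

Lemma EFin_expect f : integ P f -> (\int[P]_x f x)%:E = (\int[P]_x (f x)%:E)%E.
Proof. by move=> h; rewrite fineK //; exact: integrable_fin_num. Qed.

Lemma expect_bnd f (M : R) : measurable_fun setT f -> (forall x, `|f x| <= M) ->
  `|\int[P]_x f x| <= M.
Proof.
move=> mf h; apply: le_trans (expect_norm _ (integ_bnd f M mf h)) _.
rewrite -[leRHS]expect_cst; apply: expect_le => //; last exact: integ_cst.
exact/(integrable_norm (integ_bnd f M mf h)).
Qed.

Lemma ge0_integ f : measurable_fun setT f -> (forall x, 0 <= f x) ->
  (\int[P]_x (f x)%:E < +oo)%E -> integ P f.
Proof.
move=> mf f0 h; apply/integrableP; split; first exact/measurable_EFinP.
by under eq_integral do rewrite /= ger0_norm //.
Qed.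

Lemma markov_ge f (e t : R) : integ P f -> (forall x, 0 <= f x) ->
  \int[P]_x f x <= e -> 0 < t ->
  measurable [set x | t <= f x] /\ (P [set x | (t <= f x)%R] <= (e / t)%:E)%E.
Proof.
move=> fi f0 fe t0; have mf := integ_mfun f fi.
have mS : measurable [set x | t <= f x].
  rewrite -[X in measurable X]setTI.
  have := mf measurableT _ (measurable_itv `[t, +oo[).
  by congr measurable; apply/seteqP; split => x /=; rewrite in_itv /= andbT.
split => //.
have h := le_integral_abse P measurableT (measurable_int P fi) t0.
rewrite EFinM lee_pdivlMr // muleC.
apply: le_trans (_ : \int[P]_x (f x)%:E <= _)%E; last by rewrite -EFin_expect ?lee_fin.
under eq_integral do rewrite -[f _](ger0_norm (f0 _)).
apply: le_trans h; rewrite setTI le_eqVlt; apply/orP; left; apply/eqP.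
congr (_ * P _)%E; apply/seteqP; split => x /=; by rewrite lee_fin ger0_norm.
Qed.

End Integration.

(** * Square-integrable functions and the Cauchy-Schwarz inequality *)

Section SquareIntegrable.
Context {R : realType} {d} {T : measurableType d} (P : probability T R).
Implicit Types f g : T -> R.

Definition sqint f := measurable_fun setT f /\ integ P (fun x => f x ^+ 2).

Lemma sqint_mul f g : sqint f -> sqint g -> integ P (fun x => f x * g x).
Proof.
move=> [mf f2] [mg g2]; apply: (integ_le P _ (fun x => f x ^+ 2 + g x ^+ 2)).
- exact: measurable_funM.
- move=> x; rewrite ler_norml; have := sqr_ge0 (f x + g x).
  have := sqr_ge0 (f x - g x); have := sqr_ge0 (f x); have := sqr_ge0 (g x).
  by move=> *; apply/andP; split; lra.
- exact: integD.
Qed.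

Lemma sqint_bnd f (M : R) : measurable_fun setT f -> (forall x, `|f x| <= M) -> sqint f.
Proof.
move=> mf h; split => //; apply: (integ_bnd P _ (M ^+ 2)); first exact: measurable_funX.
by move=> x; rewrite normrX lerXn2r ?nnegrE // (le_trans _ (h x)).
Qed.

Lemma sqint_cst (c : R) : sqint (fun=> c).
Proof. by apply: (sqint_bnd _ `|c|). Qed.

Lemma sqint_integ f : sqint f -> integ P f.
Proof.
by move=> h; apply: eq_integ (sqint_mul _ _ (sqint_cst 1) h) => x; rewrite mul1r.
Qed.

Lemma sqintD f g : sqint f -> sqint g -> sqint (fun x => f x + g x).
Proof.
move=> hf hg; have [mf f2] := hf; have [mg g2] := hg.
split; first exact: measurable_funD.
apply: eq_integ (integD _ _ _ (integD _ _ _ f2 g2) (integZ _ 2 _ (sqint_mul _ _ hf hg))).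
by move=> x; rewrite /= sqrrD; ring.
Qed.

Lemma sqintZ (c : R) f : sqint f -> sqint (fun x => c * f x).
Proof.
move=> [mf f2]; split; first exact: measurable_funM.
by apply: eq_integ (integZ _ (c ^+ 2) _ f2) => x; rewrite exprMn.
Qed.

Lemma eq_sqint f g : f =1 g -> sqint f -> sqint g.
Proof. by move=> /funext ->. Qed.

Lemma sqintB f g : sqint f -> sqint g -> sqint (fun x => f x - g x).
Proof.
move=> hf hg; apply: eq_sqint (sqintD _ _ hf (sqintZ (-1) _ hg)) => x.
by rewrite mulN1r.
Qed.

Lemma sqint_sum (I : Type) (s : seq I) (F : I -> T -> R) :
  (forall i, sqint (F i)) -> sqint (fun x => \sum_(i <- s) F i x).
Proof.
move=> h; elim: s => [|i s IH].
  by apply: eq_sqint (sqint_cst 0) => x; rewrite big_nil.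
by apply: eq_sqint (sqintD _ _ (h i) IH) => x; rewrite big_cons.
Qed.

Lemma cauchy_schwarz_expect f g : sqint f -> sqint g ->
  (\int[P]_x (f x * g x)) ^+ 2 <= \int[P]_x (f x ^+ 2) * \int[P]_x (g x ^+ 2).
Proof.
move=> hf hg; have [_ f2] := hf; have [_ g2] := hg; have fg := sqint_mul _ _ hf hg.
set a := \int[P]_x (f x ^+ 2); set b := \int[P]_x (f x * g x).
set c := \int[P]_x (g x ^+ 2).
have c0 : 0 <= c by rewrite /c; apply: expect_ge0 => x; exact: sqr_ge0.
have a0 : 0 <= a by rewrite /a; apply: expect_ge0 => x; exact: sqr_ge0.
(* This is the expectation of [(f - t g)^2]. If [c = 0], the value [t = (a + 1) / (2 b)] would make
   it -1 unless [b = 0]; otherwise [t = b / c] is optimal. *)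
have H t : 0 <= a - 2 * t * b + t ^+ 2 * c.
  rewrite /a /b /c -!expectZ // -expectB -?expectD //; try exact: integZ.
    by apply: expect_ge0 => x; have := sqr_ge0 (f x - t * g x); lra.
  by apply: integB => //; exact: integZ.
have [c00|cn0] := eqVneq c 0.
  have [->|bn0] := eqVneq b 0; first by rewrite expr0n /= mulr_ge0.
  have := H ((a + 1) / (2 * b)); rewrite c00 mulr0 addr0.
  have -> : 2 * ((a + 1) / (2 * b)) * b = a + 1 by field.
  by lra.
have := H (b / c).
have -> : a - 2 * (b / c) * b + (b / c) ^+ 2 * c = (a * c - b ^+ 2) / c by field.
by rewrite pmulr_lge0 ?invr_gt0 ?lt_def ?cn0 // subr_ge0.
Qed.

End SquareIntegrable.

(** * From indicators to functions: image laws and independence *)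

Section Factorization.
Context {R : realType} {dO d} {Om : measurableType dO} {T : measurableType d}
  (mu : {measure set Om -> \bar R}) (Q : probability T R)
  (X : Om -> T) (mX : measurable_fun setT X).

Import HBNNSimple.

(** The hypothesis is the case of an indicator [h]; linearity gives simple functions and monotone
    convergence the rest. One statement covers a change of variables ([F = 1]), independence ([c]
    the mean of [F]) and a density ([mu] Lebesgue measure, [X] the identity), which is why [mu] is
    an arbitrary measure. *)
Lemma ge0_factorization (F : Om -> R) (c : R) (h : T -> R) :
  measurable_fun setT F -> (forall w, 0 <= F w) ->
  (forall A, measurable A -> (\int[mu]_w (F w * \1_A (X w))%:E = c%:E * Q A)%E) ->
  measurable_fun setT h -> (forall z, 0 <= h z) ->
  (\int[mu]_w (F w * h (X w))%:E = c%:E * \int[Q]_z (h z)%:E)%E.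
Proof.
move=> mF F0 hA mh h0.
have mhE : measurable_fun setT (EFin \o h) by exact/measurable_EFinP.
pose g := nnsfun_approx measurableT mhE.
have gcvg z : EFin \o g^~ z @ \oo --> (h z)%:E.
  by apply: (cvg_nnsfun_approx measurableT mhE) => // x _; rewrite lee_fin.
have gnd z : nondecreasing_seq (g^~ z).
  by move=> a b ab; exact/lefP/nd_nnsfun_approx.
have mind k (A : set T) : measurable A -> measurable_fun setT (fun w => F w * (k * \1_A (X w))).
  move=> mA; apply: measurable_funM => //; apply: measurable_funM => //.
  exact: measurableT_comp.
have simple n : (\int[mu]_w (F w * g n (X w))%:E = c%:E * \int[Q]_z (g n z)%:E)%E.
  have mpre k : measurable (g n @^-1` [set k]).
    by rewrite -[X in measurable X]setTI; exact: measurable_funP.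
  have ind0 k z : 0 <= k * \1_(g n @^-1` [set k]) z.
    by rewrite indicE; case: (boolP (_ \in _)); rewrite ?mulr0 // inE /= => <-; rewrite mulr1.
  rewrite integralT_nnsfun sintegralE ge0_mule_fsumr; last first.
    by move=> y; exact: nnsfun_mulemu_ge0.
  transitivity (\int[mu]_w \sum_(k \in range (g n))
      (F w * (k * \1_(g n @^-1` [set k]) (X w)))%:E)%E.
    apply: eq_integral => w _; rewrite fimfunE !fsbig_finite //= mulr_sumr.
    by rewrite -sumEFin.
  rewrite ge0_integral_fsum //; last 2 first.
  - by move=> k; exact/measurable_EFinP/mind.
  - by move=> k w _; rewrite lee_fin mulr_ge0.
  apply: eq_fsbigr => k _.
  have [k0|k0] := leP 0 k.
    under eq_integral do rewrite mulrCA EFinM.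
    rewrite ge0_integralZl_EFin //.
    - by rewrite hA // muleCA.
    - by move=> w _; rewrite lee_fin mulr_ge0.
    - by apply/measurable_EFinP; apply: eq_measurable_fun (mind 1 _ (mpre k)) => w _; rewrite mul1r.
  (* A negative [k] has empty preimage, so both sides are 0 although [k] cannot be moved out of an
     integral of nonnegative functions. *)
  have e0 : g n @^-1` [set k] = set0.
    by apply/seteqP; split => z //= e; move: k0; rewrite -e ltNge; case/negP.
  rewrite e0 measure0 !mule0 integral0_eq // => w _.
  by rewrite indicE in_set0 !mulr0.
have mono n : measurable_fun setT (fun w => (F w * g n (X w))%:E).
  by apply/measurable_EFinP; apply: measurable_funM => //; exact: measurableT_comp.
transitivity (limn (fun n => \int[mu]_w (F w * g n (X w))%:E))%E.
  rewrite -monotone_convergence //.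
  - apply: eq_integral => w _; apply/esym/cvg_lim => //.
    by under eq_fun do rewrite EFinM; rewrite EFinM; apply: cvgeZl => //; exact: gcvg.
  - by move=> n w _; rewrite lee_fin mulr_ge0.
  - by move=> w _ a b ab; rewrite lee_fin ler_wpM2l // gnd.
under eq_fun do rewrite simple.
apply/cvg_lim => //.
have cQ : (\int[Q]_z (g n z)%:E)%E @[n --> \oo] --> (\int[Q]_z (h z)%:E)%E.
  have -> : (\int[Q]_z (h z)%:E = \int[Q]_z limn (fun n => (g n z)%:E))%E.
    by apply: eq_integral => z _; apply/esym/cvg_lim => //; exact: gcvg.
  apply: cvg_monotone_convergence => //.
  - by move=> n; exact/measurable_EFinP.
  - by move=> n z _; rewrite lee_fin.
  - by move=> z _ a b ab; rewrite lee_fin gnd.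
exact: cvgeZl.
Qed.

End Factorization.

Section Law.
Context {R : realType} {dO d} {Om : measurableType dO} {T : measurableType d}
  (P : probability Om R) (Q : probability T R) (X : Om -> T) (mX : measurable_fun setT X).

Hypothesis (lawX : forall A, measurable A -> P (X @^-1` A) = Q A).

Lemma ge0_integral_law (h : T -> R) : measurable_fun setT h -> (forall z, 0 <= h z) ->
  (\int[P]_w (h (X w))%:E = \int[Q]_z (h z)%:E)%E.
Proof.
move=> mh h0; have := @ge0_factorization _ _ _ _ _ P Q X mX (fun=> 1) 1 h _ _ _ mh h0.
rewrite mul1e => <- //; first by apply: eq_integral => w _; rewrite mul1r.
move=> A mA; rewrite mul1e -lawX //.
have mXA : measurable (X @^-1` A) by rewrite -[X in measurable X]setTI; exact: mX.
rewrite -[X in P X]setIT -[RHS](integral_indic P measurableT mXA).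
by apply: eq_integral => w _; rewrite mul1r.
Qed.

Lemma integ_law (h : T -> R) : integ Q h -> integ P (fun w => h (X w)).
Proof.
move=> hi; have mh := integ_mfun Q h hi; apply/integrableP; split.
  by apply/measurable_EFinP; exact: measurableT_comp.
rewrite (@ge0_integral_law (fun z => `|h z|)) //; last exact: measurableT_comp.
by have /integrableP[_] := hi.
Qed.

Lemma expect_law (h : T -> R) : integ Q h -> \int[P]_w h (X w) = \int[Q]_z h z.
Proof.
move=> hi; have mh := integ_mfun Q h hi.
(* A difference of two nonnegative integrable functions, to which the nonnegative case applies. *)
have e z : h z = (`|h z| + h z) - `|h z| by rewrite addrC addKr.
have i1 := integrable_norm hi; have i2 := integD Q _ _ i1 hi.
rewrite (eq_expect P (fun w => (`|h (X w)| + h (X w)) - `|h (X w)|)) //.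
rewrite [RHS](eq_expect Q (fun z => (`|h z| + h z) - `|h z|)) //.
rewrite expectB; [|exact: integ_law i2|exact: integ_law i1].
rewrite expectB //.
rewrite /Rintegral (@ge0_integral_law (fun z => `|h z|)) //; last exact: measurableT_comp.
rewrite (@ge0_integral_law (fun z => `|h z| + h z)) //.
  by apply: measurable_funD => //; exact: measurableT_comp.
by move=> z; have := ler_norm (- h z); rewrite normrN; lra.
Qed.

Lemma sqint_law (h : T -> R) : sqint Q h -> sqint P (fun w => h (X w)).
Proof. by move=> [mh h2]; split; [exact: measurableT_comp|exact: integ_law h2]. Qed.

(** Adding the common bound [M] to both factors makes them nonnegative. In the expanded identity for
    the shifted factors all terms containing [M] agree on the two sides and cancel. *)
Lemma bounded_factorization (F : Om -> R) (h : T -> R) (M : R) :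
  measurable_fun setT F -> (forall w, `|F w| <= M) ->
  measurable_fun setT h -> (forall z, `|h z| <= M) ->
  (forall A, measurable A ->
    \int[P]_w (F w * \1_A (X w)) = \int[P]_w F w * fine (Q A)) ->
  \int[P]_w (F w * h (X w)) = \int[P]_w F w * \int[Q]_z h z.
Proof.
move=> mF bF mh bh hA.
have iF : integ P F := integ_bnd P F M mF bF.
have ih : integ Q h := integ_bnd Q h M mh bh.
have ihX := integ_law _ ih.
have bnd2 (g1 g2 : Om -> R) : measurable_fun setT g1 -> (forall w, `|g1 w| <= M) ->
    measurable_fun setT g2 -> (forall w, `|g2 w| <= M) -> integ P (fun w => g1 w * g2 w).
  move=> m1 b1 m2 b2; apply: (integ_bnd P _ (M * M)); first exact: measurable_funM.
  by move=> w; rewrite normrM ler_pM.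
have iFh : integ P (fun w => F w * h (X w)).
  by apply: bnd2 => //; exact: measurableT_comp.
pose F' w := F w + M; pose h' z := h z + M.
have iF' : integ P F' by apply: integD => //; exact: integ_cst.
have ih' : integ Q h' by apply: integD => //; exact: integ_cst.
have F'0 w : 0 <= F' w by have := bF w; rewrite ler_norml /F' => /andP[]; lra.
have h'0 z : 0 <= h' z by have := bh z; rewrite ler_norml /h' => /andP[]; lra.
have iF'h' : integ P (fun w => F' w * h' (X w)).
  apply: (integ_bnd P _ ((M + M) * (M + M))) => [|w].
    by apply: measurable_funM; [exact: (integ_mfun P)|apply: measurableT_comp => //; exact: (integ_mfun Q)].
  rewrite normrM ler_pM // ler_norml.
    by have := bF w; rewrite ler_norml /F' => /andP[]; lra.
  by have := bh (X w); rewrite ler_norml /h' => /andP[]; lra.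
have key : \int[P]_w (F' w * h' (X w)) = \int[P]_w F' w * \int[Q]_z h' z.
  apply: EFin_inj; rewrite EFinM !EFin_expect //.
  have := @ge0_factorization _ _ _ _ _ P Q X mX F' (\int[P]_w F' w) h'; rewrite EFin_expect //; apply => //.
  - exact: (integ_mfun P).
  - move=> A mA.
    have mXA : measurable (X @^-1` A) by rewrite -[X in measurable X]setTI; exact: mX.
    have mI : measurable_fun setT (fun w => \1_A (X w) : R) by exact: measurableT_comp.
    have I1 w : `|\1_A (X w) : R| <= 1 by rewrite indicE; case: (_ \in _); rewrite ?normr1 ?normr0.
    have iI : integ P (fun w => \1_A (X w)) := integ_bnd P _ 1 mI I1.
    have iFI : integ P (fun w => F w * \1_A (X w)).
      apply: (integ_bnd P _ (M * 1)) => [|w]; first exact: measurable_funM.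
      by rewrite normrM ler_pM.
    have EI : \int[P]_w \1_A (X w) = fine (Q A).
      rewrite -lawX // -[X in P X]setIT.
      by congr fine; exact: (integral_indic P measurableT mXA).
    have QA : Q A \is a fin_num by exact: fin_num_measure.
    rewrite -EFin_expect // -[in RHS](fineK QA) -EFinM -EFin_expect; last first.
      apply: eq_integ (integD P _ _ iFI (integZ P M _ iI)) => w.
      by rewrite /F' mulrDl.
    congr EFin; rewrite /F'; under eq_Rintegral do rewrite mulrDl.
    rewrite [LHS]expectD; [|exact: iFI|exact: integZ].
    rewrite hA // expectZ // EI expectD ?expect_cst ?mulrDl //; exact: integ_cst.
  - exact: (integ_mfun Q).
have e1 : \int[P]_w F' w = \int[P]_w F w + M.
  by rewrite expectD ?expect_cst //; exact: integ_cst.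
have e2 : \int[Q]_z h' z = \int[Q]_z h z + M.
  by rewrite expectD ?expect_cst //; exact: integ_cst.
have e3 : \int[P]_w (F' w * h' (X w)) =
   \int[P]_w (F w * h (X w)) + M * \int[P]_w F w + M * \int[Q]_z h z + M * M.
  have i1 := integZ P M _ iF; have i2 := integZ P M _ ihX.
  have i12 := integD P _ _ iFh i1; have i123 := integD P _ _ i12 i2.
  rewrite -(expect_law _ ih) -!expectZ // -[X in _ = _ + X](expect_cst P).
  rewrite -(expectD P _ _ iFh i1) -(expectD P _ _ i12 i2).
  rewrite -(expectD P _ _ i123 (integ_cst P (M * M))).
  by apply: eq_expect => w; rewrite /F' /h'; ring.
by move: key; rewrite e1 e2 e3; lra.
Qed.

End Law.

Lemma measurable_cosr (R : realType) : measurable_fun setT (@cos R).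
Proof. exact: (continuous_measurable_fun (@continuous_cos R)). Qed.

Lemma measurable_sinr (R : realType) : measurable_fun setT (@sin R).
Proof. exact: (continuous_measurable_fun (@continuous_sin R)). Qed.

Lemma measurable_invr (R : realType) : measurable_fun setT (@GRing.inv R).
Proof.
have -> : [set: R] = [set x | x != 0] `|` [set 0].
  apply/seteqP; split=> // x _; have [->|x0] := eqVneq x 0; by [right|left].
have o0 : open [set x : R | x != 0] by exact: open_neq.
apply/(measurable_funU (@GRing.inv R) (open_measurable o0) (measurable_set1 0)).
split; last exact: measurable_fun_set1.
apply: open_continuous_measurable_fun => // x; rewrite inE /= => x0.
exact: inv_continuous.
Qed.

(** * Integrating out the variables of an i.i.d. sample *)

Section IID.
Context {R : realType} {dO d} {Om : measurableType dO} {T : measurableType d}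
  (P : probability Om R) (Q : probability T R) (Z : nat -> Om -> T).
Hypothesis iid : iid_seq P Z Q.

Lemma iid_measurable i : measurable_fun setT (Z i).
Proof. by have [+ _] := iid. Qed.

Lemma iid_law i A : measurable A -> P (Z i @^-1` A) = Q A.
Proof. by have [_ [+ _]] := iid; apply. Qed.

Lemma iid_preimage i A : measurable A -> measurable (Z i @^-1` A).
Proof. by move=> mA; rewrite -[X in measurable X]setTI; exact: iid_measurable. Qed.

Lemma expect_iid i (h : T -> R) : integ Q h -> \int[P]_w h (Z i w) = \int[Q]_z h z.
Proof. by apply: expect_law; [exact: iid_measurable|move=> A; exact: iid_law]. Qed.

Lemma integ_iid i (h : T -> R) : integ Q h -> integ P (fun w => h (Z i w)).
Proof. by apply: integ_law; [exact: iid_measurable|move=> A; exact: iid_law]. Qed.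

Lemma sqint_iid i (h : T -> R) : sqint Q h -> sqint P (fun w => h (Z i w)).
Proof. by apply: sqint_law; [exact: iid_measurable|move=> A; exact: iid_law]. Qed.

Lemma expect_indic d' (T' : measurableType d') (P' : probability T' R)
  (A : set T') : measurable A -> \int[P']_w \1_A w = fine (P' A).
Proof. by move=> mA; rewrite -[X in P' X]setIT; congr fine; exact: integral_indic. Qed.

Lemma indic_le1 (T' : Type) (A : set T') w : `|\1_A w : R| <= 1.
Proof. by rewrite indicE; case: (_ \in _); rewrite ?normr1 ?normr0. Qed.

Lemma iid_indic (J : seq nat) (A : nat -> set T) : uniq J ->
  (forall i, measurable (A i)) ->
  \int[P]_w (\prod_(i <- J) \1_(A i) (Z i w)) = \prod_(i <- J) fine (Q (A i)).
Proof.
move=> uJ mA; have [_ [_ ind]] := iid.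
have -> : (fun w => \prod_(i <- J) \1_(A i) (Z i w) : R) =
    \1_(\bigcap_(i in [set` J]) (Z i @^-1` A i)).
  apply/funext => w; rewrite [RHS]indicE; case: (boolP (_ \in _)).
    rewrite inE => h; apply: big1_seq => i /= iJ.
    by rewrite indicE mem_set //; exact: h.
  rewrite notin_setE => h; apply/eqP; rewrite prodf_seq_eq0; apply/hasP.
  apply: contrapT => hn; apply: h => i /= iJ.
  apply: contrapT => hi; apply: hn; exists i => //=.
  by rewrite indicE memNset.
rewrite expect_indic; last first.
  by apply: fin_bigcap_measurable => // i _; exact: iid_preimage.
rewrite ind //.
elim: J {uJ} => [|i J IH]; first by rewrite !big_nil.
rewrite !big_cons fineM ?IH ?iid_law //; first exact: fin_num_measure.
elim: J {IH} => [|j J IH]; first by rewrite big_nil.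
by rewrite big_cons fin_numM // iid_law // fin_num_measure.
Qed.

(* [F] is independent of [(Z k, Z k.+1, ...)]. *)
Definition decoupled (k : nat) (F : Om -> R) : Prop :=
  [/\ measurable_fun setT F, (exists M, forall w, `|F w| <= M) &
  forall l (A : nat -> set T), (forall i, measurable (A i)) ->
    \int[P]_w (F w * \prod_(i <- iota k l) \1_(A i) (Z i w)) =
    \int[P]_w F w * \prod_(i <- iota k l) fine (Q (A i))].

Lemma prod_indic_measurable (J : seq nat) (A : nat -> set T) :
  (forall i, measurable (A i)) ->
  measurable_fun setT (fun w => \prod_(i <- J) \1_(A i) (Z i w) : R).
Proof.
move=> mA; apply: measurable_prod => i _.
by apply: measurableT_comp; [exact: measurable_indic|exact: iid_measurable].
Qed.

Lemma prod_indic_le1 (J : seq nat) (A : nat -> set T) w :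
  `|\prod_(i <- J) \1_(A i) (Z i w) : R| <= 1.
Proof.
elim: J => [|i J IH]; first by rewrite big_nil normr1.
by rewrite big_cons normrM -[leRHS]mulr1 ler_pM // indic_le1.
Qed.

Lemma decoupled_cst (c : R) : decoupled 0 (fun=> c).
Proof.
split; [exact: measurable_cst|by exists (`|c|)|move=> l A mA].
rewrite expectZ ?expect_cst ?iid_indic ?iota_uniq //.
apply: (integ_bnd P _ 1); first exact: prod_indic_measurable.
by move=> w; exact: prod_indic_le1.
Qed.

Lemma decoupled_lin k (c1 c2 : R) F G : decoupled k F -> decoupled k G ->
  decoupled k (fun w => c1 * F w + c2 * G w).
Proof.
move=> [mF [M1 b1] hF] [mG [M2 b2] hG]; split.
- by apply: measurable_funD; apply: measurable_funM.
- exists (`|c1| * M1 + `|c2| * M2) => w; apply: le_trans (ler_normD _ _) _.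
  by rewrite !normrM lerD // ler_wpM2l.
move=> l A mA.
have ip (H : Om -> R) M : measurable_fun setT H -> (forall w, `|H w| <= M) ->
    integ P (fun w => H w * \prod_(i <- iota k l) \1_(A i) (Z i w)).
  move=> mH bH; apply: (integ_bnd P _ (M * 1)) => [|w].
    by apply: measurable_funM => //; exact: prod_indic_measurable.
  by rewrite normrM ler_pM // prod_indic_le1.
have i1 := ip _ _ mF b1; have i2 := ip _ _ mG b2.
have j1 := integ_bnd P _ _ mF b1; have j2 := integ_bnd P _ _ mG b2.
rewrite [in RHS](expectD P _ _ (integZ P c1 _ j1) (integZ P c2 _ j2)) !expectZ //.
rewrite mulrDl -!mulrA -hF // -hG // -!expectZ //.
rewrite -(expectD P _ _ (integZ P c1 _ i1) (integZ P c2 _ i2)).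
by apply: eq_expect => w; rewrite mulrDl !mulrA.
Qed.

(** The product of [F] with events of the variables after [Z k] is independent of [Z k], hence
    [h (Z k)] can be integrated out of it. With no later events this is the product formula, and
    with arbitrary ones it is the decoupling of [F h (Z k)]. *)
Lemma decoupled_step k F (h : T -> R) M : decoupled k F ->
  measurable_fun setT h -> (forall z, `|h z| <= M) ->
  decoupled k.+1 (fun w => F w * h (Z k w)) /\
  \int[P]_w (F w * h (Z k w)) = \int[P]_w F w * \int[Q]_z h z.
Proof.
move=> [mF [M1 b1] hF] mh bh.
have mhZ : measurable_fun setT (fun w => h (Z k w)).
  by apply: measurableT_comp => //; exact: iid_measurable.
have key l A : (forall i, measurable (A i)) ->
    \int[P]_w ((F w * \prod_(i <- iota k.+1 l) \1_(A i) (Z i w)) * h (Z k w)) =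
    \int[P]_w F w * \prod_(i <- iota k.+1 l) fine (Q (A i)) * \int[Q]_z h z.
  move=> mA; pose F' w := F w * \prod_(i <- iota k.+1 l) \1_(A i) (Z i w).
  have fact B : measurable B -> \int[P]_w (F' w * \1_B (Z k w)) =
      \int[P]_w F w * \prod_(i <- iota k.+1 l) fine (Q (A i)) * fine (Q B).
    (* The event of [Z k] is put in front of the block that starts at [k.+1]; the result is a block
       of length [l.+1] starting at [k], where [decoupled k F] applies. *)
    move=> mB; pose A' i := if i == k then B else A i.
    have mA' i : measurable (A' i) by rewrite /A'; case: eqP.
    have eA (g : nat -> set T -> R) :
        \prod_(i <- iota k l.+1) g i (A' i) = \prod_(i <- iota k.+1 l) g i (A i) * g k B.
      rewrite /= big_cons mulrC /A' eqxx; congr (_ * _).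
      apply: eq_big_seq => i; rewrite mem_iota => /andP[ki _].
      by rewrite gtn_eqF.
    have := hF l.+1 A' mA'; rewrite (eA (fun i C => fine (Q C))) mulrA => <-.
    apply: eq_expect => w; rewrite (eA (fun i C => \1_C (Z i w))) /F'.
    by rewrite mulrA.
  have EF' : \int[P]_w F' w = \int[P]_w F w * \prod_(i <- iota k.+1 l) fine (Q (A i)).
    have := fact setT measurableT; rewrite probability_setT mulr1 => <-.
    by apply: eq_expect => w; rewrite indicT mulr1.
  rewrite -EF'; apply: (@bounded_factorization _ _ _ _ _ _ _ _ (iid_measurable k) _ _ _ (Num.max M1 M)) => //.
  - by move=> B; exact: iid_law.
  - by apply: measurable_funM => //; exact: prod_indic_measurable.
  - move=> w; rewrite normrM le_max; apply/orP; left.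
    by rewrite -[leRHS]mulr1 ler_pM // prod_indic_le1.
  - by move=> z; rewrite le_max bh orbT.
  - by move=> B mB; rewrite EF'; exact: fact.
have E0 : \int[P]_w (F w * h (Z k w)) = \int[P]_w F w * \int[Q]_z h z.
  have := key 0%N (fun=> setT) (fun=> measurableT).
  rewrite big_nil mulr1 => <-.
  by apply: eq_expect => w; rewrite big_nil mulr1.
split => //; split.
- exact: measurable_funM.
- by exists (M1 * M) => w; rewrite normrM ler_pM.
move=> l A mA; rewrite E0 -mulrA [X in _ * X]mulrC mulrA -key //.
by apply: eq_expect => w; rewrite mulrAC.
Qed.

(** Induction on [k] for all phases at once: the addition formula needs the induction hypothesis at
    the phases [a] and [a - pi / 2]. *)
Lemma decoupled_cos (g : T -> R) k (a : R) : measurable_fun setT g ->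
  decoupled k (fun w => cos (\sum_(i < k) g (Z i w) + a)).
Proof.
move=> mg; elim: k a => [|k IH] a.
  have -> : (fun w => cos (\sum_(i < 0) g (Z i w) + a)) = (fun=> cos a).
    by apply/funext => w; rewrite big_ord0 add0r.
  exact: decoupled_cst.
have mc : measurable_fun setT (fun z => cos (g z)).
  by apply: measurableT_comp => //; exact: measurable_cosr.
have ms : measurable_fun setT (fun z => sin (g z)).
  by apply: measurableT_comp => //; exact: measurable_sinr.
have c1 z : `|cos (g z)| <= 1 by exact: cos_max.
have s1 z : `|sin (g z)| <= 1 by exact: sin_max.
have [d1 _] := decoupled_step k _ _ _ (IH a) mc c1.
have [d2 _] := decoupled_step k _ _ _ (IH (a - pi / 2)) ms s1.
have := decoupled_lin k.+1 1 (-1) _ _ d1 d2; congr decoupled.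
apply/funext => w; rewrite big_ord_recr /=.
by rewrite [X in _ = cos X]addrAC [RHS]cosD addrA cosBpihalf; ring.
Qed.

(* The sine in the addition formula is a shifted cosine, so that the phase [a]
   makes the recursion close on cosines alone. *)
Lemma expect_cos_step (g : T -> R) k (a : R) : measurable_fun setT g ->
  \int[P]_w cos (\sum_(i < k.+1) g (Z i w) + a) =
  \int[P]_w cos (\sum_(i < k) g (Z i w) + a) * \int[Q]_z cos (g z) -
  \int[P]_w cos (\sum_(i < k) g (Z i w) + (a - pi / 2)) * \int[Q]_z sin (g z).
Proof.
move=> mg.
have mc : measurable_fun setT (fun z => cos (g z)).
  by apply: measurableT_comp => //; exact: measurable_cosr.
have ms : measurable_fun setT (fun z => sin (g z)).
  by apply: measurableT_comp => //; exact: measurable_sinr.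
have c1 z : `|cos (g z)| <= 1 by exact: cos_max.
have s1 z : `|sin (g z)| <= 1 by exact: sin_max.
have [[m1 [M1 b1] _] <-] := decoupled_step k _ _ _ (decoupled_cos g k a mg) mc c1.
have [[m2 [M2 b2] _] <-] := decoupled_step k _ _ _ (decoupled_cos g k (a - pi / 2) mg) ms s1.
rewrite -(expectB P _ _ (integ_bnd P _ _ m1 b1) (integ_bnd P _ _ m2 b2)).
apply: eq_expect => w; rewrite big_ord_recr /=.
by rewrite [X in cos X = _]addrAC [LHS]cosD addrA cosBpihalf; ring.
Qed.

Lemma expect_pair_indic i j (A B : set T) : i != j -> measurable A -> measurable B ->
  \int[P]_w (\1_A (Z i w) * \1_B (Z j w)) = fine (Q A) * fine (Q B).
Proof.
move=> ij mA mB; pose A' k := if k == i then A else B.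
have ji : (j == i) = false by rewrite eq_sym; exact/negbTE.
have := @iid_indic [:: i; j] A'; rewrite !big_cons !big_nil /A' eqxx ji !mulr1.
move=> <-; first by apply: eq_expect => w; rewrite !big_cons !big_nil /A' eqxx ji !mulr1.
  by rewrite /= inE ij.
by move=> k; case: eqP.
Qed.

(** Covariances involve unbounded functions, outside the reach of [decoupled]. The factorization is
    used twice: with [F] an indicator of [Z i] it integrates out [Z j], and then with [F = g (Z j)]
    it integrates out [Z i]. *)
Lemma ge0_pair i j (f g : T -> R) : i != j ->
  measurable_fun setT f -> (forall z, 0 <= f z) ->
  integ Q g -> (forall z, 0 <= g z) ->
  (\int[P]_w (g (Z j w) * f (Z i w))%:E = (\int[Q]_z g z)%:E * \int[Q]_z (f z)%:E)%E.
Proof.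
move=> ij mf f0 ig g0; have mg := integ_mfun Q g ig.
apply: ge0_factorization => //; first exact: iid_measurable.
  by apply: measurableT_comp => //; exact: iid_measurable.
move=> A mA.
have QA : Q A \is a fin_num by exact: fin_num_measure.
have mI B k : measurable B -> measurable_fun setT (fun w => \1_B (Z k w) : R).
  by move=> mB; apply: measurableT_comp; [exact: measurable_indic|exact: iid_measurable].
have := @ge0_factorization _ _ _ _ _ P Q (Z j) (iid_measurable j)
  (fun w => \1_A (Z i w)) (fine (Q A)) g (mI A i mA).
rewrite fineK // EFin_expect // muleC => <- //.
  by apply: eq_integral => w _; rewrite mulrC.
move=> B mB; rewrite -(fineK QA) -(fineK (fin_num_measure Q B mB)) -EFinM.
rewrite -(@expect_pair_indic i j) // EFin_expect //.
apply: (integ_bnd P _ (1 * 1)) => [|w]; first by apply: measurable_funM; exact: mI.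
by rewrite normrM ler_pM // indic_le1.
Qed.

Lemma expect_pair i j (f g : T -> R) : i != j -> sqint Q f -> sqint Q g ->
  \int[P]_w (f (Z i w) * g (Z j w)) = \int[Q]_z f z * \int[Q]_z g z.
Proof.
move=> ij hf hg.
have nonneg (f1 g1 : T -> R) : sqint Q f1 -> sqint Q g1 -> (forall z, 0 <= f1 z) ->
    (forall z, 0 <= g1 z) ->
    \int[P]_w (f1 (Z i w) * g1 (Z j w)) = \int[Q]_z f1 z * \int[Q]_z g1 z.
  move=> h1 h2 f0 g0; apply: EFin_inj; rewrite EFin_expect; last first.
    by apply: sqint_mul; exact: sqint_iid.
  under eq_integral do rewrite mulrC.
  rewrite (@ge0_pair i j) //; [|by case: h1|exact: sqint_integ].
  rewrite -EFin_expect; [by rewrite -EFinM mulrC|exact: sqint_integ].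
have norm2 (f1 : T -> R) : sqint Q f1 -> sqint Q (fun z => `|f1 z|).
  move=> [m1 i1]; split; first exact: measurableT_comp.
  by apply: eq_integ i1 => z; rewrite real_normK ?num_real.
have pos (f1 : T -> R) z : 0 <= `|f1 z| + f1 z.
  by have := ler_norm (- f1 z); rewrite normrN; lra.
(* The sign condition is removed from one factor at a time: the formula for [|f1| + f1] minus the
   one for [|f1|] is the formula for [f1]. *)
have semi (f1 g1 : T -> R) : sqint Q f1 -> sqint Q g1 -> (forall z, 0 <= g1 z) ->
    \int[P]_w (f1 (Z i w) * g1 (Z j w)) = \int[Q]_z f1 z * \int[Q]_z g1 z.
  move=> h1 h2 g0; have n1 := norm2 _ h1; have s1 := sqintD Q _ _ n1 h1.
  have := nonneg _ _ s1 h2 (pos f1) g0; rewrite expectD; [|exact: sqint_integ..].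
  rewrite mulrDl -nonneg // => e.
  apply: (addrI (\int[P]_w (`|f1 (Z i w)| * g1 (Z j w)))); rewrite -e -expectD.
  - by apply: eq_expect => w; rewrite mulrDl.
  - exact: (sqint_mul P _ _ (sqint_iid i _ n1) (sqint_iid j _ h2)).
  - exact: (sqint_mul P _ _ (sqint_iid i _ h1) (sqint_iid j _ h2)).
have n1 := norm2 _ hg; have s1 := sqintD Q _ _ n1 hg.
have := semi _ _ hf s1 (pos g); rewrite [in RHS]expectD; [|exact: sqint_integ..].
rewrite mulrDr -semi // => e.
apply: (addrI (\int[P]_w (f (Z i w) * `|g (Z j w)|))); rewrite -e -expectD.
- by apply: eq_expect => w; rewrite mulrDr.
- exact: (sqint_mul P _ _ (sqint_iid i _ hf) (sqint_iid j _ n1)).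
- exact: (sqint_mul P _ _ (sqint_iid i _ hf) (sqint_iid j _ hg)).
Qed.

Lemma sqint_iid_sum n (f : T -> R) : sqint Q f ->
  sqint P (fun w => \sum_(i < n) f (Z i w)).
Proof. by move=> hf; apply: sqint_sum => i; exact: sqint_iid. Qed.

Lemma expect_sum_sqr n (f : T -> R) : sqint Q f -> \int[Q]_z f z = 0 ->
  \int[P]_w (\sum_(i < n) f (Z i w)) ^+ 2 = n%:R * \int[Q]_z (f z ^+ 2).
Proof.
move=> hf f0; elim: n => [|n IH].
  rewrite mul0r; under eq_Rintegral do rewrite big_ord0 expr0n /=.
  exact: expect_cst.
have hS := sqint_iid_sum n f hf; have hn := sqint_iid n f hf.
have iSn := sqint_mul P _ _ hS hn.
transitivity (\int[P]_w ((\sum_(i < n) f (Z i w)) ^+ 2 +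
   2 * ((\sum_(i < n) f (Z i w)) * f (Z n w)) + f (Z n w) ^+ 2)).
  by apply: eq_expect => w; rewrite big_ord_recr /=; ring.
have e0 : \int[P]_w ((\sum_(i < n) f (Z i w)) * f (Z n w)) = 0.
  under eq_Rintegral do rewrite mulr_suml.
  rewrite expect_sum => [|i]; last by apply: sqint_mul => //; exact: sqint_iid.
  apply: big1 => i _; rewrite expect_pair ?f0 ?mul0r //.
  by rewrite ltn_eqF.
have i2 := integZ P 2 _ iSn; have i1 := integD P _ _ hS.2 i2.
rewrite (expectD P _ _ i1 hn.2) (expectD P _ _ hS.2 i2) expectZ // e0 IH.
rewrite (@expect_iid n (fun z => f z ^+ 2)) ?mulr0 ?addr0; last by case: hf.
by rewrite -natr1 mulrDl mul1r.
Qed.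

End IID.

(** * Dominated convergence to 0 for real expectations *)

Section DominatedConvergence.
Context {R : realType} {d} {T : measurableType d} (P : probability T R).

Lemma dominated_expect (f : nat -> T -> R) (g : T -> R) :
  (forall n, measurable_fun setT (f n)) -> integ P g ->
  (forall n x, `|f n x| <= g x) -> (forall x, f n x @[n --> \oo] --> 0) ->
  \int[P]_x f n x @[n --> \oo] --> 0.
Proof.
move=> mf ig fg f0.
have mfE n : measurable_fun setT (fun x => (f n x)%:E) by exact/measurable_EFinP.
have cf x : (f n x)%:E @[n --> \oo] --> 0%E by apply: cvg_EFin; [exact: nearW|exact: f0].
have [_ _] := @dominated_convergence _ _ _ P setT measurableT
  (fun n x => (f n x)%:E) (fun=> 0%E) (EFin \o g) mfE (measurable_cst _)
  (aeW P (fun x _ => cf x)) ig (aeW P (fun x n _ => fg n x)).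
rewrite integral0 => /fine_cvgP[_]; apply: cvg_trans.
by apply: near_eq_cvg; near=> n.
Unshelve. all: by end_near. Qed.

End DominatedConvergence.

(** * Taylor bounds for sine, cosine and the exponential *)

Section Trig.
Context {R : realType}.

Let sin_mvt (y : R) : 0 < y -> exists2 c, 0 < c < y & y - sin y = (1 - cos c) * y.
Proof.
move=> y0; have [|c] := @MVT _ (@sin R) (@cos R) 0 y y0.
  exact/continuous_subspaceT/continuous_sin.
by rewrite in_itv /= sin0 !subr0 => cy e; exists c => //; rewrite mulrBl mul1r e.
Qed.

Let sin_ge_N (y : R) : 0 <= y -> `|sin y| <= y.
Proof.
rewrite le_eqVlt => /predU1P[<-|y0]; first by rewrite sin0 normr0.
have [c _ e] := sin_mvt y y0.
have h1 : 0 <= (1 - cos c) * y by rewrite mulr_ge0 ?(ltW y0) // subr_ge0 cos_le1.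
have h2 : (1 - cos c) * y <= 2 * y.
  by rewrite ler_wpM2r ?(ltW y0) //; have := cos_geN1 c; lra.
by rewrite ler_norml; apply/andP; split; lra.
Qed.

Lemma norm_sin_le (y : R) : `|sin y| <= `|y|.
Proof.
have [y0|y0] := leP 0 y; first by rewrite [leRHS]ger0_norm // sin_ge_N.
by rewrite -normrN -sinN -[`|y|]normrN [leRHS]ger0_norm ?sin_ge_N // oppr_ge0 ltW.
Qed.

Let one_sub_cos (y : R) : 1 - cos y = 2 * sin (y / 2) ^+ 2.
Proof.
have {1}-> : y = (y / 2) *+ 2 by rewrite -mulr_natr; field.
by rewrite cos_mulr2n; have := cos2Dsin2 (y / 2); rewrite -mulr_natr; lra.
Qed.

Let sqr_sin_le (y : R) : sin y ^+ 2 <= y ^+ 2.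
Proof.
by rewrite -(real_normK (num_real (sin y))) -(real_normK (num_real y)) lerXn2r ?nnegrE ?norm_sin_le.
Qed.

(** The two bounds play the two roles in dominated convergence when only second moments exist. At
    [y = g / sqrt n] and multiplied by [n], the cubic one tends to 0 pointwise and the quadratic one
    is at most [g^2]. *)
Lemma sub_sin_bounds (y : R) : `|y - sin y| <= `|y| ^+ 3 / 2 /\ `|y - sin y| <= y ^+ 2.
Proof.
wlog y0 : y / 0 <= y.
  move=> H; have [|y0] := leP 0 y; first exact: H.
  have := H (- y); rewrite sinN normrN sqrrN -opprD normrN oppr_ge0; apply.
  exact: ltW.
move: y0; rewrite le_eqVlt => /predU1P[<-|y0].
  by rewrite sin0 subr0 normr0 !expr0n /= mul0r.
have [c /andP[c0 cy] ->] := sin_mvt y y0.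
have p1 : 0 <= 1 - cos c by rewrite subr_ge0 cos_le1.
rewrite ger0_norm ?mulr_ge0 ?(ltW y0) // (ger0_norm (ltW y0)).
have h1 : 1 - cos c <= y ^+ 2 / 2.
  rewrite one_sub_cos; have := sqr_sin_le (c / 2).
  have : c ^+ 2 <= y ^+ 2 by rewrite lerXn2r ?nnegrE ?ltW.
  by rewrite expr_div_n; lra.
have h2 : (1 - cos c) * y <= y ^+ 2 / 2 * y by rewrite ler_wpM2r // ltW.
split; first by rewrite exprSr mulrAC.
have [y2|y2] := leP y 2.
  apply: le_trans h2 _; rewrite -[leRHS]mulr1 -mulrA ler_wpM2l ?sqr_ge0 //; lra.
rewrite expr2 ler_wpM2r ?(ltW y0) //; have := cos_geN1 c; lra.
Qed.

(** By [1 - cos y = 2 sin(y/2)^2] the quantity is twice [(y/2)^2 - sin(y/2)^2]. Factored as a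
    difference of squares it inherits the cubic bound for sine, with one more power of [|y|] from
    the sum. *)
Lemma cos_taylor_bounds (y : R) :
  `|cos y - 1 + y ^+ 2 / 2| <= `|y| ^+ 4 /\ `|cos y - 1 + y ^+ 2 / 2| <= y ^+ 2.
Proof.
have e : cos y - 1 + y ^+ 2 / 2 = 2 * ((y / 2) ^+ 2 - sin (y / 2) ^+ 2).
  by have := one_sub_cos y; rewrite expr_div_n; lra.
have s1 := sqr_sin_le (y / 2).
split; last first.
  rewrite e ger0_norm ?mulr_ge0 ?subr_ge0 //.
  by have := sqr_ge0 (sin (y / 2)); have := sqr_ge0 y; rewrite !expr_div_n; lra.
rewrite e subr_sqr !normrM (ger0_norm (ler0n _ 2)).
have [h _] := sub_sin_bounds (y / 2).
have h2 : `|y / 2 + sin (y / 2)| <= 2 * `|y / 2|.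
  by apply: le_trans (ler_normD _ _) _; have := norm_sin_le (y / 2); lra.
apply: le_trans (_ : 2 * (`|y / 2| ^+ 3 / 2 * (2 * `|y / 2|)) <= _).
  by rewrite ler_pM2l // ler_pM.
rewrite normrM [`|2^-1|]ger0_norm // (_ : 2 * _ = `|y| ^+ 4 / 8); last by field.
by have := exprn_ge0 4 (normr_ge0 y); lra.
Qed.

Lemma expR_lin_bounds (x : R) : 0 <= x -> `|expR (- x) - (1 - x)| <= x ^+ 2.
Proof.
move=> x0; have h1 := expR_ge1Dx (- x); have h2 := expR_ge1Dx x.
have p : 0 < 1 + x by lra.
have h3 : expR (- x) <= (1 + x)^-1 by rewrite expRN lef_pV2 ?posrE ?expR_gt0.
have h4 : (1 + x)^-1 <= 1 - x + x ^+ 2.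
  rewrite -[leLHS]mul1r ler_pdivrMr //.
  by have := exprn_ge0 3 x0; rewrite [(_ + _) * _](_ : _ = 1 + x ^+ 3); [lra|ring].
by rewrite ler_norml; apply/andP; split; have := sqr_ge0 x; lra.
Qed.

Lemma norm_subX_le (a b : R) n : `|a| <= 1 -> `|b| <= 1 ->
  `|a ^+ n - b ^+ n| <= n%:R * `|a - b|.
Proof.
move=> a1 b1; elim: n => [|n IH]; first by rewrite !expr0 subrr normr0 mul0r.
rewrite !exprS (_ : _ - _ = a * (a ^+ n - b ^+ n) + (a - b) * b ^+ n); last by ring.
apply: le_trans (ler_normD _ _) _; rewrite -natr1 [leRHS]mulrDl mul1r !normrM lerD //.
  by rewrite -[leRHS]mul1r ler_pM.
by rewrite -[leRHS]mulr1 ler_wpM2l // normrX exprn_ile1.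
Qed.

(** Both sides are n-th powers of numbers of modulus at most 1, [1 - s / n] and [exp(- s / n)].
    These differ by at most [(s / n)^2], so their powers differ by at most [s^2 / n]. *)
Lemma cvg_expR_pow (s : R) : 0 <= s ->
  (1 - s / n%:R) ^+ n @[n --> \oo] --> expR (- s).
Proof.
move=> s0; apply/cvgrPdist_le => e e0; near=> n.
have n0 : 0 < (n%:R : R) by near: n; exact: nbhs_infty_gtr.
have sn : s <= n%:R by near: n; exact: nbhs_infty_ger.
have sen : s ^+ 2 / e <= n%:R by near: n; exact: nbhs_infty_ger.
have q0 : 0 <= s / n%:R by rewrite divr_ge0 // ltW.
have q1 : s / n%:R <= 1 by rewrite ler_pdivrMr ?mul1r.
have -> : expR (- s) = expR (- (s / n%:R)) ^+ n.
  by rewrite -expRM_natl mulrN mulrC divfK // gt_eqF.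
apply: le_trans (norm_subX_le _ _ _ _ _) _.
- by rewrite ger0_norm ?expR_ge0 // expR_le1 // oppr_le0.
- by rewrite ler_norml; apply/andP; split; lra.
apply: le_trans (ler_wpM2l (ltW n0) (expR_lin_bounds _ q0)) _.
have -> : n%:R * (s / n%:R) ^+ 2 = s ^+ 2 / n%:R by field; rewrite gt_eqF.
by rewrite ler_pdivrMr // mulrC -ler_pdivrMr.
Unshelve. all: by end_near. Qed.

End Trig.

(** * Limit of the expected cosine of a normalized i.i.d. sum *)

Section CharacteristicFunction.
Context {R : realType} {dO d} {Om : measurableType dO} {T : measurableType d}
  (P : probability Om R) (Q : probability T R) (Z : nat -> Om -> T).

Let t (n : nat) : R := (Num.sqrt n%:R)^-1.

Let t_ge0 n : 0 <= t n. Proof. by rewrite invr_ge0 sqrtr_ge0. Qed.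

Let nt2 n : (0 < n)%N -> n%:R * t n ^+ 2 = 1.
Proof. by move=> n0; rewrite exprVn sqr_sqrtr ?ler0n // divff // pnatr_eq0 -lt0n. Qed.

Let nt2_le1 n : n%:R * t n ^+ 2 <= 1.
Proof. by case: n => [|n]; [rewrite mul0r|rewrite nt2]. Qed.

Lemma cvg_inv_sqrt : t n @[n --> \oo] --> 0.
Proof.
apply/cvgrPdist_le => e e0; near=> n; rewrite sub0r normrN ger0_norm ?t_ge0 //.
have n0 : (e ^- 2) <= n%:R by near: n; exact: nbhs_infty_ger.
have se : e^-1 <= Num.sqrt n%:R.
  rewrite -(ler_pXn2r (ltn0Sn 1)) ?nnegrE ?sqrtr_ge0 ?invr_ge0 ?(ltW e0) //.
  by rewrite sqr_sqrtr ?ler0n // exprVn.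
by rewrite -[leRHS]invrK lef_pV2 ?posrE ?invr_gt0 // (lt_le_trans _ se) // invr_gt0.
Unshelve. all: by end_near. Qed.

Section OneStep.
Variable g : T -> R.
Hypotheses (hg : sqint Q g) (g0 : \int[Q]_z g z = 0).
Let s2 := \int[Q]_z (g z ^+ 2).

Let mg : measurable_fun setT (g : T -> R). Proof. by case: hg. Qed.

Let mtg n : measurable_fun setT (fun z => t n * g z).
Proof. exact: measurable_funM. Qed.

(** Because [g] has mean 0, the linear term [t n * g z] can be subtracted inside the integral; the
    remainder is handled by the two bounds of [sub_sin_bounds]. *)
Lemma expect_sin_rate :
  n%:R * \int[Q]_z sin (t n * g z) @[n --> \oo] --> 0.
Proof.
have ms n : measurable_fun setT (fun z => sin (t n * g z)).
  by apply: measurableT_comp => //; exact: measurable_sinr.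
pose f n z := n%:R * (sin (t n * g z) - t n * g z).
have -> : (fun n => n%:R * \int[Q]_z sin (t n * g z)) = (fun n => \int[Q]_z f n z).
  apply/funext => n.
  have i1 : integ Q (fun z => sin (t n * g z)).
    by apply: (integ_bnd Q _ 1) => // z; exact: sin_max.
  have i2 := integZ Q (t n) _ (sqint_integ Q _ hg).
  by rewrite /f expectZ ?expectB ?expectZ ?g0 ?mulr0 ?subr0 //; [exact: sqint_integ|exact: integB].
apply: (dominated_expect Q f (fun z => g z ^+ 2)) => [n||n z|z].
- by apply: measurable_funM => //; exact: measurable_funB.
- by case: hg.
- rewrite /f normrM ger0_norm // distrC.
  apply: le_trans (ler_wpM2l (ler0n _ _) (sub_sin_bounds _).2) _.
  by rewrite exprMn mulrA ler_piMl ?sqr_ge0.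
apply/cvgrPdist_le => e e0.
have : \forall n \near \oo, `|0 - t n| <= e / (`|g z| ^+ 3 + 1).
  move: cvg_inv_sqrt => /cvgrPdist_le; apply; rewrite divr_gt0 // ltr_wpDl //.
apply: filterS => n; rewrite !sub0r !normrN ger0_norm // ler_pdivlMr; last first.
  by rewrite ltr_wpDl // exprn_ge0.
move=> h; rewrite /f normrM ger0_norm // distrC.
apply: le_trans (ler_wpM2l (ler0n _ _) (sub_sin_bounds _).1) _.
rewrite normrM ger0_norm // exprMn.
have a0 := exprn_ge0 3 (normr_ge0 (g z)).
have -> : n%:R * (t n ^+ 3 * `|g z| ^+ 3 / 2) = (n%:R * t n ^+ 2) * (t n * `|g z| ^+ 3 / 2).
  by ring.
apply: le_trans (_ : t n * `|g z| ^+ 3 / 2 <= _).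
  by rewrite ler_piMl // divr_ge0 // mulr_ge0.
by have := t_ge0 n; have := mulr_ge0 (t_ge0 n) a0; rewrite mulrDr mulr1 in h; lra.
Qed.

Lemma expect_cos_rate :
  n%:R * \int[Q]_z cos (t n * g z) - (n%:R - s2 / 2) @[n --> \oo] --> 0.
Proof.
have mc n : measurable_fun setT (fun z => cos (t n * g z)).
  by apply: measurableT_comp => //; exact: measurable_cosr.
pose f n z := n%:R * (cos (t n * g z) - 1 + (t n * g z) ^+ 2 / 2).
have [_ ig2] := hg.
have : \int[Q]_z f n z @[n --> \oo] --> 0.
  apply: (dominated_expect Q f (fun z => g z ^+ 2)) => [n|//|n z|z].
  - apply: measurable_funM => //; apply: measurable_funD; first exact: measurable_funB.
    by apply: measurable_funM => //; exact: measurable_funX.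
  - rewrite /f normrM ger0_norm //.
    apply: le_trans (ler_wpM2l (ler0n _ _) (cos_taylor_bounds _).2) _.
    by rewrite exprMn mulrA ler_piMl ?sqr_ge0.
  apply/cvgrPdist_le => e e0.
  have : \forall n \near \oo, `|0 - t n| <= Num.min 1 (e / (`|g z| ^+ 4 + 1)).
    move: cvg_inv_sqrt => /cvgrPdist_le; apply.
    by rewrite lt_min ltr01 divr_gt0 // ltr_wpDl // exprn_ge0.
  apply: filterS => n; rewrite !sub0r !normrN ger0_norm // le_min => /andP[t1].
  rewrite ler_pdivlMr; last by rewrite ltr_wpDl // exprn_ge0.
  move=> h; rewrite /f normrM ger0_norm //.
  apply: le_trans (ler_wpM2l (ler0n _ _) (cos_taylor_bounds _).1) _.
  rewrite normrM ger0_norm // exprMn.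
  have a0 := exprn_ge0 4 (normr_ge0 (g z)).
  have -> : n%:R * (t n ^+ 4 * `|g z| ^+ 4) = (n%:R * t n ^+ 2) * (t n * (t n * `|g z| ^+ 4)).
    by ring.
  have p1 := mulr_ge0 (t_ge0 n) a0; have p2 := mulr_ge0 (t_ge0 n) p1.
  apply: le_trans (_ : t n * (t n * `|g z| ^+ 4) <= _); first by rewrite ler_piMl.
  apply: le_trans (_ : t n * `|g z| ^+ 4 <= _); first by rewrite ler_piMl.
  by have := t_ge0 n; rewrite mulrDr mulr1 in h; lra.
apply: cvg_trans; apply: near_eq_cvg; near=> n.
have n0 : (0 < n)%N by near: n; exact: nbhs_infty_gt.
have i1 : integ Q (fun z => cos (t n * g z)).
  by apply: (integ_bnd Q _ 1) => // z; rewrite ler_norml cos_geN1 cos_le1.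
have i2 : integ Q (fun z => cos (t n * g z) - 1) by apply: integB => //; exact: integ_cst.
have i3 := integZ Q (t n ^+ 2 / 2) _ ig2.
rewrite /f (eq_expect Q (fun z => n%:R * ((cos (t n * g z) - 1) + (t n ^+ 2 / 2) * g z ^+ 2))); last first.
  by move=> z; congr (_ * (_ + _)); ring.
rewrite expectZ; last exact: integD.
rewrite expectD // expectB //; last exact: integ_cst.
rewrite expect_cst expectZ // -/s2 mulrDr (_ : n%:R * (t n ^+ 2 / 2 * s2) = (n%:R * t n ^+ 2) * (s2 / 2)); last by ring.
by rewrite nt2 //; ring.
Unshelve. all: by end_near. Qed.

End OneStep.

(** Adding one summand multiplies the expected cosine by [c], the mean of [cos (t n * g)], and
    subtracts a shifted one times [s], the mean of [sin (t n * g)]. As [c - rho] and [s] are o(1/n)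
    with [rho = 1 - s2 / (2 n)], and expected cosines have modulus at most 1 at every phase, each
    step errs by at most [2 (e / 4) / n] from multiplication by [rho], and [n] steps by [e / 2]. *)
Lemma charfn_clt (g : T -> R) (a : R) : iid_seq P Z Q -> sqint Q g -> \int[Q]_z g z = 0 ->
  \int[P]_w cos (t n * \sum_(i < n) g (Z i w) + a) @[n --> \oo] -->
  expR (- (\int[Q]_z (g z ^+ 2) / 2)) * cos a.
Proof.
move=> iid hg g0; set s2 := \int[Q]_z (g z ^+ 2).
have s20 : 0 <= s2 / 2 by rewrite divr_ge0 // expect_ge0 // => z; exact: sqr_ge0.
have [mg _] := hg.
have lim1 : (1 - s2 / 2 / n%:R) ^+ n * cos a @[n --> \oo] --> expR (- (s2 / 2)) * cos a.
  by apply: cvgM; [exact: cvg_expR_pow|exact: cvg_cst].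
apply/cvgrPdist_le => e e0.
have e4 : 0 < e / 4 by rewrite divr_gt0.
near=> n.
have n0 : 0 < (n%:R : R) by near: n; exact: nbhs_infty_gtr.
have sn : s2 / 2 <= n%:R by near: n; exact: nbhs_infty_ger.
have h1 : `|expR (- (s2 / 2)) * cos a - (1 - s2 / 2 / n%:R) ^+ n * cos a| <= e / 4.
  by near: n; move/cvgrPdist_le : lim1; apply.
have h2 : `|0 - n%:R * \int[Q]_z sin (t n * g z)| <= e / 4.
  by near: n; move/cvgrPdist_le : (expect_sin_rate g hg g0); apply.
have h3 : `|0 - (n%:R * \int[Q]_z cos (t n * g z) - (n%:R - s2 / 2))| <= e / 4.
  by near: n; move/cvgrPdist_le : (expect_cos_rate g hg); apply.
have mtg : measurable_fun setT (fun z => t n * g z) by exact: measurable_funM.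
pose A k b := \int[P]_w cos (\sum_(i < k) (t n * g (Z i w)) + b).
have A1 k b : `|A k b| <= 1.
  apply: expect_bnd => [|w]; last exact: cos_max.
  by have [] := decoupled_cos P Q Z iid (fun z => t n * g z) k b mtg.
set c := \int[Q]_z cos (t n * g z) in h3; set s := \int[Q]_z sin (t n * g z) in h2.
set rho := 1 - s2 / 2 / n%:R in h1 *.
have q0 : 0 <= s2 / 2 / n%:R by rewrite divr_ge0 // ltW.
have q1 : s2 / 2 / n%:R <= 1 by rewrite ler_pdivrMr ?mul1r.
have rho1 : `|rho| <= 1 by rewrite ler_norml /rho; apply/andP; split; lra.
have sle : `|s| <= e / 4 / n%:R.
  rewrite ler_pdivlMr //; move: h2.
  by rewrite sub0r normrN normrM (ger0_norm (ltW n0)) mulrC.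
have cle : `|c - rho| <= e / 4 / n%:R.
  rewrite ler_pdivlMr //; move: h3.
  rewrite sub0r normrN -[X in _ -> _ * X <= _](ger0_norm (ltW n0)) -normrM.
  by congr (`|_| <= _); rewrite /rho; field; rewrite gt_eqF.
have rec k b : `|A k b - rho ^+ k * cos b| <= k%:R * (e / 4 / n%:R *+ 2).
  elim: k b => [|k IH] b.
    rewrite /A; under eq_Rintegral do rewrite big_ord0 add0r.
    by rewrite expect_cst mul1r subrr normr0 mul0r.
  rewrite {1}/A (expect_cos_step P Q Z iid (fun z => t n * g z) k b mtg) -/(A k b) -/(A k (b - pi / 2)).
  rewrite -/c -/s (_ : _ - _ = A k b * (c - rho) - A k (b - pi / 2) * s +
    rho * (A k b - rho ^+ k * cos b)); last by rewrite exprS; ring.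
  apply: le_trans (ler_normD _ _) _.
  have -> : k.+1%:R = k%:R + 1 :> R by rewrite natr1.
  rewrite [leRHS]mulrDl mul1r addrC lerD //.
    by rewrite normrM -[leRHS]mul1r ler_pM.
  apply: le_trans (ler_normB _ _) _; rewrite mulr2n lerD // normrM -[leRHS]mul1r ler_pM //.
have hA := rec n a.
have eA : \int[P]_w cos (t n * \sum_(i < n) g (Z i w) + a) = A n a.
  by apply: eq_expect => w; rewrite mulr_sumr.
rewrite eA.
have : n%:R * (e / 4 / n%:R *+ 2) = e / 2 by rewrite -mulr_natr; field; rewrite gt_eqF.
move=> E; rewrite E in hA.
rewrite (_ : _ - A n a = (expR (- (s2 / 2)) * cos a - rho ^+ n * cos a) - (A n a - rho ^+ n * cos a)); last by ring.
apply: le_trans (ler_normB _ _) _; lra.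
Unshelve. all: by end_near. Qed.

End CharacteristicFunction.

(** * The expected cosine of a centred normal variable *)

Section GaussianCharacteristicFunction.
Context {R : realType} (sg : R) (sg0 : 0 < sg).
Let N : probability (measurableTypeR R) R := normal_prob 0 sg.
Let mu : {measure set (measurableTypeR R) -> \bar R} := @lebesgue_measure R.
Let p : R -> R := normal_pdf 0 sg.

Let mp : measurable_fun setT p. Proof. exact: measurable_normal_pdf. Qed.

Let ge0_integral_N (h : R -> R) : measurable_fun setT h -> (forall x, 0 <= h x) ->
  (\int[N]_x (h x)%:E = \int[mu]_x (p x * h x)%:E)%E.
Proof.
move=> mh h0.
have := @ge0_factorization R _ _ (measurableTypeR R) (measurableTypeR R) mu N id
  (@measurable_id _ _ _) p 1 h mp.
rewrite mul1e => <- //; first by move=> x; exact: normal_pdf_ge0.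
move=> A mA; rewrite mul1e /N /normal_prob [RHS]integral_mkcond.
apply: eq_integral => x _; rewrite patchE indicE.
by case: (x \in A); rewrite ?mulr1 ?mulr0.
Qed.

Let integ_N (h : R -> R) : integ N h -> mu.-integrable setT (fun x => (p x * h x)%:E).
Proof.
move=> hi; have mh := integ_mfun N h hi; apply/integrableP; split.
  by apply/measurable_EFinP; exact: measurable_funM.
under eq_integral do rewrite /= normrM (ger0_norm (normal_pdf_ge0 _ _ _)).
rewrite -(@ge0_integral_N (fun x => `|h x|)) //; last exact: measurableT_comp.
by have /integrableP[_] := hi.
Qed.

Let expect_N (h : R -> R) : integ N h ->
  (\int[N]_x h x)%:E = (\int[mu]_x (p x * h x)%:E)%E.
Proof.
move=> hi; have mh := integ_mfun N h hi.
have i1 := integrable_norm hi; have i2 := integD N _ _ i1 hi.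
have j1 := integ_N _ i1; have j2 := integ_N _ i2.
rewrite (eq_expect N (fun x => (`|h x| + h x) - `|h x|)); last by move=> x; rewrite addrAC subrr add0r.
rewrite expectB // EFinB !EFin_expect // !ge0_integral_N //.
- rewrite -integralB_EFin //; apply: eq_integral => x _.
  by rewrite -EFinB -mulrBr addrAC subrr add0r.
- exact: (integ_mfun N _ i1).
- exact: (integ_mfun N _ i2).
- by move=> x; have := ler_norm (- h x); rewrite normrN; lra.
Qed.

Let c : R := (2 * sg ^+ 2)^-1.
Let k : R := normal_peak sg.

Let c0 : 0 < c. Proof. by rewrite invr_gt0 mulr_gt0 // exprn_gt0. Qed.

Let pE x : p x = k * expR (- c * (x * x)).
Proof.
rewrite /p normal_pdfE ?gt_eqF // /k /normal_fun subr0.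
by congr (_ * expR _); rewrite -mulr_natr /c; field; rewrite gt_eqF.
Qed.

Let sg2 : R := Num.sqrt 2 * sg.

(** Half of the exponent absorbs [|x|]: the density is a constant times [E2^2], and [1 / E2 >= 1 +
    x^2 / (4 sg^2) >= |x| / (2 sg)]. The remaining [E2] is a normal density of deviation
    [sqrt 2 * sg]. This gives both integrability of [|x|] and decay of the boundary terms. *)
Let tail : exists K, forall x, p x * `|x| <= K * normal_pdf 0 sg2 x.
Proof.
have s20 : sg2 != 0 by rewrite gt_eqF // mulr_gt0 // sqrtr_gt0.
exists (k * (2 * sg) / normal_peak sg2) => x.
have -> : normal_pdf 0 sg2 x = normal_peak sg2 * normal_fun 0 sg2 x by rewrite normal_pdfE.
rewrite [leRHS]mulrA divfK ?gt_eqF ?normal_peak_gt0 // pE.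
rewrite /normal_fun subr0; set E2 := expR (_ / _).
have e2 : - x ^+ 2 / (sg2 ^+ 2 *+ 2) = - (x ^+ 2 / (4 * sg ^+ 2)).
  by rewrite /sg2 exprMn sqr_sqrtr // mulNr -mulr_natl !mulrA -natrM.
have -> : expR (- c * (x * x)) = E2 * E2.
  by rewrite /E2 e2 -expRD /c; congr expR; field; rewrite gt_eqF.
have k0 : 0 <= k := normal_peak_ge0 sg.
have E0 : 0 < E2 := expR_gt0 _.
rewrite -!mulrA ler_wpM2l // [leRHS]mulrA mulrCA [leRHS]mulrC ler_pM2l //.
have : (E2)^-1 >= 1 + x ^+ 2 / (4 * sg ^+ 2) by rewrite /E2 e2 -expRN opprK expR_ge1Dx.
move=> h; rewrite mulrC -ler_pdivlMr //; apply: le_trans (ler_wpM2l _ h); last by rewrite mulr_ge0 ?ltW.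
have -> : 2 * sg * (1 + x ^+ 2 / (4 * sg ^+ 2)) = `|x| + (4 * sg ^+ 2 - 2 * sg * `|x| + x ^+ 2) / (2 * sg).
  by field; rewrite gt_eqF.
rewrite lerDl divr_ge0 ?mulr_ge0 ?(ltW sg0) //.
by rewrite -(real_normK (num_real x)); have := sqr_ge0 (`|x| - sg); have := sqr_ge0 sg; lra.
Qed.

Let integ_abs : integ N (fun x => `|x|).
Proof.
have mabs : measurable_fun setT (fun x : R => `|x|) by exact: measurableT_comp.
apply: (ge0_integ N) => //.
rewrite ge0_integral_N //; have [K hK] := tail.
have i1 : mu.-integrable setT (fun x => (K * normal_pdf 0 sg2 x)%:E).
  by have := integrableZl measurableT K (integrable_normal_pdf 0 sg2).
have : mu.-integrable setT (fun x => (p x * `|x|)%:E).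
  apply: le_integrable i1 => //.
    by apply/measurable_EFinP; exact: measurable_funM.
  move=> x _ /=; rewrite lee_fin ger0_norm ?mulr_ge0 ?normal_pdf_ge0 //.
  by rewrite (le_trans (hK x)) // ler_norm.
by move=> /integrableP[_]; under eq_integral do rewrite /= ger0_norm ?mulr_ge0 ?normal_pdf_ge0 //.
Qed.

(** The derivative of [p x * sin (s * x)] in [x]; that its integral vanishes is Stein's identity for
    the sine. *)
Let h (s x : R) : R := p x * (s * cos (s * x) - x / sg ^+ 2 * sin (s * x)).

Let is_derive_H (s x : R) : is_derive x 1 (fun y => p y * sin (s * y)) (h s x).
Proof.
have -> : (fun y => p y * sin (s * y)) =
    (fun y => k * expR (- c * (y * y))) * (fun y => sin (s * y)).
  by apply/funext => y; rewrite pE.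
have d1 : is_derive x 1 (fun y : R => - c * (y * y)) (- c * (x + x)).
  by apply: is_derive_eq; rewrite /GRing.scale /= !mulr1.
have d2 : is_derive x 1 (fun y : R => s * y) s.
  by apply: is_derive_eq; rewrite /GRing.scale /= mulr1.
have d3 := @is_derive1_comp _ (@expR R) _ x _ _ (is_derive_expR _) d1.
have d4 := @is_derive1_comp _ (@sin R) _ x _ _ (is_derive_sin _) d2.
have d5 := is_deriveZ k d3.
apply: is_derive_eq.
rewrite /GRing.scale /= /h pE /c; field.
by rewrite gt_eqF.
Qed.

Let h_continuous (s : R) : continuous (h s).
Proof.
have cs : continuous (fun x : R => s * x) by move=> x; exact: (@mulrl_continuous R s).
have csin : continuous (fun x : R => sin (s * x)).
  by move=> x; apply: continuous_comp; [exact: cs|exact: continuous_sin].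
have ccos : continuous (fun x : R => cos (s * x)).
  by move=> x; apply: continuous_comp; [exact: cs|exact: continuous_cos].
move=> x; apply: cvgM; first by apply: continuous_normal_pdf; rewrite gt_eqF.
apply: cvgB; first by apply: cvgM; [exact: cvg_cst|exact: ccos].
by apply: cvgM; [apply: cvgM; [exact: cvg_id|exact: cvg_cst]|exact: csin].
Qed.

Let integ_xsin (s : R) : integ N (fun x => x * sin (s * x)).
Proof.
apply: (integ_le N _ _ _ _ integ_abs) => [|x].
  apply: measurable_funM => //; apply: measurableT_comp => //.
  exact: measurable_sinr.
by rewrite normrM -[leRHS]mulr1 ler_wpM2l // sin_max.
Qed.

Let integ_cos (s : R) : integ N (fun x => cos (s * x)).
Proof.
apply: (integ_bnd N _ 1) => [|x]; last exact: cos_max.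
apply: measurableT_comp => //.
exact: measurable_cosr.
Qed.

Let integrable_h (s : R) : mu.-integrable setT (fun x => (h s x)%:E).
Proof.
have := integ_N _ (integB N _ _ (integZ N s _ (integ_cos s))
  (integZ N (sg ^+ 2)^-1 _ (integ_xsin s))).
congr (mu.-integrable _ _); apply/funext => x; congr EFin.
by rewrite /h; congr (_ * (_ - _)); ring.
Qed.

(** The integral is the limit of those over [-n, n], which the fundamental theorem of calculus
    evaluates as boundary values of [p x * sin (s * x)]; by [tail] these are O(1/n). *)
Let integral_h (s : R) : (\int[mu]_x (h s x)%:E = 0)%E.
Proof.
pose f n x := (h s x * \1_(`[- n%:R, n%:R]%classic : set R) x)%:E.
have mh : measurable_fun setT (h s) by exact: continuous_measurable_fun.
have := @dominated_convergence _ (measurableTypeR R) R mu setT measurableT f (fun x => (h s x)%:E)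
  (fun x => `|(h s x)%:E|)%E _ _ _ (integrable_abse (integrable_h s)) _.
case.
- by move=> n; apply/measurable_EFinP; apply: measurable_funM => //; exact: measurable_indic.
- exact/measurable_EFinP.
- apply: aeW => x _; apply: cvg_EFin; first exact: nearW.
  apply: cvg_near_cst; near=> n.
  rewrite /= indicE mem_set ?mulr1 //= in_itv /= -ler_norml.
  by near: n; exact: nbhs_infty_ger.
- apply: aeW => x n _; rewrite lee_fin normrM -[leRHS]mulr1 ler_wpM2l //.
  exact: indic_le1.
move=> _ _ cvgh; apply: (cvg_unique (@ereal_hausdorff R) cvgh).
pose H x := p x * sin (s * x).
(* The shifted index keeps the interval nondegenerate. *)
have FTC n : (\int[mu]_x f n.+1 x = (H n.+1%:R - H (- n.+1%:R))%:E)%E.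
  have cH : continuous H.
    move=> x; apply: differentiable_continuous; apply/derivable1_diffP.
    by have := is_derive_H s x => -[].
  have n0 : - n.+1%:R < n.+1%:R :> R by rewrite gtrN.
  rewrite EFinB -(@continuous_FTC2 R (h s) H) //.
  - rewrite [RHS]integral_mkcond; apply: eq_integral => x _.
    by rewrite /f patchE indicE; case: (x \in _); rewrite ?mulr1 ?mulr0.
  - exact/continuous_subspaceT/h_continuous.
  - split; first by move=> x _; have := is_derive_H s x => -[].
      by apply: cvg_at_right_filter; exact: cH.
    by apply: cvg_at_left_filter; exact: cH.
  - by move=> x _; rewrite derive1E; have := is_derive_H s x => -[].
have [K hK] := tail.
have Hle n : `|H n.+1%:R - H (- n.+1%:R)| <= 2 * (`|K| * normal_peak sg2) / n.+1%:R.
  have one y : n.+1%:R = `|y| -> `|H y| <= `|K| * normal_peak sg2 / n.+1%:R.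
    move=> e; rewrite /H normrM ger0_norm ?normal_pdf_ge0 //.
    apply: le_trans (_ : p y <= _).
      by rewrite -[leRHS]mulr1 ler_wpM2l ?normal_pdf_ge0 // sin_max.
    rewrite ler_pdivlMr // e; apply: le_trans (hK y) _.
    apply: le_trans (ler_norm _) _; rewrite normrM ler_wpM2l //.
    rewrite ger0_norm ?normal_pdf_ge0 // normal_pdf_ub //.
    by rewrite gt_eqF // mulr_gt0 // sqrtr_gt0.
  apply: le_trans (ler_normB _ _) _; rewrite -mulrA mulr_natl mulr2n lerD // one //.
    by rewrite ger0_norm.
  by rewrite normrN ger0_norm.
have lim0 : (H n.+1%:R - H (- n.+1%:R)) @[n --> \oo] --> 0.
  apply/cvgrPdist_le => e e0; near=> n; rewrite sub0r normrN; apply: le_trans (Hle n) _.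
  rewrite ler_pdivrMr // [leRHS]mulrC -ler_pdivrMr //; apply: le_trans (_ : n%:R <= _).
    by near: n; exact: nbhs_infty_ger.
  by rewrite ler_nat.
have limE : (\int[mu]_x f n.+1 x)%E @[n --> \oo] --> 0%E.
  under eq_fun do rewrite FTC.
  by apply: cvg_EFin; [exact: nearW|exact: lim0].
by move: limE; rewrite (cvg_shiftS (fun n => \int[mu]_x f n x)%E); exact.
Unshelve. all: by end_near. Qed.

(* Stein's identity turns [phi'] into [- sg^2 s phi]. *)
Let stein (s : R) : \int[N]_x (x * sin (s * x)) = sg ^+ 2 * s * \int[N]_x cos (s * x).
Proof.
have ic := integZ N s _ (integ_cos s); have ix := integZ N (sg ^+ 2)^-1 _ (integ_xsin s).
have : \int[N]_x (s * cos (s * x) - (sg ^+ 2)^-1 * (x * sin (s * x))) = 0.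
  apply: EFin_inj; rewrite expect_N; last exact: integB.
  apply: etrans (integral_h s); apply: eq_integral => x _; congr EFin.
  by rewrite /h; congr (_ * (_ - _)); ring.
rewrite expectB // !expectZ //.
move/eqP; rewrite subr_eq0 => /eqP e; rewrite -mulrA e mulrA divff ?mul1r //.
by rewrite gt_eqF // exprn_gt0.
Qed.

Let phi (s : R) := \int[N]_x cos (s * x).

(** Differentiation under the integral is dominated by [|x|], and [stein] turns the resulting sine
    integral back into [phi]. *)
Let is_derive_phi (s : R) : is_derive s 1 phi (- (sg ^+ 2 * s * phi s)).
Proof.
have dcos (y x : R) : is_derive y 1 (fun y : R => cos (y * x)) (- x * sin (y * x)).
  have d2 : is_derive y 1 (fun y : R => y * x) x.
    by apply: is_derive_eq; rewrite /GRing.scale /= !mulr1 ?mulr0 ?add0r ?addr0.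
  have := @is_derive1_comp _ (@cos R) _ y _ _ (is_derive_cos _) d2.
  by rewrite mulNr mulrC mulNr.
have d1E (y x : R) : partial1of2 (fun y x : R => cos (y * x)) y x = - x * sin (y * x).
  by rewrite partial1of2E; have := dcos y x => -[].
have intf (y : R) : (`]s - 1, s + 1[%classic : set R) y -> integ N (fun x => cos (y * x)).
  by move=> _; exact: integ_cos.
have der (y x : R) : (`]s - 1, s + 1[%classic : set R) y -> [set: R] x ->
    derivable (fun y : R => cos (y * x)) y 1.
  by move=> _ _; have := dcos y x => -[].
have ub (y x : R) : (`]s - 1, s + 1[%classic : set R) y -> [set: R] x ->
    `|partial1of2 (fun y x : R => cos (y * x)) y x| <= `|x|.
  by move=> _ _; rewrite d1E normrM normrN -[leRHS]mulr1 ler_wpM2l // sin_max.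
have Is : (`]s - 1, s + 1[%classic : set R) s by rewrite /= in_itv /= ltrBlDr ltrDl ltr01.
have dphi := @derivable_under_integral R _ _ N (fun y x : R => cos (y * x)) setT measurableT
  s (s - 1) (s + 1) Is intf der (fun x : R => `|x|) (fun x : R => normr_ge0 x) integ_abs ub.
have ephi := @differentiation_under_integral R _ _ N (fun y x : R => cos (y * x)) setT measurableT
  s (s - 1) (s + 1) Is intf der (fun x : R => `|x|) (fun x : R => normr_ge0 x) integ_abs ub.
apply: DeriveDef; first exact: dphi.
rewrite -derive1E ephi -stein.
rewrite (eq_expect N (fun x => (-1) * (x * sin (s * x)))); last first.
  by move=> x; rewrite d1E mulN1r mulNr.
by rewrite expectZ ?mulN1r //; exact: integ_xsin.
Qed.

(** The differential equation for [phi] says that [phi y * exp(sg^2 y^2 / 2)] has derivative 0, and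
    its value at 0 is 1. *)
Lemma normal_expect_cos (s : R) : \int[N]_x cos (s * x) = expR (- (s ^+ 2 * sg ^+ 2 / 2)).
Proof.
pose G y := phi y * expR (sg ^+ 2 / 2 * (y * y)).
have dG (y : R) : is_derive y 1 G 0.
  have d1 : is_derive y 1 (fun y : R => sg ^+ 2 / 2 * (y * y)) (sg ^+ 2 / 2 * (y + y)).
    by apply: is_derive_eq; rewrite /GRing.scale /= !mulr1.
  have d2 := @is_derive1_comp _ (@expR R) _ y _ _ (is_derive_expR _) d1.
  have d3 := is_derive_phi y.
  have -> : G = phi * (fun y => expR (sg ^+ 2 / 2 * (y * y))) by [].
  by apply: is_derive_eq; rewrite /GRing.scale /=; field.
have := is_derive_0_is_cst s 0 dG.
rewrite /G !mul0r mulr0 expR0 mulr1 {2}/phi.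
under [in RHS]eq_Rintegral do rewrite mul0r cos0.
rewrite expect_cst (_ : sg ^+ 2 / 2 * (s * s) = s ^+ 2 * sg ^+ 2 / 2); last by ring.
rewrite expRN; set E := expR _ => e.
have E0 : E != 0 by rewrite gt_eqF // expR_gt0.
by apply: (mulIf E0); rewrite mulVf // -e.
Qed.

End GaussianCharacteristicFunction.

(** * Lipschitz bounds for sine and cosine *)

Section Lipschitz.
Context {R : realType}.

Lemma cos_lipschitz (a b : R) : `|cos a - cos b| <= `|a - b|.
Proof.
have -> : cos a - cos b = - 2 * sin ((a + b) / 2) * sin ((a - b) / 2).
  have H (u v : R) : cos (u + v) - cos (u - v) = - 2 * sin u * sin v.
    by rewrite cosB cosD; ring.
  by rewrite -H; congr (cos _ - cos _); field.
rewrite !normrM normrN (ger0_norm (ler0n _ 2)).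
have h1 := sin_max ((a + b) / 2); have h2 := norm_sin_le ((a - b) / 2).
rewrite [`|_ / 2|]normrM [`|2^-1|]ger0_norm // in h2.
apply: le_trans (_ : 2 * 1 * (`|a - b| / 2) <= _); last by lra.
by rewrite ler_pM // ?mulr_ge0 // ler_pM2l.
Qed.

Lemma sin_lipschitz (a b : R) : `|sin a - sin b| <= `|a - b|.
Proof.
rewrite -!cosBpihalf; apply: le_trans (cos_lipschitz _ _) _.
by rewrite le_eqVlt; apply/orP; left; apply/eqP; congr (`|_|); ring.
Qed.

End Lipschitz.

(** * Multivariate Bernstein polynomials *)

Section Bernstein.
Context {R : realType} {r : nat}.
Implicit Types (G : 'cV[R]_r -> R) (S : 'cV[R]_r) (y : 'I_r -> R) (l : seq 'I_r).

(* Coordinate [i] of [S] is moved by [dl] with probability [y i], for each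
   occurrence of [i] in [l]; with [dl = 1/N] and [N] occurrences of every
   coordinate this is the Bernstein polynomial of degree [N] in each [y i]. *)
Fixpoint bernstein (dl : R) l G S y : R :=
  if l is i :: l' then
    y i * bernstein dl l' G (S + dl *: delta_mx i 0) y + (1 - y i) * bernstein dl l' G S y
  else G S.

Lemma bernstein_le dl l G1 G2 S y : (forall i, 0 <= y i <= 1) ->
  (forall S, G1 S <= G2 S) -> bernstein dl l G1 S y <= bernstein dl l G2 S y.
Proof.
move=> hy h; elim: l S => [|i l IH] S //=; have /andP[y0 y1] := hy i.
by rewrite lerD // ler_wpM2l // subr_ge0.
Qed.

Lemma bernstein_cst dl l (c : R) S y : bernstein dl l (fun=> c) S y = c.
Proof. by elim: l S => [|i l IH] S //=; rewrite !IH; ring. Qed.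

Lemma bernsteinD dl l G1 G2 S y :
  bernstein dl l (fun S => G1 S + G2 S) S y = bernstein dl l G1 S y + bernstein dl l G2 S y.
Proof. by elim: l S => [|i l IH] S //=; rewrite !IH; ring. Qed.

Lemma bernsteinN dl l G S y :
  bernstein dl l (fun S => - G S) S y = - bernstein dl l G S y.
Proof. by elim: l S => [|i l IH] S //=; rewrite !IH; ring. Qed.

Lemma bernstein_norm_le dl l G1 G2 S y : (forall i, 0 <= y i <= 1) ->
  (forall S, `|G1 S| <= G2 S) -> `|bernstein dl l G1 S y| <= bernstein dl l G2 S y.
Proof.
move=> hy h; rewrite ler_norml -bernsteinN !bernstein_le // => S';
  by have := h S'; rewrite ler_norml => /andP[].
Qed.

(** Squared bias plus variance: coordinate [i] of the final point is its starting value plus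
    [count_mem i l] independent jumps of size [dl], each made with probability [y i]. *)
Lemma bernstein_quad dl l (e C : R) S y :
  bernstein dl l (fun S => e + C * \sum_i (S i 0 - y i) ^+ 2) S y =
  e + C * \sum_i ((S i 0 + dl * (count_mem i l)%:R * y i - y i) ^+ 2 +
                  dl ^+ 2 * (count_mem i l)%:R * (y i * (1 - y i))).
Proof.
elim: l S => [|j l IH] S /=.
  congr (_ + _ * _); apply: eq_bigr => i _.
  by rewrite !mulr0 !mul0r !addr0.
rewrite !IH; set c := fun i => count_mem i l.
rewrite (bigD1 j) //= [\sum_i _ in X in _ + X = _](bigD1 j) //= [\sum_i _ in RHS](bigD1 j) //=.
rewrite !mxE !eqxx /= mulr1 natrD.
have -> : \sum_(i < r | i != j) (((S + dl *: delta_mx j 0) i 0 + dl * (count_mem i l)%:R * y i - y i) ^+ 2 +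
       dl ^+ 2 * (count_mem i l)%:R * (y i * (1 - y i))) =
    \sum_(i < r | i != j) ((S i 0 + dl * (count_mem i l)%:R * y i - y i) ^+ 2 +
       dl ^+ 2 * (count_mem i l)%:R * (y i * (1 - y i))).
  by apply: eq_bigr => i ij; rewrite !mxE (negbTE ij) mulr0 addr0.
have -> : \sum_(i < r | i != j) ((S i 0 + dl * ((j == i) + count_mem i l)%:R * y i - y i) ^+ 2 +
       dl ^+ 2 * ((j == i) + count_mem i l)%:R * (y i * (1 - y i))) =
    \sum_(i < r | i != j) ((S i 0 + dl * (count_mem i l)%:R * y i - y i) ^+ 2 +
       dl ^+ 2 * (count_mem i l)%:R * (y i * (1 - y i))).
  by apply: eq_bigr => i ij; rewrite eq_sym (negbTE ij) add0n.
by ring.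
Qed.

(** With [dl = 1 / N] and start 0 the bias vanishes and each coordinate has variance
    [y i (1 - y i) / N <= 1 / N]. A quadratic majorant of the error is thus averaged exactly, with
    no separate treatment of points near and far. *)
Lemma bernstein_approx (N : nat) G (e C v : R) y : (0 < N)%N -> 0 <= C ->
  (forall i, 0 <= y i <= 1) ->
  (forall S, `|G S - v| <= e + C * \sum_i (S i 0 - y i) ^+ 2) ->
  `|bernstein N%:R^-1 (flatten (nseq N (enum 'I_r))) G 0 y - v| <= e + C * r%:R / N%:R.
Proof.
move=> N0 C0 hy h; set l := flatten _.
have cnt i : count_mem i l = N.
  rewrite /l; elim: N {N0 l h} => [|N IH] //=.
  by rewrite count_cat IH count_uniq_mem ?enum_uniq // mem_enum add1n.
have -> : bernstein N%:R^-1 l G 0 y - v = bernstein N%:R^-1 l (fun S => G S - v) 0 y.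
  by rewrite bernsteinD bernstein_cst.
apply: le_trans (bernstein_norm_le _ _ _ _ _ _ hy h) _.
rewrite bernstein_quad lerD2l -mulrA ler_wpM2l //.
apply: le_trans (_ : \sum_(i < r) N%:R^-1 <= _); last by rewrite sumr_const card_ord mulr_natl.
have Np : (0 : R) < N%:R by rewrite ltr0n.
apply: ler_sum => i _; have /andP[y0 y1] := hy i.
have -> : forall z, (z + N%:R^-1 * (count_mem i l)%:R * y i - y i) ^+ 2 +
    N%:R^-1 ^+ 2 * (count_mem i l)%:R * (y i * (1 - y i)) =
    z ^+ 2 + N%:R^-1 * (y i * (1 - y i)) :> R.
  by move=> z; rewrite cnt; field; rewrite gt_eqF.
rewrite mxE expr0n add0r ger_pMr ?invr_gt0 //.
by apply: le_trans (_ : y i * 1 <= _); [rewrite ler_wpM2l //; lra|rewrite mulr1].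
Qed.

End Bernstein.

(** * Approximation by uniformly bounded trigonometric polynomials *)

Section TrigPoly.
Context {R : realType} {r : nat}.

(** Multiplication is by one cosine at a time, so that convergence of expectations can be proved by
    induction; the free phase [a] includes the sines. *)
Inductive trig_poly : ('cV[R]_r -> R) -> Prop :=
| trig_cst c : trig_poly (fun=> c)
| trig_lin (c1 c2 : R) f g : trig_poly f -> trig_poly g ->
    trig_poly (fun x => c1 * f x + c2 * g x)
| trig_mul (t : 'cV[R]_r) (a : R) f : trig_poly f ->
    trig_poly (fun x => f x * cos (dot t x + a)).

(* For [|x i 0| <= L], [x] is recovered from [y (2 L) x], so that [f] is a
   function [G] of [y (2 L) x] there, and a Bernstein polynomial of [G] in the
   [y s x i] is a trigonometric polynomial in [x]. *)
Let y (s : R) (x : 'cV[R]_r) (i : 'I_r) : R := (1 + sin (x i 0 / s)) / 2.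

Let y01 s x i : 0 <= y s x i <= 1.
Proof.
rewrite /y; have := sin_geN1 (x i 0 / s); have := sin_le1 (x i 0 / s).
by move=> *; apply/andP; split; lra.
Qed.

Let trig_y s i f : trig_poly f -> trig_poly (fun x => y s x i * f x).
Proof.
move=> hf.
have := trig_lin (1 / 2) (1 / 2) _ _ hf (trig_mul (s^-1 *: delta_mx i 0) (- (pi / 2)) _ hf).
congr trig_poly; apply/funext => x; rewrite /y cosBpihalf dotZl.
by rewrite dot_delta [s^-1 * _]mulrC; field.
Qed.

Let trig_bernstein s dl l G S : trig_poly (fun x => bernstein dl l G S (y s x)).
Proof.
elim: l S => [|i l IH] S /=; first exact: trig_cst.
have := trig_lin 1 1 _ _ (trig_y s i _ (IH (S + dl *: delta_mx i 0)))
  (trig_lin 1 (-1) _ _ (IH S) (trig_y s i _ (IH S))).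
by congr trig_poly; apply/funext => x; ring.
Qed.

Section Approximation.
Variables (f : 'cV[R]_r -> R) (M L : R).
Hypotheses (cf : continuous f) (fM : forall x, `|f x| <= M) (L0 : 0 < L).

Let s : R := 2 * L.
Let s0 : 0 < s. Proof. by rewrite mulr_gt0. Qed.

Let G (S : 'cV[R]_r) : R := f (\col_i (s * asin (2 * S i 0 - 1))).

Let continuous_cV (x0 : 'cV[R]_r) (e : R) : 0 < e -> exists2 d, 0 < d &
  forall x : 'cV[R]_r, (forall i, `|x i 0 - x0 i 0| < d) -> `|f x - f x0| <= e.
Proof.
move=> e0; have /cvgrPdist_le/(_ e e0)/nbhs_ballP[d /= d0 hd] := cf x0.
exists d => // x hx; rewrite distrC; apply: hd; split => // i j.
by rewrite ord1 /ball /= distrC.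
Qed.

Let G_near (x0 : 'cV[R]_r) (e : R) : 0 < e -> (forall i, `|x0 i 0| <= L) -> exists2 d, 0 < d &
  forall S : 'cV[R]_r, (forall i, `|S i 0 - y s x0 i| < d) -> `|G S - f x0| <= e.
Proof.
move=> e0 hx0; have [d d0 hd] := continuous_cV x0 _ e0.
have : \forall k \near \oo, forall i (z : R), `|z - y s x0 i| < k.+1%:R^-1 ->
    `|s * asin (2 * z - 1) - x0 i 0| < d.
  apply: filter_forall => i.
  (* The choice [s = 2 L] keeps the argument strictly inside (-pi/2, pi/2), where [asin] inverts
     [sin] and is continuous at the image point. *)
  have xi1 : `|x0 i 0 / s| <= 1 / 2.
    rewrite normrM normfV (gtr0_norm s0) ler_pdivrMr // /s.
    by have := hx0 i; lra.
  have pi2 := @pihalf_ge1 R.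
  have yE : 2 * y s x0 i - 1 = sin (x0 i 0 / s) by rewrite /y; field.
  have asinE : asin (2 * y s x0 i - 1) = x0 i 0 / s.
    by rewrite yE sinK // in_itv /= -ler_norml (le_trans xi1) //; lra.
  have lt1 : -1 < 2 * y s x0 i - 1 < 1.
    rewrite yE -ltr_norml -(ltr_pXn2r (ltn0Sn 1)) ?nnegrE // expr1n real_normK ?num_real //.
    rewrite -(cos2Dsin2 (x0 i 0 / s)) ltrDr exprn_gt0 // cos_gt0_pihalf //.
    by rewrite -ltr_norml (le_lt_trans xi1) //; lra.
  have /cvgrPdist_lt/(_ (d / s)) := continuous_asin lt1.
  rewrite divr_gt0 // => /(_ isT)/nbhs_ballP[e' /= e'0 he'].
  near=> k; move=> z hz.
  have := he' (2 * z - 1); rewrite /ball /= asinE => h.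
  have -> : s * asin (2 * z - 1) - x0 i 0 = - (s * (x0 i 0 / s - asin (2 * z - 1))).
    by field; rewrite gt_eqF.
  rewrite normrN normrM (gtr0_norm s0) -ltr_pdivlMl // [ltRHS]mulrC; apply: h.
  have -> : 2 * y s x0 i - 1 - (2 * z - 1) = - (2 * (z - y s x0 i)) by ring.
  rewrite normrN normrM (ger0_norm (ler0n _ 2)) mulrC -ltr_pdivlMr //.
  apply: lt_le_trans hz _; rewrite -[leRHS]invrK lef_pV2 ?posrE ?invr_gt0 ?divr_gt0 //.
  rewrite invf_div; apply: le_trans (_ : k%:R <= _); last by rewrite ler_nat.
  by near: k; exact: nbhs_infty_ger.
case=> N _ /(_ N (leqnn N)) hN; exists N.+1%:R^-1 => // S hS.
by apply: hd => i; rewrite mxE; exact: hN.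
Unshelve. all: by end_near. Qed.

(** Compactness of the cube makes the radius in [G_near] independent of the point. The comparison is
    with [f x] while only [x] is confined to the cube; [S] may be any nearby vector. *)
Let G_uniform (e : R) : 0 < e -> exists2 d, 0 < d &
  forall (x S : 'cV[R]_r), (forall i, `|x i 0| <= L) -> (forall i, `|S i 0 - y s x i| < d) ->
    `|G S - f x| <= e.
Proof.
move=> e0; have e2 : 0 < e / 2 by rewrite divr_gt0.
have /compact_near_coveringP nc := @cV_box_compact R r L.
pose Pr (k : nat) (x : 'cV[R]_r) := forall S : 'cV[R]_r, (forall i, `|S i 0 - y s x i| < k.+1%:R^-1) ->
  `|G S - f x| <= e.
have [|N _ /(_ N (leqnn N)) hN] := nc nat \oo Pr _.
- move=> x0 /= hx0; have [d1 d10 h1] := G_near x0 _ e2 hx0.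
  have [d2 d20 h2] := continuous_cV x0 _ e2.
  pose d := Num.min (d1 * L) d2.
  have d0 : 0 < d by rewrite lt_min mulr_gt0.
  exists ([set x : 'cV[R]_r | forall i, `|x i 0 - x0 i 0| < d], [set k : nat | 2 / d1 <= k%:R]).
    split; last exact: nbhs_infty_ger.
    by apply/nbhs_ballP; exists d => //= x [_ hx] i; have := hx i 0; rewrite /ball /= distrC.
  move=> [x k] /= [hx hk] S hS.
  have -> : G S - f x = (G S - f x0) - (f x - f x0) by ring.
  apply: le_trans (ler_normB _ _) _; rewrite [leRHS]splitr lerD //; last first.
    by apply: h2 => i; apply: lt_le_trans (hx i) _; rewrite ge_min lexx orbT.
  apply: h1 => i; have -> : S i 0 - y s x0 i = (S i 0 - y s x i) + (y s x i - y s x0 i) by ring.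
  apply: le_lt_trans (ler_normD _ _) _; rewrite [ltRHS]splitr ltrD //.
    apply: lt_le_trans (hS i) _; rewrite -[leRHS]invrK lef_pV2 ?posrE ?invr_gt0 ?divr_gt0 //.
    by rewrite invf_div (le_trans hk) // ler_nat.
  have -> : y s x i - y s x0 i = (sin (x i 0 / s) - sin (x0 i 0 / s)) / 2 by rewrite /y; field.
  rewrite normrM [`|2^-1|]ger0_norm // ltr_pM2r ?invr_gt0 //.
  apply: le_lt_trans (sin_lipschitz _ _) _; rewrite -mulrBl normrM normfV (gtr0_norm s0).
  rewrite ltr_pdivrMr //; apply: lt_le_trans (hx i) _; rewrite ge_min; apply/orP; left.
  by rewrite ler_pM2l // /s mulr_natl mulr2n lerDl ltW.
- by exists N.+1%:R^-1 => // x S hx hS; exact: hN.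
Qed.

(** A Bernstein polynomial at weights in [0, 1] is an average of values of [G], so the bound [M]
    holds on the whole space and not only on the cube. This is what lets the probability of leaving
    the cube control the error outside it. *)
Lemma trig_poly_approx (e : R) : 0 < e -> exists h, [/\ trig_poly h,
  (forall x, `|h x| <= M) &
  (forall x : 'cV[R]_r, (forall i, `|x i 0| <= L) -> `|h x - f x| <= e)].
Proof.
move=> e0; have e2 : 0 < e / 2 by rewrite divr_gt0.
have M0 : 0 <= M by exact: le_trans (normr_ge0 _) (fM 0).
have [d d0 hd] := G_uniform _ e2.
(* If some coordinate of [S] is at distance at least [d], the trivial error [2 M] equals [C d^2] and
   is covered by the quadratic term. [N] is then taken so large that [C r / N <= e / 2]. *)
pose C := 2 * M / d ^+ 2.
have C0 : 0 <= C by rewrite !mulr_ge0 // invr_ge0 exprn_ge0 // ltW.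
pose N := (Num.truncn (2 * C * r%:R / e)).+1.
have N0 : (0 < N)%N by [].
exists (fun x => bernstein N%:R^-1 (flatten (nseq N (enum 'I_r))) G 0 (y s x)).
split=> [|x|x hx]; first exact: trig_bernstein.
  have hG S : `|G S| <= M by exact: fM.
  have := bernstein_norm_le N%:R^-1 (flatten (nseq N (enum 'I_r))) G (fun=> M) 0 _ (y01 s x) hG.
  by rewrite bernstein_cst.
have hG S : `|G S - f x| <= e / 2 + C * \sum_i (S i 0 - y s x i) ^+ 2.
  have [hS|/existsNP[i /negP]] := pselect (forall i, `|S i 0 - y s x i| < d).
    apply: le_trans (hd x S hx hS) _; rewrite lerDl mulr_ge0 //.
    by apply: sumr_ge0 => i _; exact: sqr_ge0.
  rewrite -leNgt => hi; apply: le_trans (_ : 2 * M <= _).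
    have GM : `|G S| <= M by exact: fM.
    by apply: le_trans (ler_normB _ _) _; rewrite mulr_natl mulr2n lerD.
  rewrite -[leLHS]add0r lerD ?(ltW e2) //.
  have -> : 2 * M = C * d ^+ 2 by rewrite /C divfK // gt_eqF // exprn_gt0.
  rewrite ler_wpM2l // (bigD1 i) //= -[leLHS]addr0 lerD //.
    by rewrite -[leRHS]real_normK ?num_real // lerXn2r ?nnegrE // ltW.
  by apply: sumr_ge0 => j _; exact: sqr_ge0.
have := bernstein_approx N G (e / 2) C (f x) _ N0 C0 (y01 s x) hG.
move/le_trans; apply.
have Np : (0 : R) < N%:R by rewrite ltr0n.
have hN : 2 * C * r%:R / e < N%:R by exact: Num.Theory.truncnS_gt.
rewrite [leRHS]splitr lerD // ler_pdivrMr //.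
move: hN; rewrite ltr_pdivrMr // [ltRHS]mulrC => hN.
have : 2 * (C * r%:R) <= 2 * (e / 2 * N%:R).
  by rewrite mulrA (_ : 2 * (e / 2 * N%:R) = e * N%:R); [rewrite ltW|field].
by rewrite ler_pM2l.
Qed.

End Approximation.

End TrigPoly.

(** * Measurability of functions of a random vector *)

Section RandomVector.
Context {R : realType} {d} {Om : measurableType d} {r : nat} (X : Om -> 'cV[R]_r)
  (mX : forall i, measurable_fun setT (fun w => X w i 0)).

Lemma measurable_cos_dot (t : 'cV[R]_r) (a : R) :
  measurable_fun setT (fun w => cos (dot t (X w) + a)).
Proof.
apply: measurableT_comp; first exact: measurable_cosr.
apply: measurable_funD => //; apply: measurable_sum => i.
exact: measurable_funM.
Qed.

Lemma trig_poly_measurable h : trig_poly h -> measurable_fun setT (fun w => h (X w)).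
Proof.
elim=> [c|c1 c2 f g _ IHf _ IHg|t a f _ IH] /=; first exact: measurable_cst.
- by apply: measurable_funD; apply: measurable_funM.
- by apply: measurable_funM => //; exact: measurable_cos_dot.
Qed.

(** Measurability is assumed coordinatewise only. It passes to trigonometric polynomials and then to
    [f], the pointwise limit of such polynomials accurate to [1 / (k + 1)] on the cube of half-width
    [k + 1]. *)
Lemma continuous_vector_measurable (f : 'cV[R]_r -> R) (M : R) : continuous f ->
  (forall x, `|f x| <= M) -> measurable_fun setT (fun w => f (X w)).
Proof.
move=> cf fM.
have approx k := trig_poly_approx f M k.+1%:R cf fM (ltr0Sn _ _) k.+1%:R^-1
  ltac:(by rewrite invr_gt0).
pose h k := sval (cid (approx k)).
have hP k : [/\ trig_poly (h k), (forall x, `|h k x| <= M) &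
    (forall x : 'cV[R]_r, (forall i, `|x i 0| <= k.+1%:R) -> `|h k x - f x| <= k.+1%:R^-1)].
  exact: svalP (cid (approx k)).
apply: (@measurable_fun_cvg _ _ _ _ (fun k w => h k (X w))) => [k|w _].
  by have [+ _ _] := hP k; exact: trig_poly_measurable.
apply/cvgrPdist_le => e e0; near=> k; rewrite distrC.
have [_ _ hk] := hP k; apply: le_trans (hk _ _) _.
  move=> i; apply: le_trans (coord_le_vnorm _ _) _.
  apply: le_trans (_ : k%:R <= _); last by rewrite ler_nat.
  by near: k; exact: nbhs_infty_ger.
rewrite -[leRHS]invrK lef_pV2 ?posrE ?invr_gt0 //.
apply: le_trans (_ : k%:R <= _); last by rewrite ler_nat.
by near: k; exact: nbhs_infty_ger.
Unshelve. all: by end_near. Qed.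

End RandomVector.

Lemma trig_poly_bounded (R : realType) (r : nat) (h : 'cV[R]_r -> R) :
  trig_poly h -> exists M, forall x, `|h x| <= M.
Proof.
elim=> [c|c1 c2 f g _ [M1 b1] _ [M2 b2]|t a f _ [M b]]; first by exists `|c|.
- exists (`|c1| * M1 + `|c2| * M2) => x; apply: le_trans (ler_normD _ _) _.
  by rewrite !normrM lerD // ler_wpM2l.
- exists (M * 1) => x; rewrite normrM ler_pM //.
  exact: cos_max.
Qed.

(** * Weak convergence from expected cosines and tightness *)

Section WeakConvergence.
Context {R : realType} {d d'} {Om : measurableType d} {Om' : measurableType d'}
  (P : probability Om R) (P' : probability Om' R) {r : nat}
  (X : nat -> Om -> 'cV[R]_r) (Y : Om' -> 'cV[R]_r).
Hypotheses (mX : forall n i, measurable_fun setT (fun w => X n w i 0))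
  (mY : forall i, measurable_fun setT (fun w => Y w i 0))
  (cvg_cos : forall t a, \int[P]_w cos (dot t (X n w) + a) @[n --> \oo] -->
     \int[P']_w cos (dot t (Y w) + a)).

Let trig_integ d0 (Om0 : measurableType d0) (P0 : probability Om0 R)
    (X0 : Om0 -> 'cV[R]_r) h : (forall i, measurable_fun setT (fun w => X0 w i 0)) ->
  trig_poly h -> integ P0 (fun w => h (X0 w)).
Proof.
move=> mX0 hh; have [M hM] := trig_poly_bounded _ _ _ hh.
by apply: (integ_bnd P0 _ M) => //; exact: trig_poly_measurable.
Qed.

(** The extra cosine strengthens the induction: when [h] ends with a cosine, the product formula
    merges the two into a sum of single cosines, with frequencies [t0 + t] and [t0 - t]. *)
Let trig_cvg_cos h : trig_poly h -> forall t a,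
  \int[P]_w (h (X n w) * cos (dot t (X n w) + a)) @[n --> \oo] -->
  \int[P']_w (h (Y w) * cos (dot t (Y w) + a)).
Proof.
elim=> [c|c1 c2 f g hf IHf hg IHg|t0 a0 f hf IH] t a.
- have hc := trig_mul t a _ (trig_cst 1).
  have e d0 (Om0 : measurableType d0) (P0 : probability Om0 R)
      (X0 : Om0 -> 'cV[R]_r) : (forall i, measurable_fun setT (fun w => X0 w i 0)) ->
      \int[P0]_w (c * cos (dot t (X0 w) + a)) = c * \int[P0]_w cos (dot t (X0 w) + a).
    move=> mX0; rewrite expectZ //.
    by apply: eq_integ (trig_integ _ _ _ _ _ mX0 hc) => w; rewrite mul1r.
  rewrite e //; under eq_fun do rewrite e //.
  by apply: cvgM; [exact: cvg_cst|exact: cvg_cos].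
- have e d0 (Om0 : measurableType d0) (P0 : probability Om0 R)
      (X0 : Om0 -> 'cV[R]_r) : (forall i, measurable_fun setT (fun w => X0 w i 0)) ->
      \int[P0]_w ((c1 * f (X0 w) + c2 * g (X0 w)) * cos (dot t (X0 w) + a)) =
      c1 * \int[P0]_w (f (X0 w) * cos (dot t (X0 w) + a)) +
      c2 * \int[P0]_w (g (X0 w) * cos (dot t (X0 w) + a)).
    move=> mX0; have i1 := trig_integ _ _ P0 _ _ mX0 (trig_mul t a _ hf).
    have i2 := trig_integ _ _ P0 _ _ mX0 (trig_mul t a _ hg).
    rewrite -!expectZ // -expectD; [|exact: integZ..].
    by apply: eq_expect => w; ring.
  rewrite e //; under eq_fun do rewrite e //.
  by apply: cvgD; apply: cvgM; try exact: cvg_cst; [exact: IHf|exact: IHg].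
- have e d0 (Om0 : measurableType d0) (P0 : probability Om0 R)
      (X0 : Om0 -> 'cV[R]_r) : (forall i, measurable_fun setT (fun w => X0 w i 0)) ->
      \int[P0]_w (f (X0 w) * cos (dot t0 (X0 w) + a0) * cos (dot t (X0 w) + a)) =
      1 / 2 * \int[P0]_w (f (X0 w) * cos (dot (t0 + t) (X0 w) + (a0 + a))) +
      1 / 2 * \int[P0]_w (f (X0 w) * cos (dot (t0 - t) (X0 w) + (a0 - a))).
    move=> mX0; have i1 := trig_integ _ _ P0 _ _ mX0 (trig_mul (t0 + t) (a0 + a) _ hf).
    have i2 := trig_integ _ _ P0 _ _ mX0 (trig_mul (t0 - t) (a0 - a) _ hf).
    rewrite -!expectZ // -expectD; [|exact: integZ..].
    apply: eq_expect => w; rewrite dotDl dotBl.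
    set A1 := dot t0 _; set A2 := dot t _.
    have -> : A1 + A2 + (a0 + a) = (A1 + a0) + (A2 + a) by ring.
    have -> : A1 - A2 + (a0 - a) = (A1 + a0) - (A2 + a) by ring.
    by set u := A1 + a0; set v := A2 + a; rewrite cosD cosB; field.
  rewrite e //; under eq_fun do rewrite e //.
  by apply: cvgD; apply: cvgM; try exact: cvg_cst; exact: IH.
Qed.

Let trig_cvg h : trig_poly h ->
  \int[P]_w h (X n w) @[n --> \oo] --> \int[P']_w h (Y w).
Proof.
move=> hh; have := trig_cvg_cos _ hh 0 0.
have e x : h x * cos (dot 0 x + 0) = h x by rewrite dot0l addr0 cos0 mulr1.
rewrite (eq_expect P' (fun w => h (Y w))) => [|w]; last exact: e.
by under eq_fun do rewrite (eq_expect P _ _ (fun w => e (X _ w))).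
Qed.

Definition out_box (L : R) : set 'cV[R]_r := [set x | exists i, L < `|x i 0|].

Hypothesis tightX : forall e : R, 0 < e -> exists2 L, 0 < L &
  \forall n \near \oo, (P [set w | out_box L (X n w)] <= e%:E)%E.
Hypothesis tightY : forall e : R, 0 < e -> exists2 L, 0 < L &
  (P' [set w | out_box L (Y w)] <= e%:E)%E.

Lemma measurable_out_box d0 (Om0 : measurableType d0)
    (X0 : Om0 -> 'cV[R]_r) L : (forall i, measurable_fun setT (fun w => X0 w i 0)) ->
  measurable [set w | out_box L (X0 w)].
Proof.
move=> mX0.
have -> : [set w | out_box L (X0 w)] = \bigcup_(i in [set: 'I_r]) [set w | L < `|X0 w i 0|].
  by apply/seteqP; split => w /= [i hi]; exists i.
apply: fin_bigcup_measurable => // i _; rewrite -[X in measurable X]setTI.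
have mn : measurable_fun setT (fun w => `|X0 w i 0|) by exact: measurableT_comp.
have := mn measurableT _ (measurable_itv `]L, +oo[).
by congr measurable; apply/seteqP; split => w /=; rewrite in_itv /= andbT.
Qed.

(** The error is at most [e] in the cube and [2 M] outside it; the latter has probability at most
    [e / (M + 1)] and contributes at most [2 e]. *)
Let expect_close d0 (Om0 : measurableType d0) (P0 : probability Om0 R)
    (X0 : Om0 -> 'cV[R]_r) f h (M e L : R) : (forall i, measurable_fun setT (fun w => X0 w i 0)) ->
  continuous f -> trig_poly h -> 0 <= M -> 0 < e ->
  (forall x, `|f x| <= M) -> (forall x, `|h x| <= M) ->
  (forall x : 'cV[R]_r, (forall i, `|x i 0| <= L) -> `|h x - f x| <= e) ->
  (P0 [set w | out_box L (X0 w)] <= (e / (M + 1))%:E)%E ->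
  `|\int[P0]_w h (X0 w) - \int[P0]_w f (X0 w)| <= 3 * e.
Proof.
move=> mX0 cf hh M0 e0 fM hM hL hP.
have ih : integ P0 (fun w => h (X0 w)) := trig_integ _ _ P0 _ _ mX0 hh.
have if_ : integ P0 (fun w => f (X0 w)).
  by apply: (integ_bnd P0 _ M) => //; exact: continuous_vector_measurable fM.
have mO := measurable_out_box _ _ _ L mX0; set O := [set w | _] in hP mO.
have iO : integ P0 (fun w => \1_O w).
  by apply: (integ_bnd P0 _ 1) => [|w]; [exact: measurable_indic|exact: indic_le1].
rewrite -expectB //; apply: le_trans (expect_norm _ _ (integB _ _ _ ih if_)) _.
apply: le_trans (_ : \int[P0]_w (e + 2 * M * \1_O w) <= _).
  apply: expect_le => [||w].
  - exact: (integrable_norm (integB _ _ _ ih if_)).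
  - by apply: integD; [exact: integ_cst|exact: integZ].
  rewrite indicE; case: (boolP (w \in O)) => [_|].
    rewrite mulr1; apply: le_trans (ler_normB _ _) _.
    by have := fM (X0 w); have := hM (X0 w); lra.
  rewrite notin_setE => hw; rewrite mulr0 addr0; apply: hL => i.
  by rewrite leNgt; apply/negP => hi; apply: hw; exists i.
rewrite expectD; [|exact: integ_cst|exact: integZ].
rewrite expect_cst expectZ // expect_indic //.
have : fine (P0 O) <= e / (M + 1) by rewrite -lee_fin fineK // fin_num_measure.
rewrite ler_pdivlMr; last lra.
have q0 : 0 <= fine (P0 O) by rewrite fine_ge0.
by move=> h1; nra.
Qed.

Lemma weak_convergence (f : 'cV[R]_r -> R) (M : R) : continuous f ->
  (forall x, `|f x| <= M) ->
  \int[P]_w f (X n w) @[n --> \oo] --> \int[P']_w f (Y w).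
Proof.
move=> cf fM; have M0 : 0 <= M by exact: le_trans (normr_ge0 _) (fM 0).
apply/cvgrPdist_le => e e0.
(* Replacing [f] by [h] costs [3 (e / 7)] on each side, and the convergence for [h] a further
   [e / 7]. *)
have e7 : 0 < e / 7 by rewrite divr_gt0.
have eM : 0 < e / 7 / (M + 1) by rewrite divr_gt0 // ltr_wpDl.
have [L1 L10 t1] := tightX _ eM; have [L2 L20 t2] := tightY _ eM.
pose L := Num.max L1 L2.
have L0 : 0 < L by rewrite lt_max L10.
have sub L' : L' <= L -> out_box L `<=` out_box L'.
  by move=> le x [i hi]; exists i; exact: le_lt_trans hi.
have [h [hh hM hL]] := trig_poly_approx f M L cf fM L0 _ e7.
have mono d0 (Om0 : measurableType d0) (P0 : probability Om0 R)
    (X0 : Om0 -> 'cV[R]_r) L' : (forall i, measurable_fun setT (fun w => X0 w i 0)) ->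
    L' <= L -> (P0 [set w | out_box L (X0 w)] <= P0 [set w | out_box L' (X0 w)])%E.
  move=> mX0 le; apply: le_measure; rewrite ?inE; try exact: measurable_out_box.
  by move=> w; exact: sub.
have cY : `|\int[P']_w h (Y w) - \int[P']_w f (Y w)| <= 3 * (e / 7).
  apply: (expect_close _ _ P' Y f h M _ L) => //.
  by apply: le_trans t2; apply: mono => //; rewrite le_max lexx orbT.
near=> n.
have cX : `|\int[P]_w h (X n w) - \int[P]_w f (X n w)| <= 3 * (e / 7).
  apply: (expect_close _ _ P (X n) f h M _ L) => //.
  apply: le_trans (mono _ _ P _ L1 _ _) _ => //; first by rewrite le_max lexx.
  by near: n.
have cXY : `|\int[P']_w h (Y w) - \int[P]_w h (X n w)| <= e / 7.
  by near: n; move/cvgrPdist_le : (trig_cvg _ hh); apply.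
move: cX cY cXY; rewrite !ler_norml => /andP[? ?] /andP[? ?] /andP[? ?].
by apply/andP; split; lra.
Unshelve. all: by end_near. Qed.

End WeakConvergence.

(** * Calculus of events of probability tending to one *)

Section HighProbability.
Context {R : realType} {d} {Om : measurableType d} (P : probability Om R).
Implicit Types (E F : nat -> set Om) (X : nat -> Om -> R).

Lemma probability_compl_ge (A : set Om) (e : R) : measurable A ->
  (P A <= e%:E)%E -> ((1 - e)%:E <= P (~` A))%E.
Proof.
by move=> mA h; rewrite probability_setC // EFinB leeB.
Qed.

Lemma probability_compl_le (A : set Om) (e : R) : measurable A ->
  ((1 - e)%:E <= P A)%E -> (P (~` A) <= e%:E)%E.
Proof.
move=> mA; rewrite probability_setC // -(fineK (fin_num_measure P A mA)) -EFinB !lee_fin.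
by lra.
Qed.

Lemma prob_to_oneS E F : (\forall n \near \oo, E n `<=` F n) ->
  prob_to_one P E -> prob_to_one P F.
Proof.
move=> EF hE delta d0; near=> n.
have [B [mB BE PB]] : exists B, [/\ measurable B, B `<=` E n & ((1 - delta)%:E <= P B)%E].
  by near: n; exact: hE.
exists B; split => //; apply: subset_trans BE _.
by near: n.
Unshelve. all: by end_near. Qed.

Lemma probability_setI_ge (A B : set Om) (e1 e2 : R) : measurable A -> measurable B ->
  ((1 - e1)%:E <= P A)%E -> ((1 - e2)%:E <= P B)%E ->
  ((1 - (e1 + e2))%:E <= P (A `&` B))%E.
Proof.
move=> mA mB hA hB.
have compl (C : set Om) (e : R) : measurable C -> ((1 - e)%:E <= P C)%E -> (P (~` C) <= e%:E)%E.
  exact: probability_compl_le.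
rewrite -[A `&` B]setCK setCI; apply: probability_compl_ge.
  by apply: measurableU; exact: measurableC.
apply: le_trans (measureU2 _ _ _) _; [exact: measurableC|exact: measurableC|].
by rewrite EFinD leeD // compl.
Qed.

Lemma prob_to_oneI E F : prob_to_one P E -> prob_to_one P F ->
  prob_to_one P (fun n => E n `&` F n).
Proof.
move=> hE hF delta d0; have d2 : 0 < delta / 2 by rewrite divr_gt0.
near=> n.
have [B [mB BE PB]] : exists B, [/\ measurable B, B `<=` E n & ((1 - delta / 2)%:E <= P B)%E].
  by near: n; exact: hE.
have [C [mC CF PC]] : exists B, [/\ measurable B, B `<=` F n & ((1 - delta / 2)%:E <= P B)%E].
  by near: n; exact: hF.
exists (B `&` C); split; [exact: measurableI|exact: setISS|].
by rewrite [delta]splitr; exact: probability_setI_ge.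
Unshelve. all: by end_near. Qed.

Lemma op_rate_prob X rate : op_rate P X rate <->
  forall eps, 0 < eps -> prob_to_one P (fun n => [set w | `|X n w| <= eps * rate n]).
Proof.
split=> h eps.
  move=> e0 delta d0; apply: filterS (h eps delta e0 d0) => n [A [mA sA PA]].
  exists (~` A); split; [exact: measurableC| |exact: probability_compl_ge].
  by move=> w /= nA; rewrite leNgt; apply/negP => hw; apply: nA; exact: sA.
move=> delta e0 d0; apply: filterS (h eps e0 delta d0) => n [B [mB sB PB]].
exists (~` B); split; first exact: measurableC.
  by move=> w /= hw hB; have := sB w hB; rewrite /= leNgt hw.
exact: probability_compl_le.
Qed.

Definition Op X (rate : nat -> R) := forall delta, 0 < delta ->
  exists2 M, 0 < M & \forall n \near \oo, exists B,
    [/\ measurable B, B `<=` [set w | X n w <= M * rate n] & ((1 - delta)%:E <= P B)%E].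

(** A quantity that is O_p of a rate may be treated as bounded by a fixed multiple of it: the
    constant depends on [delta], but the conclusion does not mention it. Half of [delta] pays for
    the choice of [M]. *)
Lemma prob_to_one_Op X rate F : Op X rate ->
  (forall M, 0 < M -> prob_to_one P (fun n => [set w | X n w <= M * rate n -> F n w])) ->
  prob_to_one P F.
Proof.
move=> hX hF delta d0; have d2 : 0 < delta / 2 by rewrite divr_gt0.
have [M M0 hM] := hX _ d2.
near=> n.
have [B [mB BE PB]] : exists B,
   [/\ measurable B, B `<=` [set w | X n w <= M * rate n] & ((1 - delta / 2)%:E <= P B)%E].
  by near: n.
have [C [mC CF PC]] : exists B,
   [/\ measurable B, B `<=` [set w | X n w <= M * rate n -> F n w] & ((1 - delta / 2)%:E <= P B)%E].
  by near: n; exact: hF.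
exists (B `&` C); split; first exact: measurableI.
  by move=> w [/BE hB /CF]; apply.
by rewrite [delta]splitr; exact: probability_setI_ge.
Unshelve. all: by end_near. Qed.

Lemma markov_event (f : Om -> R) (e t : R) : integ P f -> (forall w, 0 <= f w) ->
  \int[P]_w f w <= e -> 0 < t ->
  exists B, [/\ measurable B, B `<=` [set w | f w <= t] & ((1 - e / t)%:E <= P B)%E].
Proof.
move=> fi f0 fe t0; have [mS hS] := markov_ge P f e t fi f0 fe t0.
exists (~` [set w | t <= f w]); split; [exact: measurableC| |exact: probability_compl_ge].
by move=> w /= /negP; rewrite -ltNge => /ltW.
Qed.

Lemma Op_markov X (rate : nat -> R) (K : R) :
  (\forall n \near \oo, [/\ 0 < rate n, integ P (X n), (forall w, 0 <= X n w) &
     \int[P]_w X n w <= K * rate n]) -> Op X rate.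
Proof.
move=> h delta d0; pose M := (`|K| + 1) / delta.
have M0 : 0 < M by rewrite divr_gt0 // ltr_wpDl.
exists M => //; apply: filterS h => n [r0 iX X0 EX].
have [|B [mB sB PB]] := markov_event _ _ (M * rate n) iX X0 EX; first by rewrite mulr_gt0.
exists B; split => //; apply: le_trans PB; rewrite lee_fin lerD2l lerN2.
rewrite -mulf_div divff ?gt_eqF // mulr1 ler_pdivrMr // /M mulrC divfK ?gt_eqF //.
by have := ler_norm K; lra.
Qed.

Lemma prob_markov X (rate : nat -> R) :
  (forall e, 0 < e -> \forall n \near \oo, [/\ 0 < rate n, integ P (X n),
    (forall w, 0 <= X n w) & \int[P]_w X n w <= e * rate n]) ->
  forall e, 0 < e -> prob_to_one P (fun n => [set w | X n w <= e * rate n]).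
Proof.
move=> h e e0 delta d0; have ed : 0 < e * delta by rewrite mulr_gt0.
apply: filterS (h _ ed) => n [r0 iX X0 EX].
have [|B [mB sB PB]] := markov_event _ _ (e * rate n) iX X0 EX; first by rewrite mulr_gt0.
exists B; split => //; apply: le_trans PB; rewrite lee_fin lerD2l lerN2.
rewrite -mulf_div divff ?gt_eqF // mulr1 mulrAC divff ?gt_eqF // mul1r //.
Qed.

End HighProbability.

(** * Moments of sample means and the weak law of large numbers *)

Section SampleMeans.
Context {R : realType} {dO d} {Om : measurableType dO} {T : measurableType d}
  (P : probability Om R) (Q : probability T R) (Z : nat -> Om -> T).
Hypothesis iid : iid_seq P Z Q.

Lemma sqint_avg n (f : T -> R) : sqint Q f ->
  sqint P (fun w => avg (fun j : 'I_n => f (Z j w))).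
Proof. by move=> hf; apply: sqintZ; exact: (sqint_iid_sum P Q Z iid). Qed.

Lemma expect_avg_sqr n (f : T -> R) : (0 < n)%N -> sqint Q f -> \int[Q]_z f z = 0 ->
  \int[P]_w (avg (fun j : 'I_n => f (Z j w)) ^+ 2) = n%:R^-1 * \int[Q]_z (f z ^+ 2).
Proof.
move=> n0 hf f0; under eq_Rintegral do rewrite exprMn.
rewrite expectZ; last by have [] := sqint_iid_sum P Q Z iid n f hf.
by rewrite (expect_sum_sqr P Q Z iid) //; field; rewrite pnatr_eq0 -lt0n.
Qed.

Lemma sqint_vnorm d' (T' : measurableType d') (P' : probability T' R)
  k (g : T' -> 'cV[R]_k) : (forall i, sqint P' (fun z => g z i 0)) ->
  integ P' (fun z => vnorm (g z) ^+ 2) /\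
  \int[P']_z (vnorm (g z) ^+ 2) = \sum_i \int[P']_z (g z i 0 ^+ 2).
Proof.
move=> hg; have e z : vnorm (g z) ^+ 2 = \sum_i g z i 0 ^+ 2 := vnorm_sqr_sum _.
split.
  by apply: (eq_integ P' (fun z => \sum_i g z i 0 ^+ 2)) => [z|]; [|apply: integ_sum => i; have [] := hg i].
rewrite (eq_expect P' _ _ e) expect_sum // => i; by have [] := hg i.
Qed.

Lemma expect_smean_sqr n k (g : T -> 'cV[R]_k) : (0 < n)%N ->
  (forall i, sqint Q (fun z => g z i 0)) -> (forall i, \int[Q]_z g z i 0 = 0) ->
  integ P (fun w => vnorm (smean Z g n w) ^+ 2) /\
  \int[P]_w (vnorm (smean Z g n w) ^+ 2) = n%:R^-1 * \int[Q]_z (vnorm (g z) ^+ 2).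
Proof.
move=> n0 hg g0.
have e w i : smean Z g n w i 0 = avg (fun j : 'I_n => g (Z j w) i 0).
  by rewrite /smean !mxE summxE.
have hs i : sqint P (fun w => smean Z g n w i 0).
  by apply: eq_sqint (sqint_avg n _ (hg i)) => w; rewrite e.
have [i1 e1] := sqint_vnorm _ _ P _ _ hs; split => //; rewrite e1.
have [_ ->] := sqint_vnorm _ _ Q _ _ hg; rewrite mulr_sumr; apply: eq_bigr => i _.
rewrite -(expect_avg_sqr n _ n0 (hg i) (g0 i)).
by apply: eq_expect => w; rewrite e.
Qed.

(** The pointwise bound [|y| <= s + y^2 / s] turns a second-moment bound into one on the first
    absolute moment, with a free parameter in place of a square root. *)
Lemma expect_abs_le d' (T' : measurableType d') (P' : probability T' R)
  (f : T' -> R) (s : R) : 0 < s -> sqint P' f ->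
  \int[P']_w `|f w| <= s + s^-1 * \int[P']_w (f w ^+ 2).
Proof.
move=> s0 hf; have [mf f2] := hf.
rewrite -expectZ // -[X in _ <= X + _](expect_cst P') -expectD; [|exact: integ_cst|exact: integZ].
apply: expect_le => [||w].
- exact: (integrable_norm (sqint_integ P' f hf)).
- by apply: integD; [exact: integ_cst|exact: integZ].
rewrite -(real_normK (num_real (f w))) -subr_ge0.
set y := `|f w|; have -> : s + s^-1 * y ^+ 2 - y = s^-1 * ((s - y / 2) ^+ 2 + 3 / 4 * y ^+ 2).
  by field; rewrite gt_eqF.
by rewrite mulr_ge0 ?invr_ge0 ?(ltW s0) // addr_ge0 ?sqr_ge0 // mulr_ge0 ?sqr_ge0.
Qed.

(** Only a first moment is available for products such as [v i * v l], so [f] is truncated at a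
    level [K]. The centred bounded part is small by its variance, the rest is small in mean
    uniformly in [n], and convergence in mean gives the claim by Markov's inequality. *)
Lemma weak_lln (f : T -> R) e : integ Q f -> 0 < e ->
  prob_to_one P (fun n => [set w | `|avg (fun j : 'I_n => f (Z j w)) - \int[Q]_z f z| <= e]).
Proof.
move=> hf; move: e; have mf := integ_mfun Q f hf.
have iav n (g : T -> R) : integ Q g -> integ P (fun w => avg (fun j : 'I_n => g (Z j w))).
  by move=> ig; apply: integZ; apply: integ_sum => j; exact: (integ_iid P Q Z iid).
have Eav n (g : T -> R) : (0 < n)%N -> integ Q g ->
    \int[P]_w avg (fun j : 'I_n => g (Z j w)) = \int[Q]_z g z.
  move=> n0 ig; rewrite expectZ; last by apply: integ_sum => j; exact: (integ_iid P Q Z iid).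
  rewrite expect_sum; last by move=> j; exact: (integ_iid P Q Z iid).
  rewrite (eq_bigr (fun=> \int[Q]_z g z)); last by move=> j _; exact: (expect_iid P Q Z iid).
  by rewrite sumr_const card_ord -(mulr_natl (\int[Q]_z g z)) mulrA mulVf ?mul1r // pnatr_eq0 -lt0n.
suff : forall e, 0 < e -> \forall n \near \oo,
    \int[P]_w `|avg (fun j : 'I_n => f (Z j w)) - \int[Q]_z f z| <= e.
  move=> H e e0.
  have := prob_markov P (fun n w => `|avg (fun j : 'I_n => f (Z j w)) - \int[Q]_z f z|) (fun=> 1).
  rewrite /= => H2; have := H2 _ e e0; rewrite mulr1; apply.
  move=> e' e'0; apply: filterS (H e' e'0) => n hn; split => //; last by rewrite mulr1.
  have : integ P (fun w => avg (fun j : 'I_n => f (Z j w)) - \int[Q]_z f z).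
    by apply: integB; [exact: iav|exact: integ_cst].
  exact: integrable_norm.
move=> e e0; have e8 : 0 < e / 8 by rewrite divr_gt0.
pose A (K : nat) := [set z | `|f z| <= K%:R].
have mA K : measurable (A K).
  rewrite -[X in measurable X]setTI.
  have mn : measurable_fun setT (fun z => `|f z|) by exact: measurableT_comp.
  have := mn measurableT _ (measurable_itv `]-oo, K%:R]).
  by congr measurable; apply/seteqP; split => w /=; rewrite in_itv.
have mI K : measurable_fun setT (\1_(A K) : T -> R) by exact: measurable_indic.
have hK : \int[Q]_z (`|f z| * (1 - \1_(A K) z)) @[K --> \oo] --> 0.
  apply: (dominated_expect Q (fun K z => `|f z| * (1 - \1_(A K) z)) (fun z => `|f z|)) => [K||K z|z].
  - by apply: measurable_funM; [exact: measurableT_comp|exact: measurable_funB].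
  - exact: integrable_norm hf.
  - rewrite normrM normr_id indicE; case: (_ \in _); rewrite ?subrr ?subr0 ?normr0 ?normr1 ?mulr0 ?mulr1 //.
  - apply: cvg_near_cst; near=> K; rewrite indicE mem_set ?subrr ?mulr0 //=.
    by near: K; exact: nbhs_infty_ger.
have [K hKe] : exists K, \int[Q]_z (`|f z| * (1 - \1_(A K) z)) <= e / 8.
  have /cvgrPdist_le/(_ _ e8)[N _ /(_ N (leqnn N))] := hK.
  by rewrite /= sub0r normrN => h; exists N; apply: le_trans h; exact: ler_norm.
pose g z := f z * \1_(A K) z; pose h z := f z * (1 - \1_(A K) z).
have mg : measurable_fun setT g by exact: measurable_funM.
have gK z : `|g z| <= K%:R.
  rewrite /g normrM indicE; case: (boolP (z \in A K)); rewrite ?normr0 ?mulr0 //.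
  by rewrite inE normr1 mulr1.
have sg := sqint_bnd Q g K%:R mg gK; have ig := sqint_integ Q g sg.
have ih : integ Q h.
  by apply: (eq_integ Q (fun z => f z - g z)) (integB Q _ _ hf ig) => z; rewrite /g /h; ring.
have nh : \int[Q]_z `|h z| <= e / 8.
  apply: le_trans hKe; rewrite le_eqVlt; apply/orP; left; apply/eqP; apply: eq_expect => z.
  rewrite /h normrM; congr (_ * _); rewrite ger0_norm // subr_ge0 indicE.
have inh : integ Q (fun z => `|h z|) := integrable_norm ih.
pose g0 z := g z - \int[Q]_z g z.
have sg0 : sqint Q g0 by apply: sqintB => //; exact: sqint_cst.
have Eg0 : \int[Q]_z g0 z = 0.
  by rewrite expectB ?expect_cst ?subrr //; exact: integ_cst.
have fE : \int[Q]_z f z = \int[Q]_z g z + \int[Q]_z h z.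
  by rewrite -expectD //; apply: eq_expect => z; rewrite /g /h; ring.
set V := \int[Q]_z (g0 z ^+ 2).
near=> n.
have n0 : (0 < n)%N by near: n; exact: nbhs_infty_gt.
have np : (0 : R) < n%:R by rewrite ltr0n.
have nV : 64 * V / e ^+ 2 <= n%:R by near: n; exact: nbhs_infty_ger.
have b1 : \int[P]_w `|avg (fun j : 'I_n => g0 (Z j w))| <= e / 4.
  apply: le_trans (expect_abs_le _ _ P _ _ e8 (sqint_avg n _ sg0)) _.
  rewrite expect_avg_sqr // -/V.
  have : n%:R^-1 * V <= e ^+ 2 / 64.
    rewrite mulrC ler_pdivrMr // -ler_pdivrMl ?divr_gt0 ?exprn_gt0 //.
    by rewrite invf_div mulrAC.
  move=> h1; have : (e / 8)^-1 * (n%:R^-1 * V) <= (e / 8)^-1 * (e ^+ 2 / 64).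
    by rewrite ler_pM2l // invr_gt0.
  have -> : (e / 8)^-1 * (e ^+ 2 / 64) = e / 8 by field; rewrite gt_eqF.
  by lra.
have i1 : integ P (fun w => `|avg (fun j : 'I_n => g0 (Z j w))|).
  by apply: integrable_norm; apply: iav; exact: sqint_integ.
have i2 : integ P (fun w => avg (fun j : 'I_n => `|h (Z j w)|)) by exact: (iav n (fun z => `|h z|)).
apply: le_trans (_ : \int[P]_w (`|avg (fun j : 'I_n => g0 (Z j w))| +
   (avg (fun j : 'I_n => `|h (Z j w)|) + e / 8)) <= _).
  apply: expect_le => [||w].
  - have : integ P (fun w => avg (fun j : 'I_n => f (Z j w)) - \int[Q]_z f z).
      by apply: integB; [exact: iav|exact: integ_cst].
    exact: integrable_norm.
  - by apply: integD => //; apply: integD => //; exact: integ_cst.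
  have -> : avg (fun j : 'I_n => f (Z j w)) - \int[Q]_z f z =
      avg (fun j : 'I_n => g0 (Z j w)) + (avg (fun j : 'I_n => h (Z j w)) - \int[Q]_z h z).
    have -> : avg (fun j : 'I_n => f (Z j w)) =
        avg (fun j : 'I_n => g0 (Z j w) + \int[Q]_z g z + h (Z j w)).
      by congr (_ * _); apply: eq_bigr => j _; rewrite /g0 /g /h; ring.
    have ec : avg (fun _ : 'I_n => \int[Q]_z g z) = \int[Q]_z g z.
      exact: avg_cst.
    by rewrite !avgD ec fE; ring.
  apply: le_trans (ler_normD _ _) _; rewrite lerD //.
  apply: le_trans (ler_normB _ _) _; rewrite lerD //.
    rewrite /avg normrM ger0_norm ?invr_ge0 ?ler0n // ler_wpM2l ?invr_ge0 ?ler0n //.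
    exact: ler_norm_sum.
  exact: le_trans (expect_norm Q _ ih) nh.
rewrite expectD //; last by apply: integD => //; exact: integ_cst.
rewrite expectD //; last exact: integ_cst.
rewrite expect_cst (Eav n (fun z => `|h z|)) //; lra.
Unshelve. all: by end_near. Qed.

End SampleMeans.

(** * Matrices, Gram forms and norms *)

Lemma sqint_coord (R : realType) d (T : measurableType d)
    (P : probability T R) (k : nat) (g : T -> 'cV[R]_k) :
  (forall i, measurable_fun setT (fun z => g z i 0)) ->
  (\int[P]_z (vnorm (g z) ^+ 2)%:E < +oo)%E -> forall i, sqint P (fun z => g z i 0).
Proof.
move=> mg h i.
have mn : measurable_fun setT (fun z => vnorm (g z) ^+ 2).
  rewrite (_ : (fun z => _) = (fun z => \sum_i g z i 0 ^+ 2)).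
    by apply: measurable_sum => j; exact: measurable_funX.
  by apply/funext => z; exact: vnorm_sqr_sum.
have ig : integ P (fun z => vnorm (g z) ^+ 2).
  by apply: ge0_integ => // z; exact: sqr_ge0.
split; first exact: mg.
apply: (integ_le P _ _ _ _ ig) => [|z]; first exact: measurable_funX.
by rewrite ger0_norm ?sqr_ge0 // -(real_normK (num_real (g z i 0))) lerXn2r ?nnegrE ?vnorm_ge0 // coord_le_vnorm.
Qed.

Lemma norm_entry_le_opnorm (R : realType) (p q : nat) (M : 'M[R]_(p, q)) i l :
  `|M i l| <= opnorm M.
Proof.
have e1 : vnorm (delta_mx l 0 : 'cV[R]_q) = 1.
  by rewrite vnormE dot_delta mxE !eqxx sqrtr1.
have -> : M i l = (M *m (delta_mx l 0 : 'cV[R]_q)) i 0 by rewrite -colE mxE.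
apply: le_trans (coord_le_vnorm _ _) _.
by have := vnorm_mul_opnorm M (delta_mx l 0 : 'cV[R]_q); rewrite e1 mulr1.
Qed.

Lemma regular_quad (R : realType) (m : nat -> nat) (W : forall n, 'M[R]_(m n)) :
  regular_seq W -> exists c C : R, [/\ 0 < c, 0 < C &
    forall n (a : 'cV[R]_(m n)), c * dot a a <= dot a (W n *m a) <= C * dot a a].
Proof.
(* The maximum with 1 makes the upper constant positive without appealing to a unit vector, which
   dimension 0 does not have. *)
move=> [c [C [c0 h]]]; exists c, (Num.max C 1); split=> // [|n a].
  by rewrite lt_max ltr01 orbT.
have [->|a0] := eqVneq a 0; first by rewrite mulmx0 !dot0r !mulr0 lexx.
have na : 0 < vnorm a.
  by rewrite lt_def vnorm_ge0 andbT; apply: contraNneq a0 => /vnorm_eq0 ->.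
have := h n ((vnorm a)^-1 *: a).
rewrite vnormZ ger0_norm ?invr_ge0 ?vnorm_ge0 // mulVf ?gt_eqF // => /(_ erefl).
rewrite -mulmxA mxdotE -scalemxAr dotZl dotZr mulrA -expr2 exprVn mulrC.
rewrite ler_pdivlMr ?exprn_gt0 // ler_pdivrMr ?exprn_gt0 // vnorm_sqr => /andP[-> h2] /=.
by apply: le_trans h2 _; rewrite ler_wpM2r ?dot_ge0 // le_max lexx.
Qed.

Lemma gram_quad (R : realType) d (T : measurableType d)
    (Q : probability T R) (f : nat -> T -> R) (k : nat) (a : 'cV[R]_k) :
  (forall i, sqint Q (f i)) ->
  dot a (gram Q f k *m a) = \int[Q]_z (dot (colfun f k z) a ^+ 2).
Proof.
move=> hf.
have e z : dot (colfun f k z) a = \sum_i a i 0 * f i z.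
  by apply: eq_bigr => i _; rewrite mxE mulrC.
rewrite (eq_expect Q (fun z => \sum_i \sum_l (a i 0 * a l 0) * (f i z * f l z))); last first.
  move=> z; rewrite e expr2 mulr_suml; apply: eq_bigr => i _; rewrite mulr_sumr.
  by apply: eq_bigr => l _; ring.
have il i l : integ Q (fun z => (a i 0 * a l 0) * (f i z * f l z)).
  by apply: integZ; exact: sqint_mul.
rewrite expect_sum => [|i]; last by apply: integ_sum => l; exact: il.
apply: eq_bigr => i _; rewrite expect_sum => [|l]; last exact: il.
rewrite mxE mulr_sumr; apply: eq_bigr => l _; rewrite expectZ; last exact: sqint_mul.
by rewrite !mxE /Rintegral; ring.
Qed.

Lemma outer_mulmx (R : realType) (p q : nat) (x : 'cV[R]_p) (y a : 'cV[R]_q) :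
  (x *m y^T) *m a = dot y a *: x.
Proof.
apply/colP => i; rewrite -mulmxA !mxE big_ord1 mulrC; congr (_ * _).
by rewrite mxE; apply: eq_bigr => j _; rewrite mxE.
Qed.

Lemma avgv_outer (R : realType) (n p q : nat) (x : 'I_n -> 'cV[R]_p) (y : 'I_n -> 'cV[R]_q) a :
  (n%:R^-1 *: \sum_j (x j *m (y j)^T)) *m a = avgv (fun j => dot (y j) a *: x j).
Proof.
rewrite -scalemxAl mulmx_suml; congr (_ *: _); apply: eq_bigr => j _.
exact: outer_mulmx.
Qed.

(** * Projection onto the closed linear span *)

Section L2Projection.
Context {R : realType} {d} {T : measurableType d} (Q : probability T R)
  (v : nat -> T -> R) (sv : forall i, sqint Q (v i)) (mean0 : forall i, \int[Q]_z v i z = 0).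
Variables (g h : T -> R).
Hypotheses (sg : sqint Q g) (gh : L2proj Q v g h).

Lemma L2proj_sqint : sqint Q h.
Proof.
have [mh h2 _ _] := gh; split => //.
by apply: ge0_integ => // [|z]; [exact: measurable_funX|exact: sqr_ge0].
Qed.

Let sh := L2proj_sqint.

Lemma L2proj_orth i : \int[Q]_z ((g z - h z) * v i z) = 0.
Proof. by have [_ _ + _] := gh; rewrite /Rintegral => ->. Qed.

Lemma span_sqint N (c : 'I_N -> R) : sqint Q (fun z => \sum_(i < N) c i * v i z).
Proof. by apply: sqint_sum => i; exact: sqintZ. Qed.

Lemma L2proj_approx eps : 0 < eps -> exists N (c : 'I_N -> R),
  \int[Q]_z ((h z - \sum_(i < N) c i * v i z) ^+ 2) < eps.
Proof.
move=> e0; have [_ _ _ /(_ eps e0)[N [c hc]]] := gh; exists N, c.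
have [_ i2] := sqintB Q _ _ sh (span_sqint N c).
by rewrite -lte_fin EFin_expect.
Qed.

(** Subtracting a finite combination of the [v i] from [h] leaves the inner product with [f]
    unchanged and makes [h] arbitrarily small, so Cauchy-Schwarz forces the product to be 0. *)
Lemma L2proj_closed_span f : sqint Q f -> (forall i, \int[Q]_z (f z * v i z) = 0) ->
  \int[Q]_z (f z * h z) = 0.
Proof.
move=> sf fv.
set b := \int[Q]_z _; set F := \int[Q]_z (f z ^+ 2).
have F0 : 0 <= F by rewrite /F; apply: expect_ge0 => z; exact: sqr_ge0.
suff : b ^+ 2 <= 0 by rewrite exprn_even_le0 //= => /eqP.
apply/ler_addgt0Pr => e e0; rewrite add0r.
have F1 : 0 < F + 1 by rewrite ltr_wpDl.
have [|N [c hc]] := L2proj_approx (e / (F + 1)); first by rewrite divr_gt0.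
have ss := span_sqint N c.
have -> : b = \int[Q]_z (f z * (h z - \sum_(i < N) c i * v i z)).
  have e1 : \int[Q]_z (f z * \sum_(i < N) c i * v i z) = 0.
    rewrite (eq_expect Q (fun z => \sum_(i < N) c i * (f z * v i z))); last first.
      by move=> z; rewrite mulr_sumr; apply: eq_bigr => i _; ring.
    rewrite expect_sum => [|i]; last by apply: integZ; exact: sqint_mul.
    by apply: big1 => i _; rewrite expectZ ?fv ?mulr0 //; exact: sqint_mul.
  rewrite (eq_expect Q (fun z => f z * h z - f z * \sum_(i < N) c i * v i z)); last first.
    by move=> z; rewrite mulrBr.
  by rewrite expectB ?e1 ?subr0 //; exact: sqint_mul.
apply: le_trans (cauchy_schwarz_expect Q _ _ sf (sqintB Q _ _ sh ss)) _.
rewrite -/F; apply: le_trans (ler_wpM2l F0 (ltW hc)) _.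
by rewrite mulrA ler_pdivrMr // mulrC ler_pM2l // lerDl.
Qed.

(** Since every [v i] has mean 0, the constant 1 is orthogonal to the span, hence to [h]. *)
Lemma L2proj_mean0 : \int[Q]_z h z = 0.
Proof.
rewrite -[RHS](L2proj_closed_span (fun=> 1) (sqint_cst Q 1)) => [|i].
  by apply: eq_expect => z; rewrite mul1r.
by rewrite -[RHS](mean0 i); apply: eq_expect => z; rewrite mul1r.
Qed.

(** Pythagoras: the error of [pr] is orthogonal to all combinations of the first [k] functions, so
    any other combination adds a square. The coefficients [c] are padded with zeros up to [k]. *)
Lemma L2proj_best k (pr : 'cV[R]_k) N (c : 'I_N -> R) : (N <= k)%N ->
  (forall i : 'I_k, \int[Q]_z ((h z - dot (colfun v k z) pr) * v i z) = 0) ->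
  \int[Q]_z ((h z - dot (colfun v k z) pr) ^+ 2) <=
  \int[Q]_z ((h z - \sum_(i < N) c i * v i z) ^+ 2).
Proof.
move=> Nk orth.
pose c' (i : nat) : R := if insub i is Some j then c j else 0.
pose a : 'cV[R]_k := \col_i c' i.
have sdot (x : 'cV[R]_k) : sqint Q (fun z => dot (colfun v k z) x).
  apply: eq_sqint (span_sqint k (fun i => x i 0)) => z.
  by apply: eq_bigr => i _; rewrite mxE mulrC.
have aE z : \sum_(i < N) c i * v i z = dot (colfun v k z) a.
  rewrite (eq_bigr (fun i : 'I_N => c' i * v i z)) => [|i _]; last by rewrite /c' valK.
  rewrite (big_ord_widen k (fun i => c' i * v i z)) // big_mkcond.
  apply: eq_bigr => i _; rewrite !mxE /c'; case: insubP => [j jN _|]; first by rewrite jN mulrC.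
  by move=> /negbTE ->; rewrite mulr0.
have orthx (x : 'cV[R]_k) : \int[Q]_z ((h z - dot (colfun v k z) pr) * dot (colfun v k z) x) = 0.
  have sD := sqintB Q _ _ sh (sdot pr).
  rewrite (eq_expect Q (fun z => \sum_i x i 0 * ((h z - dot (colfun v k z) pr) * v i z))); last first.
    by move=> z; rewrite [X in _ * X]/dot mulr_sumr; apply: eq_bigr => i _; rewrite mxE; ring.
  rewrite expect_sum => [|i]; last by apply: integZ; exact: sqint_mul.
  by apply: big1 => i _; rewrite expectZ ?orth ?mulr0 //; exact: sqint_mul.
have sD := sqintB Q _ _ sh (sdot pr); have sE := sdot (pr - a).
have i1 := sD.2; have i2 := sE.2; have i3 := sqint_mul Q _ _ sD sE.
rewrite [leRHS](eq_expect Q (fun z => (h z - dot (colfun v k z) pr) ^+ 2 +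
  (2 * ((h z - dot (colfun v k z) pr) * dot (colfun v k z) (pr - a)) +
   dot (colfun v k z) (pr - a) ^+ 2))); last first.
  by move=> z; rewrite aE dotBr; ring.
have i4 := integZ Q 2 _ i3.
rewrite [leRHS]expectD //; last exact: integD.
rewrite [X in _ <= _ + X]expectD // expectZ // orthx mulr0 add0r lerDl.
by apply: expect_ge0 => z; exact: sqr_ge0.
Qed.

End L2Projection.

(** * The estimator: expansion and projection *)

Section Model.
Context {R : realType} {dO} {Om : measurableType dO} (P : probability Om R)
  {dZ} {T : measurableType dZ} (Q : probability T R)
  (Z : nat -> Om -> T) (r : nat) (psi : T -> 'cV[R]_r)
  (m : nat -> nat) (u v : nat -> T -> R)
  (uhat : forall n : nat, Om -> T -> 'cV[R]_(m n)).
Hypotheses (iid : iid_seq P Z Q)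
  (mpsi : forall k : 'I_r, measurable_fun setT (fun z => psi z k 0))
  (psi2 : (\int[Q]_z (vnorm (psi z) ^+ 2)%:E < +oo)%E)
  (m_infty : forall N : nat, \forall n \near \oo, (N <= m n)%N)
  (W_unit : forall n, gram Q u (m n) \in unitmx)
  (W_regular : regular_seq (fun n => gram Q u (m n)))
  (muhat : forall n (j : nat) (i : 'I_(m n)),
     measurable_fun setT (fun w => uhat n w (Z j w) i 0))
  (max_rate : op_rate P (fun n w => \big[Num.max/0]_(j < n) vnorm (uhat n w (Z j w)))
    (fun n => Num.sqrt n%:R / ((m n)%:R * Num.sqrt (m n)%:R)))
  (What_rate : op_rate P (fun n w => opnorm ((n%:R)^-1 *:
                 \sum_(j < n) (uhat n w (Z j w) *m (uhat n w (Z j w))^T)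
               - gram Q u (m n)))
    (fun n => ((m n)%:R)^-1))
  (cross_rate : op_rate P (fun n w => frob ((n%:R)^-1 *: \sum_(j < n)
                 (psi (Z j w) *m (uhat n w (Z j w))^T
                  - Emx P (fun w' => psi (Z j w') *m (uhat n w' (Z j w'))^T))))
    (fun n => (Num.sqrt (m n)%:R)^-1))
  (mv : forall i, measurable_fun setT (v i))
  (v2 : forall n, (\int[Q]_z (vnorm (colfun v (m n) z) ^+ 2)%:E < +oo)%E)
  (v0 : forall n (i : 'I_(m n)), (\int[Q]_z (v i z)%:E = 0)%E)
  (uhat_close : forall eps : R, 0 < eps -> \forall n \near \oo,
     ((m n)%:R%:E * ((n%:R)^-1%:E * \sum_(j < n)
        \int[P]_w (vnorm (uhat n w (Z j w) - colfun v (m n) (Z j w)) ^+ 2)%:E)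
      <= eps%:E)%E)
  (mean_rate : op_rate P (fun n w => vnorm ((n%:R)^-1 *: \sum_(j < n) uhat n w (Z j w)
                               - smean Z (colfun v (m n)) n w))
    (fun n => (Num.sqrt (m n)%:R * Num.sqrt n%:R)^-1)).

Let coord_sqint (f : nat -> T -> R) i : (forall i, measurable_fun setT (f i)) ->
  (forall n, (\int[Q]_z (vnorm (colfun f (m n) z) ^+ 2)%:E < +oo)%E) -> sqint Q (f i).
Proof.
(* The hypotheses concern the first [m n] functions; since m_n tends to infinity, each index is
   below some [m n]. *)
move=> mf f2; have [n _ /(_ n (leqnn n)) hn] := m_infty i.+1.
have := sqint_coord _ _ _ Q _ (colfun f (m n)) _ (f2 n) (Ordinal hn).
have e j : (fun z => colfun f (m n) z j 0) = f j by apply/funext => z; rewrite mxE.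
by rewrite e; apply => j; rewrite e.
Qed.

Lemma sqint_v i : sqint Q (v i). Proof. exact: coord_sqint. Qed.

Lemma mean_v i : \int[Q]_z v i z = 0.
Proof.
have [n _ /(_ n (leqnn n)) hn] := m_infty i.+1.
by rewrite /Rintegral (v0 n (Ordinal hn)).
Qed.

Definition err n (j : nat) (w : Om) : 'cV[R]_(m n) :=
  uhat n w (Z j w) - colfun v (m n) (Z j w).

(** Condition (iv) is an inequality between extended reals. A finite sum of nonnegative integrals
    has finite terms, which gives square integrability of each error and then the real form of the
    bound. *)
Lemma err_small eps : 0 < eps -> \forall n \near \oo,
  [/\ (0 < n)%N, (0 < m n)%N, forall (j : 'I_n) i, sqint P (fun w => err n j w i 0) &
   avg (fun j : 'I_n => \int[P]_w (vnorm (err n j w) ^+ 2)) <= eps / (m n)%:R].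
Proof.
move=> e0; near=> n.
have n0 : (0 < n)%N by near: n; exact: nbhs_infty_gt.
have m0 : (0 < m n)%N by near: n; exact: m_infty.
have np : (0 : R) < n%:R by rewrite ltr0n.
have mp : (0 : R) < (m n)%:R by rewrite ltr0n.
have H : ((m n)%:R%:E * ((n%:R)^-1%:E * \sum_(j < n)
        \int[P]_w (vnorm (err n j w) ^+ 2)%:E) <= eps%:E)%E.
  by near: n; exact: uhat_close.
have H2 : (\sum_(j < n) \int[P]_w (vnorm (err n j w) ^+ 2)%:E <= (n%:R * (eps / (m n)%:R))%:E)%E.
  have r0 : 0 < (m n)%:R * n%:R^-1 :> R by rewrite divr_gt0.
  move: H; rewrite muleA -EFinM -lee_pdivlMl // -EFinM => H.
  by apply: le_trans H _; rewrite lee_fin invf_div mulrAC mulrA.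
have I0 (j : 'I_n) : (0 <= \int[P]_w (vnorm (err n j w) ^+ 2)%:E)%E.
  by apply: integral_ge0 => w _; rewrite lee_fin sqr_ge0.
have merr (j : nat) i : measurable_fun setT (fun w => err n j w i 0).
  have -> : (fun w => err n j w i 0) = (fun w => uhat n w (Z j w) i 0 - v i (Z j w)).
    by apply/funext => w; rewrite !mxE.
  apply: measurable_funB; first exact: muhat.
  by apply: measurableT_comp => //; exact: (iid_measurable P Q Z iid).
have sq (j : 'I_n) i : sqint P (fun w => err n j w i 0).
  apply: sqint_coord => //; apply: le_lt_trans (ltry (n%:R * (eps / (m n)%:R))).
  apply: le_trans H2; rewrite (bigD1 j) //= leeDl // sume_ge0 //.
split => //.
rewrite /avg ler_pdivrMl // -lee_fin -sumEFin; apply: le_trans H2.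
by apply: lee_sum => j _; rewrite EFin_expect //; have [] := sqint_vnorm _ _ P _ _ (sq j).
Unshelve. all: by end_near. Qed.

Lemma uhat_sqint n (j : nat) i : sqint P (fun w => err n j w i 0) ->
  sqint P (fun w => uhat n w (Z j w) i 0).
Proof.
move=> h; apply: eq_sqint (sqintD P _ _ h (sqint_iid P Q Z iid j _ (sqint_v i))) => w.
by rewrite !mxE subrK.
Qed.

(* The law of large numbers and (iv) identify the limit of an entry of [hat W_n]
   with that of [E (v_n v_n^T)], while (ii) identifies it with that of [W_n]. As
   neither limit depends on [n], the two Gram matrices are equal. *)
Lemma gram_entry_eq i l : \int[Q]_z (u i z * u l z) = \int[Q]_z (v i z * v l z).
Proof.
apply/eqP; rewrite -subr_eq0 -normr_eq0; apply/eqP/le_anti; rewrite normr_ge0 andbT.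
apply/ler_addgt0Pr => e e0; rewrite add0r.
have e3 : 0 < e / 3 by rewrite divr_gt0.
have q4 : 0 < 1 / 4 :> R by rewrite divr_gt0.
pose B := \int[Q]_z (v i z ^+ 2) + \int[Q]_z (v l z ^+ 2).
have B0 : 0 <= B by rewrite addr_ge0 // expect_ge0 // => z; exact: sqr_ge0.
(* Write each entry of hat u_n as [v] plus an error. With weight [t], the mixed terms satisfy
   [|a q| <= (a^2 / t + t q^2) / 2]; this [t] makes the part with [v] at most [e / 24], and (iv) at
   level [e / 24 / (1 + 1 / t)] does the same for the errors. *)
pose t := e / (12 * (B + 1)).
have t0 : 0 < t by rewrite divr_gt0 // mulr_gt0 // ltr_wpDl.
have tB : t / 2 * B <= e / 24.
  have -> : t / 2 * B = e / 24 * (B / (B + 1)) by rewrite /t; field; rewrite gt_eqF // ltr_wpDl.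
  by rewrite ler_piMr ?divr_ge0 ?(ltW e0) // ler_pdivrMr ?mul1r ?lerDl // ltr_wpDl.
have c0 : 0 < 1 + t^-1 by rewrite addr_gt0 // invr_gt0.
have eps0 : 0 < e / 24 / (1 + t^-1) by rewrite !divr_gt0.
have W1 := weak_lln P Q Z iid (fun z => v i z * v l z) (e / 3)
  (sqint_mul Q _ _ (sqint_v i) (sqint_v l)) e3.
have W2 := proj1 (op_rate_prob P _ _) What_rate _ e3.
suff : \forall n \near \oo, `|\int[Q]_z (u i z * u l z) - \int[Q]_z (v i z * v l z)| <= e.
  by case=> N _ /(_ N (leqnn N)).
near=> n.
have [n0 m0 sqe De] : [/\ (0 < n)%N, (0 < m n)%N, forall (j : 'I_n) i, sqint P (fun w => err n j w i 0) &
   avg (fun j : 'I_n => \int[P]_w (vnorm (err n j w) ^+ 2)) <= (e / 24 / (1 + t^-1)) / (m n)%:R].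
  by near: n; exact: err_small.
have np : (0 : R) < n%:R by rewrite ltr0n.
have im : (i < m n)%N by near: n; exact: m_infty.
have lm : (l < m n)%N by near: n; exact: m_infty.
pose i' := Ordinal im; pose l' := Ordinal lm.
have [B1 [mB1 sB1 PB1]] : exists A, [/\ measurable A,
    A `<=` [set w | `|avg (fun j : 'I_n => v i (Z j w) * v l (Z j w)) - \int[Q]_z (v i z * v l z)| <= e / 3]
    & ((1 - 1 / 4)%:E <= P A)%E].
  by near: n; exact: W1.
have [B2 [mB2 sB2 PB2]] : exists A, [/\ measurable A,
    A `<=` [set w | `|opnorm ((n%:R)^-1 *:
      \sum_(j < n) (uhat n w (Z j w) *m (uhat n w (Z j w))^T) - gram Q u (m n))|
      <= e / 3 / (m n)%:R] & ((1 - 1 / 4)%:E <= P A)%E].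
  by near: n; exact: W2.
pose X w := avg (fun j : 'I_n => `|uhat n w (Z j w) i' 0 * uhat n w (Z j w) l' 0 -
  v i (Z j w) * v l (Z j w)|).
have svZ k (j : 'I_n) := sqint_iid P Q Z iid j _ (sqint_v k).
have iterm (j : 'I_n) : integ P (fun w => `|uhat n w (Z j w) i' 0 * uhat n w (Z j w) l' 0 -
  v i (Z j w) * v l (Z j w)|).
  apply: integrable_norm; apply: integB; apply: sqint_mul => //; exact: uhat_sqint.
have iX : integ P X by apply: integZ; apply: integ_sum => j; exact: iterm.
have EX : \int[P]_w X w <= e / 12.
  rewrite expectZ ?expect_sum //; last by apply: integ_sum => j; exact: iterm.
  apply: le_trans (_ : avg (fun j : 'I_n => (1 + t^-1) * \int[P]_w (vnorm (err n j w) ^+ 2) + t / 2 * B) <= _).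
    apply: ler_avg => j.
    have ie : integ P (fun w => vnorm (err n j w) ^+ 2) by have [] := sqint_vnorm _ _ P _ _ (sqe j).
    have i1 : integ P (fun w => v i (Z j w) ^+ 2) by have [] := svZ i j.
    have i2 : integ P (fun w => v l (Z j w) ^+ 2) by have [] := svZ l j.
    have i3 := integD P _ _ i1 i2.
    have [_ vi2] := sqint_v i; have [_ vl2] := sqint_v l.
    rewrite /B -(expect_iid P Q Z iid j _ vi2) -(expect_iid P Q Z iid j _ vl2).
    rewrite -expectD // -!expectZ // -expectD; [|exact: integZ..].
    apply: expect_le => [||w]; [exact: iterm|by apply: integD; exact: integZ|].
    have hx k : uhat n w (Z j w) k 0 = err n j w k 0 + v k (Z j w) by rewrite !mxE subrK.
    rewrite !hx /=.
    have ce k : `|err n j w k 0| <= vnorm (err n j w) := coord_le_vnorm _ _.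
    set a := err n j w i' 0; set b := err n j w l' 0; set p := v i _; set q := v l _.
    have ha : a ^+ 2 <= vnorm (err n j w) ^+ 2.
      by rewrite -(real_normK (num_real a)) lerXn2r ?nnegrE ?vnorm_ge0 // ce.
    have hb : b ^+ 2 <= vnorm (err n j w) ^+ 2.
      by rewrite -(real_normK (num_real b)) lerXn2r ?nnegrE ?vnorm_ge0 // ce.
    move: ha hb; set N2 := vnorm _ ^+ 2 => ha hb.
    have amgm (c c' : R) : `|c * c'| <= (t^-1 * c ^+ 2 + t * c' ^+ 2) / 2.
      have k1 : 0 <= t^-1 * (`|c| - t * `|c'|) ^+ 2 by rewrite mulr_ge0 ?sqr_ge0 // invr_ge0 ltW.
      have k2 : t^-1 * (`|c| - t * `|c'|) ^+ 2 = t^-1 * c ^+ 2 + t * c' ^+ 2 - 2 * (`|c| * `|c'|).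
        by rewrite -(real_normK (num_real c)) -(real_normK (num_real c')); field; rewrite gt_eqF.
      by rewrite normrM; lra.
    have h1 : `|a * b| <= N2.
      rewrite normrM; have := sqr_ge0 (`|a| - `|b|).
      rewrite -(real_normK (num_real a)) in ha; rewrite -(real_normK (num_real b)) in hb.
      by rewrite sqrrB; lra.
    have h2 := amgm a q; have h3 := amgm b p.
    have -> : (a + p) * (b + q) - p * q = a * b + a * q + b * p by ring.
    apply: le_trans (ler_normD _ _) _; apply: le_trans (lerD (ler_normD _ _) (lexx _)) _.
    have ti : 0 <= t^-1 by rewrite invr_ge0 ltW.
    have h4 := ler_wpM2l ti ha; have h5 := ler_wpM2l ti hb.
    by rewrite mulrDl mul1r; lra.
  rewrite avgD avgZ avg_cst //.
  have : (1 + t^-1) * avg (fun j : 'I_n => \int[P]_w (vnorm (err n j w) ^+ 2)) <= e / 24.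
    rewrite mulrC -ler_pdivlMr //; apply: le_trans De _.
    by rewrite ler_piMr ?(ltW eps0) // invf_le1 ?ler1n // ltr0n.
  by lra.
have X0 w : 0 <= X w by rewrite mulr_ge0 ?invr_ge0 ?ler0n // sumr_ge0.
have [B3 [mB3 sB3 PB3]] := markov_event P X (e / 12) (e / 3) iX X0 EX e3.
have {}PB3 : ((1 - 1 / 4)%:E <= P B3)%E.
  apply: le_trans PB3; rewrite lee_fin lerD2l lerN2 ler_pdivrMr //; lra.
have P12 := probability_setI_ge P _ _ _ _ mB1 mB2 PB1 PB2.
have P123 := probability_setI_ge P _ _ _ _ (measurableI _ _ mB1 mB2) mB3 P12 PB3.
(* Three events of probability at least 3/4 meet. The claim is not random, so a single sample point
   where all three approximations are within [e / 3] suffices. *)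
have [w [[/sB1 /= k1 /sB2 /= k2] /sB3 /= k3]] : B1 `&` B2 `&` B3 !=set0.
  apply/set0P/eqP => B00; move: P123; rewrite B00 measure0 lee_fin; lra.
have k2' : `|avg (fun j : 'I_n => uhat n w (Z j w) i' 0 * uhat n w (Z j w) l' 0) -
    \int[Q]_z (u i z * u l z)| <= e / 3.
  apply: le_trans (_ : e / 3 / (m n)%:R <= _); last first.
    by rewrite ler_piMr ?(ltW e3) // invf_le1 ?ler1n // ltr0n.
  apply: le_trans k2; apply: le_trans (ler_norm _).
  have := norm_entry_le_opnorm _ _ _ ((n%:R)^-1 *:
      \sum_(j < n) (uhat n w (Z j w) *m (uhat n w (Z j w))^T) - gram Q u (m n)) i' l'.
  rewrite !mxE summxE; congr (`|_ * _ - _| <= _).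
  by apply: eq_bigr => j _; rewrite mxE big_ord1 !mxE.
have k3' : `|avg (fun j : 'I_n => uhat n w (Z j w) i' 0 * uhat n w (Z j w) l' 0) -
    avg (fun j : 'I_n => v i (Z j w) * v l (Z j w))| <= e / 3.
  apply: le_trans k3; rewrite /avg -mulrBr -sumrB normrM ger0_norm ?invr_ge0 ?ler0n //.
  by rewrite ler_wpM2l ?invr_ge0 ?ler0n // ler_norm_sum.
move: k1 k2' k3'; rewrite !ler_norml => /andP[? ?] /andP[? ?] /andP[? ?].
by apply/andP; split; lra.
Unshelve. all: by end_near. Qed.

Lemma gram_eq n : gram Q u (m n) = gram Q v (m n).
Proof. by apply/matrixP => i l; rewrite !mxE; exact: gram_entry_eq. Qed.

Let sv i : sqint Q (v i) := sqint_v i.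
Let mean0 i : \int[Q]_z v i z = 0 := mean_v i.

Let spsi q : sqint Q (fun z => psi z q 0).
Proof. exact: sqint_coord. Qed.

Let psi_sqr := \int[Q]_z (vnorm (psi z) ^+ 2).

Let psi_sqrE : psi_sqr = \sum_q \int[Q]_z (psi z q 0 ^+ 2).
Proof. by have [] := sqint_vnorm _ _ Q _ _ spsi. Qed.

Let psi_sqr_ge0 : 0 <= psi_sqr. Proof. by apply: expect_ge0 => z; exact: sqr_ge0. Qed.

Let vdot n (a : 'cV[R]_(m n)) : sqint Q (fun z => dot (colfun v (m n) z) a).
Proof.
apply: eq_sqint (sqint_sum Q _ (index_enum 'I_(m n)) (fun i z => a i 0 * v i z) _) => [z|i].
  by apply: eq_bigr => i _; rewrite mxE mulrC.
exact: sqintZ.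
Qed.

Lemma psi_Op : Op P (fun n w => avg (fun j : 'I_n => vnorm (psi (Z j w)) ^+ 2)) (fun=> 1).
Proof.
apply: (Op_markov P _ _ psi_sqr); near=> n.
have n0 : (0 < n)%N by near: n; exact: nbhs_infty_gt.
have [ip _] := sqint_vnorm _ _ Q _ _ spsi.
have ij (j : 'I_n) : integ P (fun w => vnorm (psi (Z j w)) ^+ 2).
  exact: (integ_iid P Q Z iid j (fun z => vnorm (psi z) ^+ 2)).
split => //; [|by move=> w; rewrite mulr_ge0 ?invr_ge0 ?ler0n // sumr_ge0 // => j _; exact: sqr_ge0|].
  by apply: integZ; exact: integ_sum.
rewrite mulr1 expectZ ?expect_sum //; last exact: integ_sum.
rewrite (eq_bigr (fun=> psi_sqr)) => [|j _]; last exact: (expect_iid P Q Z iid j (fun z => vnorm (psi z) ^+ 2)).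
by have := @avg_cst R n psi_sqr n0; rewrite /avg => ->.
Unshelve. all: by end_near. Qed.

Definition crossmx n : 'M[R]_(r, m n) := \matrix_(q, i) \int[Q]_z (psi z q 0 * v i z).

Lemma crossmx_mul n (a : 'cV[R]_(m n)) q :
  (crossmx n *m a) q 0 = \int[Q]_z (psi z q 0 * dot (colfun v (m n) z) a).
Proof.
rewrite (eq_expect Q (fun z => \sum_i a i 0 * (psi z q 0 * v i z))); last first.
  by move=> z; rewrite mulr_sumr; apply: eq_bigr => i _; rewrite mxE; ring.
rewrite expect_sum => [|i]; last by apply: integZ; apply: sqint_mul.
by rewrite mxE; apply: eq_bigr => i _; rewrite expectZ ?mxE 1?mulrC //; apply: sqint_mul.
Qed.

Section QuadraticBounds.
Variables (c C : R).
Hypotheses (C0 : 0 < C) (W_quad : forall n (a : 'cV[R]_(m n)),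
  c * dot a a <= dot a (gram Q u (m n) *m a) <= C * dot a a).

Lemma V_quad n (a : 'cV[R]_(m n)) : \int[Q]_z (dot (colfun v (m n) z) a ^+ 2) <= C * dot a a.
Proof. by rewrite -gram_quad // -gram_eq; have /andP[] := W_quad n a. Qed.

(** The expected square is the trace of the Gram matrix divided by [n], and each of its [m n]
    diagonal entries is at most [C]. *)
Lemma vbar_Op : Op P (fun n w => vnorm (smean Z (colfun v (m n)) n w) ^+ 2)
  (fun n => (m n)%:R / n%:R).
Proof.
apply: (Op_markov P _ _ C); near=> n.
have n0 : (0 < n)%N by near: n; exact: nbhs_infty_gt.
have m0 : (0 < m n)%N by near: n; exact: m_infty.
have sc i : sqint Q (fun z => colfun v (m n) z i 0).
  by apply: eq_sqint (sv i) => z; rewrite mxE.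
have [|i1 e1] := expect_smean_sqr P Q Z iid n _ (colfun v (m n)) n0 sc.
  by move=> i; rewrite -[RHS](mean0 i); apply: eq_expect => z; rewrite mxE.
split; [by rewrite divr_gt0 ?ltr0n|exact: i1|by move=> w; exact: sqr_ge0|].
rewrite e1 mulrA mulrC ler_pM2r ?invr_gt0 ?ltr0n //.
have [_ ->] := sqint_vnorm _ _ Q _ _ sc.
apply: le_trans (_ : \sum_(i < m n) C <= _); last by rewrite sumr_const card_ord mulr_natr.
apply: ler_sum => i _; have := V_quad n (delta_mx i 0).
rewrite dot_delta mxE !eqxx mulr1; apply: le_trans; rewrite le_eqVlt; apply/orP; left; apply/eqP.
by apply: eq_expect => z; rewrite dotC dot_delta.
Unshelve. all: by end_near. Qed.

(** Cauchy-Schwarz in L_2(Q) for each coordinate of [psi], with the variance of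
    [dot (colfun v (m n)) a] bounded by [C |a|^2]: the constant is free of the dimension. *)
Lemma crossmx_le : exists2 Ca, 0 < Ca &
  forall n (a : 'cV[R]_(m n)), vnorm (crossmx n *m a) <= Ca * vnorm a.
Proof.
exists (Num.sqrt (psi_sqr * C) + 1) => [|n a]; first by rewrite ltr_wpDl ?sqrtr_ge0.
apply: le_trans (_ : Num.sqrt (psi_sqr * C) * vnorm a <= _); last first.
  by rewrite ler_wpM2r ?vnorm_ge0 // lerDl.
rewrite -(ler_pXn2r (ltn0Sn 1)) ?nnegrE ?mulr_ge0 ?vnorm_ge0 ?sqrtr_ge0 //.
rewrite [leRHS]exprMn [X in _ <= X * _]sqr_sqrtr ?mulr_ge0 ?psi_sqr_ge0 ?(ltW C0) // -[leRHS]mulrA vnorm_sqr vnorm_sqr_sum psi_sqrE mulr_suml.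
apply: ler_sum => q _; rewrite crossmx_mul.
apply: le_trans (cauchy_schwarz_expect Q _ _ (spsi q) (vdot n a)) _.
by rewrite ler_wpM2l ?V_quad // expect_ge0 // => z; exact: sqr_ge0.
Qed.

End QuadraticBounds.

(** Condition (iii) centres at the mean of psi hat u_n^T, while the expansion needs the mean of psi
    v_n^T. The difference [F j] is the mean of psi times the estimation error, of squared Frobenius
    norm at most [psi_sqr] times the mean squared error, so (iv) makes its average o(m_n^(-1/2)). *)
Lemma cross_small eta : 0 < eta -> prob_to_one P (fun n => [set w |
  forall a, vnorm (avgv (fun j : 'I_n => dot (uhat n w (Z j w)) a *: psi (Z j w)) - crossmx n *m a)
    <= eta / Num.sqrt (m n)%:R * vnorm a]).
Proof.
move=> eta0; have e2 : 0 < eta / 2 by rewrite divr_gt0.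
apply: prob_to_oneS (proj1 (op_rate_prob P _ _) cross_rate _ e2).
have K1 : 0 < psi_sqr + 1 by rewrite ltr_wpDl.
(* With [t = eta / 2 / sqrt m_n], [|F j|] is at most half of [t] plus half of [(psi_sqr + 1) D / t],
   where [D] is the mean squared error; this [eps] makes the average of the second quantity at most
   [t]. *)
pose eps := (eta / 2) ^+ 2 / (psi_sqr + 1).
have eps0 : 0 < eps by rewrite divr_gt0 // exprn_gt0.
near=> n => w /= hw a.
have [n0 m0 sqe De] : [/\ (0 < n)%N, (0 < m n)%N,
   forall (j : 'I_n) i, sqint P (fun w => err n j w i 0) &
   avg (fun j : 'I_n => \int[P]_w (vnorm (err n j w) ^+ 2)) <= eps / (m n)%:R].
  by near: n; exact: err_small.
have mp : (0 : R) < (m n)%:R by rewrite ltr0n.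
have sp : 0 < Num.sqrt (m n)%:R :> R by rewrite sqrtr_gt0.
pose E j := Emx P (fun w' => psi (Z j w') *m (uhat n w' (Z j w'))^T).
pose F (j : 'I_n) : 'M[R]_(r, m n) :=
  \matrix_(q, i) \int[P]_w (psi (Z j w) q 0 * err n j w i 0).
have sZ (j : nat) q := sqint_iid P Q Z iid j _ (spsi q).
have EF (j : 'I_n) : E j = crossmx n + F j.
  apply/matrixP => q i; rewrite !mxE.
  have iv1 := sqint_mul Q _ _ (spsi q) (sv i).
  rewrite -(expect_iid P Q Z iid j _ iv1) -expectD; first last.
  - exact: sqint_mul.
  - exact: (integ_iid P Q Z iid j _ iv1).
  by apply: eq_expect => w'; rewrite !mxE big_ord1 !mxE; ring.
have Fle (j : 'I_n) : vnorm (F j *m a) <=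
    (eta / 2 / Num.sqrt (m n)%:R + (Num.sqrt (m n)%:R * (psi_sqr + 1) / (eta / 2)) *
      \int[P]_w (vnorm (err n j w) ^+ 2)) / 2 * vnorm a.
  apply: le_trans (vnorm_mul_frob _ _) _; rewrite ler_wpM2r ?vnorm_ge0 //.
  set D := \int[P]_w _.
  have D0 : 0 <= D by rewrite /D; apply: expect_ge0 => w'; exact: sqr_ge0.
  have FD : frob (F j) ^+ 2 <= psi_sqr * D.
    rewrite frob_sqr psi_sqrE mulr_suml; apply: ler_sum => q _.
    have [_ DE] := sqint_vnorm _ _ P _ _ (sqe j); rewrite /D DE mulr_sumr; apply: ler_sum => i _.
    rewrite mxE; apply: le_trans (cauchy_schwarz_expect P _ _ (sZ j q) (sqe j i)) _.
    by have [_ p2] := spsi q; rewrite (expect_iid P Q Z iid j _ p2).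
  pose t := eta / 2 / Num.sqrt (m n)%:R.
  have t0 : 0 < t by rewrite divr_gt0.
  have -> : Num.sqrt (m n)%:R * (psi_sqr + 1) / (eta / 2) * D = (psi_sqr + 1) * D / t.
    by rewrite /t; field; rewrite !gt_eqF.
  have f0 := frob_ge0 (F j).
  have h : 0 <= t^-1 * (frob (F j) - t) ^+ 2 by rewrite mulr_ge0 ?sqr_ge0 // invr_ge0 ltW.
  have h2 : t^-1 * (frob (F j) - t) ^+ 2 = frob (F j) ^+ 2 / t + t - 2 * frob (F j).
    by field; rewrite gt_eqF.
  have h3 : frob (F j) ^+ 2 / t <= (psi_sqr + 1) * D / t.
    by rewrite ler_pM2r ?invr_gt0 // (le_trans FD) // ler_wpM2r // lerDl.
  by rewrite -/t; lra.
have key : vnorm (avgv (fun j => F j *m a)) <= eta / 2 / Num.sqrt (m n)%:R * vnorm a.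
  apply: le_trans (vnorm_avgv _ _) _; apply: le_trans (ler_avg _ _ Fle) _.
  set G := fun j : 'I_n => \int[P]_w (vnorm (err n j w) ^+ 2).
  set t := eta / 2 / _; set s := _ * (psi_sqr + 1) / _.
  have -> : avg (fun j => (t + s * G j) / 2 * vnorm a) = (t + s * avg G) / 2 * vnorm a.
    rewrite -avgZ -{2}(avg_cst t n0) -avgD [_ / 2 * _](_ : _ = vnorm a / 2 * avg (fun j => t + s * G j)).
      by rewrite -avgZ; congr (_ * _); apply: eq_bigr => j _; ring.
    by ring.
  rewrite ler_wpM2r ?vnorm_ge0 //.
  have s0 : 0 < s by rewrite /s divr_gt0 // mulr_gt0.
  have : s * avg G <= s * (eps / (m n)%:R) by rewrite ler_pM2l.
  have -> : s * (eps / (m n)%:R) = t.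
    have ms : (m n)%:R = Num.sqrt (m n)%:R ^+ 2 :> R by rewrite sqr_sqrtr ?ler0n.
    rewrite /s /eps /t; move: ms sp; set sq := Num.sqrt _ => ms sp; rewrite ms.
    by field; rewrite !gt_eqF.
  by lra.
have -> : avgv (fun j : 'I_n => dot (uhat n w (Z j w)) a *: psi (Z j w)) - crossmx n *m a =
   (n%:R^-1 *: \sum_(j < n) (psi (Z j w) *m (uhat n w (Z j w))^T - E j)) *m a + avgv (fun j => F j *m a).
  have -> : avgv (fun j => F j *m a) = avgv (fun j : 'I_n => E j *m a) - crossmx n *m a.
    have -> : crossmx n *m a = avgv (fun _ : 'I_n => crossmx n *m a) by rewrite avgv_cst.
    by rewrite -avgvB; congr (_ *: _); apply: eq_bigr => j _; rewrite EF mulmxDl addrAC subrr add0r.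
  rewrite -scalemxAl mulmx_suml addrA; congr (_ - _).
  rewrite -avgvD; congr (_ *: _); apply: eq_bigr => j _.
  by rewrite mulmxBl outer_mulmx subrK.
apply: le_trans (vnormD _ _) _; rewrite [eta]splitr !mulrDl lerD //.
apply: le_trans (vnorm_mul_frob _ _) _; rewrite ler_wpM2r ?vnorm_ge0 //.
by apply: le_trans hw; exact: ler_norm.
Unshelve. all: by end_near. Qed.

Lemma el_solutionP n w (zeta : 'cV[R]_(m n)) : (0 < n)%N ->
  el_solution Z (uhat n) n w zeta <->
  (forall j : 'I_n, 0 < 1 + dot (uhat n w (Z j w)) zeta) /\
  \sum_(j < n) (1 + dot (uhat n w (Z j w)) zeta)^-1 *: uhat n w (Z j w) = 0.
Proof.
move=> n0; have ni : n%:R^-1 != 0 :> R by rewrite invr_eq0 pnatr_eq0 -lt0n.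
have e1 : \sum_(j < n) (1 + ((uhat n w (Z j w))^T *m zeta) 0 0)^-1 *: uhat n w (Z j w) =
    \sum_(j < n) (1 + dot (uhat n w (Z j w)) zeta)^-1 *: uhat n w (Z j w).
  by apply: eq_bigr => j _; rewrite mxdotE.
split=> -[h1 h2]; split=> [j|].
- by rewrite -mxdotE.
- by apply/eqP; rewrite -e1; move/eqP: h2; rewrite scaler_eq0 (negbTE ni).
- by rewrite mxdotE.
- by rewrite e1 h2 scaler0.
Qed.

(** The order of choices matters: the two O_p bounds fix [M], then [el_expansion] yields [K] and
    [eta0], and only then is [eta <= eps / K] chosen and inserted in the rates (i), (ii), (v) and in
    [cross_small]. *)
Lemma el_expansion_prob eps : 0 < eps -> prob_to_one P (fun n => [set w |
  exists zeta, [/\ el_solution Z (uhat n) n w zeta,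
    forall zeta', el_solution Z (uhat n) n w zeta' -> zeta' = zeta &
    vnorm (el_estimate Z psi (uhat n) n w zeta - (smean Z psi n w -
      crossmx n *m (invmx (gram Q v (m n)) *m smean Z (colfun v (m n)) n w)))
    <= eps / Num.sqrt n%:R]]).
Proof.
move=> eps0; have [c [C [c0 C0 hq]]] := regular_quad _ _ _ W_regular.
have [Ca Ca0 hCa] : exists2 Ca, 0 < Ca &
    forall n (a : 'cV[R]_(m n)), vnorm (crossmx n *m a) <= Ca * vnorm a.
  exact: (crossmx_le c C C0 hq).
apply: (prob_to_one_Op P _ _ _ (vbar_Op c C hq)) => // M1 M10.
apply: (prob_to_one_Op P _ _ _ psi_Op) => M2 M20.
(* The O_p bounds are on squares, and [M >= 1] gives [M1 <= M^2] and [M2 <= M^2]. *)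
pose M := 1 + M1 + M2.
have M0 : 0 < M by rewrite /M; lra.
have [K [eta0 [K0 e0 main]]] := el_expansion c C Ca M c0 C0 Ca0 M0.
pose eta := Num.min eta0 (eps / K).
have eta_gt0 : 0 < eta by rewrite lt_min e0 divr_gt0.
have h1 := proj1 (op_rate_prob P _ _) max_rate _ eta_gt0.
have h2 := proj1 (op_rate_prob P _ _) What_rate _ eta_gt0.
have h3 : prob_to_one P (fun n => [set w | forall a,
    vnorm (avgv (fun j : 'I_n => dot (uhat n w (Z j w)) a *: psi (Z j w)) -
      crossmx n *m a) <= eta / Num.sqrt (m n)%:R * vnorm a]).
  exact: cross_small.
have h4 := proj1 (op_rate_prob P _ _) mean_rate _ eta_gt0.
apply: prob_to_oneS (prob_to_oneI P _ _ (prob_to_oneI P _ _ h1 h2) (prob_to_oneI P _ _ h3 h4)).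
near=> n => w /= [[g1 g2] [g3 g4]] hpsi hv.
have n0 : (0 < n)%N by near: n; exact: nbhs_infty_gt.
have m0 : (0 < m n)%N by near: n; exact: m_infty.
have np : (0 : R) < n%:R by rewrite ltr0n.
have mp : (0 : R) < (m n)%:R by rewrite ltr0n.
pose a : R := Num.sqrt (m n)%:R; pose b : R := Num.sqrt n%:R.
have a0 : 0 < a by rewrite sqrtr_gt0.
have b0 : 0 < b by rewrite sqrtr_gt0.
have a2 : a ^+ 2 = (m n)%:R by rewrite sqr_sqrtr // ltW.
have b2 : b ^+ 2 = n%:R by rewrite sqr_sqrtr // ltW.
have a1 : 1 <= a by rewrite -(sqrtr1 R) ler_sqrt // ler1n.
have [||||||||z [z1 z2 z3 z4]] := main n (m n) r (fun j => uhat n w (Z j w)) (fun j => psi (Z j w))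
  (gram Q u (m n)) (crossmx n) (smean Z (colfun v (m n)) n w)
  (invmx (gram Q u (m n)) *m smean Z (colfun v (m n)) n w) a b eta n0 a1 b0 _ (hq n) (hCa n).
- by rewrite eta_gt0 ge_min lexx.
- by rewrite mulmxA mulmxV // mul1mx.
- move=> j; rewrite exprS a2 [a * _]mulrC.
  apply: le_trans (le_trans (ler_norm _) g1).
  exact: (le_bigmax_cond _ (fun j : 'I_n => vnorm (uhat n w (Z j w)))).
- move=> x; rewrite -(avgv_outer _ _ _ _ (fun j : 'I_n => uhat n w (Z j w))) -mulmxBl.
  apply: le_trans (vnorm_mul_opnorm _ _) _; rewrite ler_wpM2r ?vnorm_ge0 //.
  by apply: le_trans (ler_norm _) _; rewrite a2.
- by move=> x; exact: g3.
- by apply: le_trans (ler_norm _) g4.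
- rewrite -(ler_pXn2r (ltn0Sn 1)) ?nnegrE ?vnorm_ge0 ?mulr_ge0 ?invr_ge0 ?(ltW a0) ?(ltW b0) ?(ltW M0) //.
  apply: le_trans hv _; rewrite exprMn expr_div_n a2 b2 ler_wpM2r ?divr_ge0 ?ler0n //.
  by rewrite /M expr2; nra.
- by apply: le_trans hpsi _; rewrite mulr1 /M expr2; nra.
exists z; split.
- by apply/el_solutionP.
- by move=> z' /(el_solutionP _ _ _ n0)[? ?]; exact: z3.
have -> : el_estimate Z psi (uhat n) n w z =
    avgv (fun j : 'I_n => (1 + dot (uhat n w (Z j w)) z)^-1 *: psi (Z j w)).
  by congr (_ *: _); apply: eq_bigr => j _; rewrite mxdotE.
rewrite -gram_eq; apply: le_trans z4 _; rewrite ler_wpM2r ?invr_ge0 ?(ltW b0) //.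
by rewrite mulrC -ler_pdivlMr // ge_min lexx orbT.
Unshelve. all: by end_near. Qed.

Lemma el_exists_unique :
  prob_to_one P (fun n => [set w | exists! zeta, el_solution Z (uhat n) n w zeta]).
Proof.
apply: prob_to_oneS (el_expansion_prob 1 ltr01); near=> n => w /= [z [z1 z2 _]].
by exists z; split=> // z' hz'; rewrite (z2 z').
Unshelve. all: by end_near. Qed.

Context (zh : forall n : nat, Om -> 'cV[R]_(m n)) (phi : T -> 'cV[R]_r).
Hypotheses
  (zh_sol : forall n w, (exists! zeta, el_solution Z (uhat n) n w zeta) ->
                 el_solution Z (uhat n) n w (zh n w))
  (V_unit : forall n, gram Q v (m n) \in unitmx)
  (hphi : forall k : 'I_r, L2proj Q v (fun z => psi z k 0) (fun z => phi z k 0)).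

Let sphi k : sqint Q (fun z => phi z k 0) := L2proj_sqint Q v _ _ (hphi k).

Let pr n : T -> 'cV[R]_r := fun z =>
  crossmx n *m (invmx (gram Q v (m n)) *m colfun v (m n) z).

Let coef n q : 'cV[R]_(m n) := (row q (crossmx n *m invmx (gram Q v (m n))))^T.

Let prE n q z : pr n z q 0 = dot (colfun v (m n) z) (coef n q).
Proof.
by rewrite /pr mulmxA mxE /dot; apply: eq_bigr => i _; rewrite !mxE mulrC.
Qed.

Let spr n q : sqint Q (fun z => pr n z q 0).
Proof.
apply: eq_sqint (span_sqint Q v sv (m n) (fun i => coef n q i 0)) => z.
by rewrite prE /dot; apply: eq_bigr => i _; rewrite [colfun _ _ _ _ _]mxE mulrC.
Qed.

(** The normal equations: the combination with coefficients [coef] has the same inner products with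
    the first [m n] functions as [psi], and [phi] shares these because [psi - phi] is orthogonal to
    every [v i]. *)
Let pr_orth n q (i : 'I_(m n)) :
  \int[Q]_z ((phi z q 0 - dot (colfun v (m n) z) (coef n q)) * v i z) = 0.
Proof.
have e1 : \int[Q]_z (phi z q 0 * v i z) = crossmx n q i.
  rewrite mxE; apply/esym/eqP; rewrite -subr_eq0 -expectB; [|exact: sqint_mul..].
  apply/eqP; rewrite -[RHS](L2proj_orth Q v _ _ (hphi q) i); apply: eq_expect => z.
  by rewrite mulrBl.
have sd : sqint Q (fun z => dot (colfun v (m n) z) (coef n q)).
  by apply: eq_sqint (spr n q) => z; exact: prE.
have e2 : \int[Q]_z (dot (colfun v (m n) z) (coef n q) * v i z) = crossmx n q i.
  rewrite (eq_expect Q (fun z => \sum_l coef n q l 0 * (v l z * v i z))); last first.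
    by move=> z; rewrite /dot mulr_suml; apply: eq_bigr => l _; rewrite [colfun _ _ _ _ _]mxE; ring.
  rewrite expect_sum => [|l]; last by apply: integZ; exact: sqint_mul.
  rewrite -[in RHS](mulmxKV (V_unit n) (crossmx n)) mxE.
  apply: eq_bigr => l _; rewrite expectZ; last exact: sqint_mul.
  by rewrite [in RHS]/gram [X in _ = _ * X]mxE /coef ![(row _ _)^T _ _]mxE [row _ _ _ _]mxE.
rewrite (eq_expect Q (fun z => phi z q 0 * v i z - dot (colfun v (m n) z) (coef n q) * v i z)).
  by rewrite expectB ?e1 ?e2 ?subrr //; exact: sqint_mul.
by move=> z; rewrite mulrBl.
Qed.

(** Some finite combination is within [eps] of [phi]; once [m n] exceeds its length, the finite
    projection is at least as good. *)
Let pr_cvg q eps : 0 < eps -> \forall n \near \oo,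
  \int[Q]_z ((phi z q 0 - pr n z q 0) ^+ 2) <= eps.
Proof.
move=> e0; have [N [c hc]] := L2proj_approx Q v sv _ _ (hphi q) eps e0.
near=> n; under eq_Rintegral do rewrite prE.
apply: le_trans (ltW hc); apply: (L2proj_best Q v sv _ _ (hphi q)).
  by near: n; exact: m_infty.
exact: pr_orth.
Unshelve. all: by end_near. Qed.

Lemma phi_mean0 q : \int[Q]_z phi z q 0 = 0.
Proof. exact: (L2proj_mean0 Q v sv mean0 _ _ (hphi q)). Qed.

(** The difference is the sample mean of the centred function [pr n - phi]. Its expected square is
    that of one summand over [n], and the summand tends to 0 in L_2(Q), so Markov's inequality gives
    o_p(n^(-1/2)). *)
Lemma projection_small eta : 0 < eta -> prob_to_one P (fun n => [set w |
  vnorm (crossmx n *m (invmx (gram Q v (m n)) *m smean Z (colfun v (m n)) n w)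
    - smean Z phi n w) <= eta / Num.sqrt n%:R]).
Proof.
move=> eta0.
pose X n w := vnorm (smean Z (fun z => pr n z - phi z) n w) ^+ 2.
have XE n w : vnorm (crossmx n *m (invmx (gram Q v (m n)) *m smean Z (colfun v (m n)) n w)
    - smean Z phi n w) ^+ 2 = X n w.
  congr (vnorm _ ^+ 2); rewrite /smean -!scalemxAr -scalerBr; congr (_ *: _).
  by rewrite !mulmx_sumr -sumrB.
have ee : 0 < eta ^+ 2 by rewrite exprn_gt0.
have main : forall e, 0 < e -> \forall n \near \oo, [/\ 0 < n%:R^-1 :> R, integ P (X n),
    (forall w, 0 <= X n w) & \int[P]_w X n w <= e * n%:R^-1].
  move=> e e0; have er : 0 < e / (r%:R + 1) by rewrite divr_gt0 // ltr_wpDl.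
  have hq : \forall n \near \oo, forall q, \int[Q]_z ((phi z q 0 - pr n z q 0) ^+ 2) <= e / (r%:R + 1).
    by apply: filter_forall => q; exact: pr_cvg.
  near=> n.
  have n0 : (0 < n)%N by near: n; exact: nbhs_infty_gt.
  have np : (0 : R) < n%:R by rewrite ltr0n.
  have sd q : sqint Q (fun z => (pr n z - phi z) q 0).
    by apply: eq_sqint (sqintB Q _ _ (spr n q) (sphi q)) => z; rewrite [RHS]mxE [X in _ = _ + X]mxE.
  have md q : \int[Q]_z ((pr n z - phi z) q 0) = 0.
    rewrite (eq_expect Q (fun z => pr n z q 0 - phi z q 0)) => [|z]; last first.
      by rewrite [LHS]mxE [X in _ + X]mxE.
    rewrite expectB ?phi_mean0 ?subr0; [|exact: sqint_integ..].
    rewrite (eq_expect Q (fun z => \sum_i coef n q i 0 * v i z)); last first.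
      by move=> z; rewrite prE; apply: eq_bigr => i _; rewrite mxE mulrC.
    rewrite expect_sum => [|i]; last by apply: integZ; exact: sqint_integ.
    by apply: big1 => i _; rewrite expectZ ?mean0 ?mulr0 //; exact: sqint_integ.
  have [iX eX] := expect_smean_sqr P Q Z iid n _ _ n0 sd md.
  split=> //; [by rewrite invr_gt0|by move=> w; exact: sqr_ge0|].
  rewrite /X eX mulrC ler_pM2r ?invr_gt0 //.
  have [_ ->] := sqint_vnorm _ _ Q _ _ sd.
  apply: le_trans (_ : \sum_(q < r) e / (r%:R + 1) <= _).
    apply: ler_sum => q _; apply: le_trans (_ : \int[Q]_z ((phi z q 0 - pr n z q 0) ^+ 2) <= _).
      rewrite le_eqVlt; apply/orP; left; apply/eqP; apply: eq_expect => z.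
      by rewrite [X in X ^+ 2 = _]mxE [X in (_ + X) ^+ 2 = _]mxE; ring.
    by move: q; near: n.
  rewrite sumr_const card_ord -[leLHS]mulr_natr mulrAC ler_pdivrMr ?ltr_wpDl //.
  by rewrite ler_pM2l // lerDl.
apply: prob_to_oneS (prob_markov P X (fun n => n%:R^-1) main _ ee).
near=> n => w /= hw.
have n0 : (0 < n)%N by near: n; exact: nbhs_infty_gt.
have np : (0 : R) < n%:R by rewrite ltr0n.
rewrite -(ler_pXn2r (ltn0Sn 1)) ?nnegrE ?vnorm_ge0 ?divr_ge0 ?sqrtr_ge0 ?(ltW eta0) //.
by rewrite XE expr_div_n sqr_sqrtr // ltW.
Unshelve. all: by end_near. Qed.

Lemma el_estimate_expansion :
  op_rate P (fun n w => vnorm (el_estimate Z psi (uhat n) n w (zh n w)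
                                   - (smean Z psi n w - smean Z phi n w)))
        (fun n => (Num.sqrt n%:R)^-1).
Proof.
apply/op_rate_prob => eps eps0; have e2 : 0 < eps / 2 by rewrite divr_gt0.
have h := projection_small _ e2.
apply: prob_to_oneS (prob_to_oneI P _ _ h (el_expansion_prob _ e2)).
near=> n => w /= [h1 [z [z1 z2 h2]]].
(* On this event the solution is unique, so the selection [zh] must be the one that was expanded;
   elsewhere [zh] is arbitrary. *)
have -> : zh n w = z.
  by apply: (z2); apply: zh_sol; exists z; split=> // z' hz'; rewrite (z2 z').
rewrite ger0_norm ?vnorm_ge0 //.
have -> : eps / Num.sqrt n%:R = eps / 2 / Num.sqrt n%:R + eps / 2 / Num.sqrt n%:R.
  by rewrite -mulrDl -splitr.
apply: le_trans (lerD h2 h1); apply: le_trans (vnormB _ _).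
set E := el_estimate _ _ _ _ _ _; set A := _ *m _; set B := smean Z psi n w.
by rewrite [X in vnorm X <= _](_ : _ = E - (B - A) - (A - smean Z phi n w)) // !opprB -[RHS]addrA [X in _ = _ + X]addrC [X in _ = _ + X]addrA subrK.
Unshelve. all: by end_near. Qed.

End Model.

(** * Tightness and expected cosines of Gaussian vectors *)

Section RandomVector.
Context {R : realType} {d} {T : measurableType d} (P : probability T R)
  {r : nat} (Y : T -> 'cV[R]_r) (mY : forall i, measurable_fun setT (fun w => Y w i 0)).

Lemma random_vector_tight e : 0 < e ->
  exists2 L, 0 < L & (P [set w | out_box L (Y w)] <= e%:E)%E.
Proof.
move=> e0; pose F n := [set w | out_box (n%:R : R) (Y w)].
have mF n : measurable (F n) by exact: measurable_out_box.
have F0 : \bigcap_n F n = set0.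
  apply/seteqP; split=> // w hw.
  have [n hn] : exists n : nat, \sum_i `|Y w i 0| <= n%:R.
    exists (Num.trunc (\sum_i `|Y w i 0|)).+1.
    by apply/ltW/truncnS_gt.
  have [i] := hw n I; apply/negP; rewrite -leNgt; apply: le_trans hn.
  by rewrite (bigD1 i) //= lerDl sumr_ge0.
have h : P (F n) @[n --> \oo] --> P (\bigcap_n F n).
  apply: nonincreasing_cvg_mu => //.
  - by rewrite ltey_eq fin_num_measure.
  - exact: bigcap_measurable.
  - move=> k l kl; apply/subsetPset => w [i hi]; exists i; apply: le_lt_trans hi.
    by rewrite ler_nat.
rewrite F0 measure0 in h.
have [_ /cvgrPdist_le/(_ e e0)[N _ hN]] := proj1 (fine_cvgP _ _) h.
exists N.+1%:R => //; rewrite -(fineK (fin_num_measure P _ (mF N.+1))) lee_fin.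
by have := hN N.+1 (leqnSn N); rewrite /= sub0r normrN; apply: le_trans; exact: ler_norm.
Qed.

Context (Sig : 'M[R]_r) (gY : gaussian_vec P Sig Y) (t : 'cV[R]_r).
Hypothesis q0 : 0 <= (t^T *m Sig *m t) 0 0.

Let proj_measurable (s : 'cV[R]_r) : measurable_fun setT (fun w => (s^T *m Y w) 0 0).
Proof.
apply: (eq_measurable_fun (fun w => \sum_i s i 0 * Y w i 0)) => [w _|].
  by rewrite mxdotE.
by apply: measurable_sum => i; apply: measurable_funM.
Qed.

(** A zero variance gives a point mass. Otherwise the phase is expanded by the addition formula, and
    the sine part vanishes by symmetry: the projections on [t] and on [- t] have the same normal
    law. *)
Lemma gaussian_expect_cos a :
  \int[P]_w cos (dot t (Y w) + a) = expR (- ((t^T *m Sig *m t) 0 0 / 2)) * cos a.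
Proof.
have [_ law] := gY; set q := (t^T *m Sig *m t) 0 0.
have law1 (s : 'cV[R]_r) A : measurable A -> P ((fun w => (s^T *m Y w) 0 0) @^-1` A) =
  (if (s^T *m Sig *m s) 0 0 == 0 then \d_(0 : R) A
       else normal_prob 0 (Num.sqrt ((s^T *m Sig *m s) 0 0)) A) by exact: law.
have e1 (s : 'cV[R]_r) w : dot s (Y w) = (s^T *m Y w) 0 0 by rewrite mxdotE.
have mcos b : measurable_fun setT (fun x : R => cos (x + b)).
  apply: measurableT_comp; first exact: measurable_cosr.
  exact: measurable_funD.
have msin : measurable_fun setT (@sin R).
  exact: measurable_sinr.
have [qz|qz] := eqVneq q 0.
  rewrite qz mul0r oppr0 expR0 mul1r.
  pose D := (@dirac _ (measurableTypeR R) (0 : R) R : probability (measurableTypeR R) R).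
  have lawD A : measurable A -> P ((fun w => (t^T *m Y w) 0 0) @^-1` A) = D A.
    by move=> mA; rewrite law1 // -/q qz eqxx.
  rewrite (eq_expect P (fun w => cos ((t^T *m Y w) 0 0 + a))) => [|w]; last by rewrite e1.
  rewrite (expect_law P D _ (proj_measurable t) lawD (fun x : R => cos (x + a))); last first.
    by apply: (integ_bnd D _ 1); [exact: mcos|move=> x; exact: cos_max].
  rewrite /Rintegral integral_dirac //; last by apply/measurable_EFinP; exact: mcos.
  by rewrite diracT mul1e add0r.
have sq0 : 0 < Num.sqrt q by rewrite sqrtr_gt0 lt_def qz.
pose N : probability (measurableTypeR R) R := normal_prob 0 (Num.sqrt q).
have lawN A : measurable A -> P ((fun w => (t^T *m Y w) 0 0) @^-1` A) = N A.
  by move=> mA; rewrite law1 // -/q (negbTE qz).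
have eN : (- t)^T = - t^T by apply/matrixP => i j; rewrite !mxE.
have lawN' A : measurable A -> P ((fun w => ((- t)^T *m Y w) 0 0) @^-1` A) = N A.
  move=> mA; rewrite law1 // (_ : (- t)^T *m Sig *m - t = t^T *m Sig *m t) -/q ?(negbTE qz) //.
  by rewrite eN !mulNmx mulmxN opprK.
have ic b : integ N (fun x : R => cos (x + b)).
  by apply: (integ_bnd N _ 1); [exact: mcos|move=> x; exact: cos_max].
have isin : integ N (@sin R) by apply: (integ_bnd N _ 1); [exact: msin|move=> x; exact: sin_max].
have sin0 : \int[N]_x sin x = 0.
  have h1 := expect_law P N _ (proj_measurable t) lawN _ isin.
  have h2 := expect_law P N _ (proj_measurable (- t)) lawN' _ isin.
  have : \int[N]_x sin x = - \int[N]_x sin x.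
    rewrite -[LHS]h2 -[in RHS]h1 -mulN1r -expectZ; last first.
      exact: (integ_law P N _ (proj_measurable t) lawN _ isin).
    by apply: eq_expect => w; rewrite eN mulNmx mxE sinN mulN1r.
  by lra.
rewrite (eq_expect P (fun w => cos ((t^T *m Y w) 0 0 + a))) => [|w]; last by rewrite e1.
rewrite (expect_law P N _ (proj_measurable t) lawN (fun x : R => cos (x + a))) //.
rewrite (eq_expect N (fun x => cos a * cos (1 * x) - sin a * sin x)); last first.
  by move=> x; rewrite cosD mul1r mulrC [sin x * _]mulrC.
rewrite expectB; first last.
- exact: integZ.
- by apply: integZ; apply: eq_integ (ic 0) => x; rewrite addr0 mul1r.
rewrite !expectZ // ?sin0 ?mulr0 ?subr0; last first.
  by apply: eq_integ (ic 0) => x; rewrite addr0 mul1r.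
by rewrite normal_expect_cos // expr1n mul1r sqr_sqrtr // mulrC.
Qed.

End RandomVector.

(** * Transfer of limits between asymptotically equal vectors *)

Section Slutsky.
Context {R : realType} {d} {Om : measurableType d} (P : probability Om R)
  {r : nat} (X G : nat -> Om -> 'cV[R]_r).
Hypotheses (mX : forall n i, measurable_fun setT (fun w => X n w i 0))
  (mG : forall n i, measurable_fun setT (fun w => G n w i 0))
  (close : op_rate P (fun n w => vnorm (X n w - G n w)) (fun=> 1)).

(** Cosine is 1-Lipschitz, so the two cosines differ by at most [|t| |X - G|] on the good event, and
    by at most 2 off it. The budget is [e / 3] for the limit, [e / 3] on the event and [2 (e / 6)]
    off it. *)
Lemma slutsky_expect_cos t a (l : R) :
  \int[P]_w cos (dot t (G n w) + a) @[n --> \oo] --> l ->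
  \int[P]_w cos (dot t (X n w) + a) @[n --> \oo] --> l.
Proof.
move=> hG; apply/cvgrPdist_le => e e0.
have e3 : 0 < e / 3 by rewrite divr_gt0.
have e6 : 0 < e / 6 by rewrite divr_gt0.
have et : 0 < e / 3 / (vnorm t + 1) by rewrite divr_gt0 // ltr_wpDl ?vnorm_ge0.
have h := proj1 (op_rate_prob P _ _) close _ et.
have hG' := proj1 (cvgrPdist_le _ _) hG _ e3.
near=> n.
have [B [mB sB PB]] : exists B, [/\ measurable B,
    B `<=` [set w | `|vnorm (X n w - G n w)| <= e / 3 / (vnorm t + 1) * 1] &
    ((1 - e / 6)%:E <= P B)%E] by near: n; exact: h.
have g : `|l - \int[P]_w cos (dot t (G n w) + a)| <= e / 3 by near: n; exact: hG'.
have mcX := measurable_cos_dot (X n) (mX n) t a.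
have mcG := measurable_cos_dot (G n) (mG n) t a.
have icX : integ P (fun w => cos (dot t (X n w) + a)).
  by apply: (integ_bnd P _ 1) => // w; exact: cos_max.
have icG : integ P (fun w => cos (dot t (G n w) + a)).
  by apply: (integ_bnd P _ 1) => // w; exact: cos_max.
have mi : measurable_fun setT (\1_(~` B) : Om -> R).
  by apply: measurable_indic; exact: measurableC.
have ii : integ P (\1_(~` B) : Om -> R).
  by apply: (integ_bnd P _ 1) => // w; rewrite ger0_norm ?indic_le1.
have : `|\int[P]_w cos (dot t (G n w) + a) - \int[P]_w cos (dot t (X n w) + a)| <= e / 3 + 2 * (e / 6).
  rewrite -expectB //; apply: le_trans (expect_norm P _ (integB P _ _ icG icX)) _.
  apply: le_trans (_ : \int[P]_w (e / 3 + 2 * \1_(~` B) w) <= _).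
    apply: expect_le; first exact: integrable_norm (integB P _ _ icG icX).
      by apply: integD; [exact: integ_cst|exact: integZ].
    move=> w; rewrite indicE; case: (boolP (w \in ~` B)) => hw.
      apply: le_trans (ler_normB _ _) _; have := cos_max (dot t (G n w) + a).
      by have := cos_max (dot t (X n w) + a); rewrite mulr1; lra.
    move: hw; rewrite notin_setE => /contrapT hw.
    rewrite mulr0 addr0; apply: le_trans (cos_lipschitz _ _) _.
    rewrite (_ : dot t (G n w) + a - (dot t (X n w) + a) = - dot t (X n w - G n w)); last first.
      by rewrite dotBr; ring.
    rewrite normrN; apply: le_trans (norm_dot_le _ _) _.
    have := sB _ hw; rewrite /= mulr1 ger0_norm ?vnorm_ge0 // => hw'.
    have t0 := vnorm_ge0 t; have x0 := vnorm_ge0 (X n w - G n w).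
    move: hw'; rewrite ler_pdivlMr ?ltr_wpDl //.
    by nra.
  rewrite expectD; [|exact: integ_cst|exact: integZ].
  rewrite expect_cst expectZ // lerD2l ler_pM2l // expect_indic; last exact: measurableC.
  rewrite -lee_fin fineK ?fin_num_measure //; last exact: measurableC.
  exact: probability_compl_le.
move=> h1; rewrite (_ : l - _ = (l - \int[P]_w cos (dot t (G n w) + a)) +
  (\int[P]_w cos (dot t (G n w) + a) - \int[P]_w cos (dot t (X n w) + a))); last by ring.
apply: le_trans (ler_normD _ _) _; move: g h1; set y1 := `|_|; set y2 := `|_|; lra.
Unshelve. all: by end_near. Qed.

Lemma slutsky_tight : Op P (fun n w => vnorm (G n w) ^+ 2) (fun=> 1) ->
  forall e, 0 < e -> exists2 L, 0 < L &
    \forall n \near \oo, (P [set w | out_box L (X n w)] <= e%:E)%E.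
Proof.
move=> hG e e0; have e2 : 0 < e / 2 by rewrite divr_gt0.
have [M M0 hM] := hG _ e2.
(* [|G| <= |G|^2 + 1 <= M + 1], and [X] is within 1 of [G]. *)
exists (M + 2); first by rewrite addr_gt0.
have h := proj1 (op_rate_prob P _ _) close _ (@ltr01 R) (e / 2) e2.
near=> n.
have [B1 [mB1 sB1 PB1]] : exists B, [/\ measurable B,
  B `<=` [set w | vnorm (G n w) ^+ 2 <= M * 1] & ((1 - e / 2)%:E <= P B)%E] by near: n.
have [B2 [mB2 sB2 PB2]] : exists B, [/\ measurable B,
  B `<=` [set w | `|vnorm (X n w - G n w)| <= 1 * 1] & ((1 - e / 2)%:E <= P B)%E] by near: n.
have mI : measurable (B1 `&` B2) by exact: measurableI.
have := probability_setI_ge P _ _ _ _ mB1 mB2 PB1 PB2; rewrite -splitr => PI.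
apply: le_trans (probability_compl_le P _ _ mI PI); apply: le_measure; rewrite ?inE.
- exact: measurable_out_box.
- exact: measurableC.
move=> w /= [i hi] [/sB1 /= h1 /sB2 /= h2]; move: h1 h2 hi; rewrite !mulr1 => h1.
rewrite ger0_norm ?vnorm_ge0 // => h2; apply/negP; rewrite -leNgt.
apply: le_trans (coord_le_vnorm _ _) _.
rewrite -[X n w](subrK (G n w)); apply: le_trans (vnormD _ _) _.
have := sqr_ge0 (vnorm (G n w) - 1); have := vnorm_ge0 (G n w).
by rewrite expr2 in h1; rewrite expr2; lra.
Unshelve. all: by end_near. Qed.

End Slutsky.

(** * Moments of the influence function *)

Section Residual.
Context {R : realType} {d} {T : measurableType d} (Q : probability T R)
  (v : nat -> T -> R) {r : nat} (psi phi : T -> 'cV[R]_r).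
Hypotheses (sv : forall i, sqint Q (v i)) (mean0 : forall i, \int[Q]_z v i z = 0)
  (spsi : forall k, sqint Q (fun z => psi z k 0))
  (hphi : forall k : 'I_r, L2proj Q v (fun z => psi z k 0) (fun z => phi z k 0)).

(** The influence function of the estimator; it is centred because [phi] has mean 0. *)
Definition residual z := psi z - phi z - meanvec Q psi.

Let sphi k : sqint Q (fun z => phi z k 0) := L2proj_sqint Q v _ _ (hphi k).

Let phi0 k : \int[Q]_z phi z k 0 = 0 := L2proj_mean0 Q v sv mean0 _ _ (hphi k).

Let resE z k : residual z k 0 = psi z k 0 - phi z k 0 - \int[Q]_z psi z k 0.
Proof. rewrite /residual [LHS]mxE [X in X + _ = _]mxE [X in _ + X + _ = _]mxE [X in _ + X = _]mxE.
by rewrite /meanvec [X in _ - X = _]mxE. Qed.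

Lemma sqint_residual k : sqint Q (fun z => residual z k 0).
Proof.
apply: eq_sqint (sqintB Q _ _ (sqintB Q _ _ (spsi k) (sphi k)) (sqint_cst Q (\int[Q]_z psi z k 0))) => z.
by rewrite resE.
Qed.

Lemma residual_mean0 k : \int[Q]_z residual z k 0 = 0.
Proof.
rewrite (eq_expect Q (fun z => psi z k 0 - phi z k 0 - \int[Q]_z psi z k 0)) => [|z]; last exact: resE.
have i1 := sqint_integ Q _ (spsi k); have i2 := sqint_integ Q _ (sphi k).
rewrite expectB; [|exact: integB|exact: integ_cst].
by rewrite expectB // expect_cst phi0 subr0 subrr.
Qed.

(** Each coordinate of [psi - phi] is orthogonal to each coordinate of [phi], so the mixed moments
    of centred [psi] with [phi] equal the second moments of [phi]. The two mixed terms then leave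
    exactly minus the covariance of [phi]. *)
Lemma residual_cov k l :
  \int[Q]_z (residual z k 0 * residual z l 0) = (covmx Q psi - covmx Q phi) k l.
Proof.
pose a k z := psi z k 0 - \int[Q]_z psi z k 0.
have sa i : sqint Q (a i) by apply: sqintB => //; exact: sqint_cst.
have aphi i j : \int[Q]_z (a i z * phi z j 0) = \int[Q]_z (phi z i 0 * phi z j 0).
  have orth : \int[Q]_z ((psi z i 0 - phi z i 0) * phi z j 0) = 0.
    apply: (L2proj_closed_span Q v sv _ _ (hphi j) (fun z => psi z i 0 - phi z i 0)).
      exact: sqintB.
    exact: (L2proj_orth Q v _ _ (hphi i)).
  have s1 : sqint Q (fun z => psi z i 0 - phi z i 0) by exact: sqintB.
  rewrite (eq_expect Q (fun z => (psi z i 0 - phi z i 0) * phi z j 0 + phi z i 0 * phi z j 0 -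
    (\int[Q]_z psi z i 0) * phi z j 0)); last by move=> z; rewrite /a; ring.
  have i1 := sqint_mul Q _ _ s1 (sphi j); have i2 := sqint_mul Q _ _ (sphi i) (sphi j).
  have i3 := sqint_integ Q _ (sphi j).
  rewrite expectB; [|exact: integD|exact: integZ].
  by rewrite expectD // orth add0r expectZ // phi0 mulr0 subr0.
have -> : (covmx Q psi - covmx Q phi) k l =
    \int[Q]_z (a k z * a l z) - \int[Q]_z (phi z k 0 * phi z l 0).
  rewrite [LHS]mxE [X in _ + X]mxE; congr (_ - _).
    by rewrite /covmx mxE /Rintegral; congr fine; apply: eq_integral => z _; rewrite /a !mxE.
  rewrite /covmx mxE /Rintegral; congr fine; apply: eq_integral => z _.
  by rewrite !mxE -!/(Rintegral _ _ _) !phi0 !subr0.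
have i1 := sqint_mul Q _ _ (sa k) (sa l); have i2 := sqint_mul Q _ _ (sphi k) (sphi l).
have i3 := sqint_mul Q _ _ (sa k) (sphi l); have i4 := sqint_mul Q _ _ (sa l) (sphi k).
rewrite (eq_expect Q (fun z => a k z * a l z + phi z k 0 * phi z l 0 -
   (a k z * phi z l 0 + a l z * phi z k 0))); last first.
  by move=> z; rewrite !resE /a; ring.
rewrite expectB; [|exact: integD|exact: integD].
rewrite !expectD // !aphi.
have -> : \int[Q]_z (phi z l 0 * phi z k 0) = \int[Q]_z (phi z k 0 * phi z l 0).
  by apply: eq_expect => z; rewrite mulrC.
by ring.
Qed.

Lemma sqint_dot_residual (t : 'cV[R]_r) : sqint Q (fun z => dot t (residual z)).
Proof. by apply: sqint_sum => i; apply: sqintZ; exact: sqint_residual. Qed.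

Lemma dot_residual_mean0 (t : 'cV[R]_r) : \int[Q]_z dot t (residual z) = 0.
Proof.
rewrite expect_sum => [|i]; last by apply: integZ; apply: sqint_integ; exact: sqint_residual.
apply: big1 => i _; rewrite expectZ ?residual_mean0 ?mulr0 //.
by apply: sqint_integ; exact: sqint_residual.
Qed.

Lemma dot_residual_sqr (t : 'cV[R]_r) :
  \int[Q]_z (dot t (residual z) ^+ 2) = (t^T *m (covmx Q psi - covmx Q phi) *m t) 0 0.
Proof.
have i1 k l := sqint_mul Q _ _ (sqint_residual k) (sqint_residual l).
rewrite -mulmxA mxdotE /dot.
rewrite (eq_expect Q (fun z => \sum_k \sum_l t k 0 * (t l 0 * (residual z k 0 * residual z l 0)))); last first.
  move=> z; rewrite expr2 mulr_suml; apply: eq_bigr => k _.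
  by rewrite mulr_sumr; apply: eq_bigr => l _; ring.
rewrite expect_sum => [|k]; last by apply: integ_sum => l; do 2 apply: integZ; exact: i1.
apply: eq_bigr => k _; rewrite mxE mulr_sumr.
rewrite expect_sum => [|l]; last by do 2 apply: integZ; exact: i1.
apply: eq_bigr => l _; rewrite expectZ; last by apply: integZ; exact: i1.
by rewrite expectZ ?residual_cov 1?[_ * t l 0]mulrC //; exact: i1.
Qed.

End Residual.

(** * The central limit theorem for the estimator *)

Section Clt.
Context {R : realType} {dO} {Om : measurableType dO} (P : probability Om R)
  {dZ} {T : measurableType dZ} (Q : probability T R)
  (Z : nat -> Om -> T) (r : nat) (psi phi : T -> 'cV[R]_r) (v : nat -> T -> R)
  (X : nat -> Om -> 'cV[R]_r).
Hypotheses (iid : iid_seq P Z Q) (sv : forall i, sqint Q (v i))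
  (mean0 : forall i, \int[Q]_z v i z = 0) (spsi : forall k, sqint Q (fun z => psi z k 0))
  (hphi : forall k : 'I_r, L2proj Q v (fun z => psi z k 0) (fun z => phi z k 0))
  (mX : forall n i, measurable_fun setT (fun w => X n w i 0))
  (X_expansion : op_rate P (fun n w => vnorm (X n w - (smean Z psi n w - smean Z phi n w)))
     (fun n => (Num.sqrt n%:R)^-1)).

Let g := residual Q psi phi.
Let sg k : sqint Q (fun z => g z k 0) := sqint_residual Q v psi phi spsi hphi k.
Let g0 k : \int[Q]_z g z k 0 = 0 := residual_mean0 Q v psi phi sv mean0 spsi hphi k.

Let Xn n w := Num.sqrt n%:R *: (X n w - meanvec Q psi).
Let Gn n w := Num.sqrt n%:R *: smean Z g n w.

Let mXn n i : measurable_fun setT (fun w => Xn n w i 0).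
Proof.
apply: (eq_measurable_fun (fun w => Num.sqrt n%:R * (X n w i 0 - meanvec Q psi i 0))) => [w _|].
  by rewrite [RHS]mxE; congr (_ * _); rewrite [RHS]mxE [X in _ = _ + X]mxE.
by apply: measurable_funM => //; apply: measurable_funB.
Qed.

Let GnE n w i : Gn n w i 0 = Num.sqrt n%:R * avg (fun j : 'I_n => g (Z j w) i 0).
Proof. by rewrite [LHS]mxE /avg [X in _ * X]mxE summxE. Qed.

Let mGn n i : measurable_fun setT (fun w => Gn n w i 0).
Proof.
apply: (eq_measurable_fun (fun w => Num.sqrt n%:R * avg (fun j : 'I_n => g (Z j w) i 0))) => [w _|].
  by rewrite GnE.
by apply: measurable_funM => //; have [] := sqint_avg P Q Z iid n _ (sg i).
Qed.

Let close : op_rate P (fun n w => vnorm (Xn n w - Gn n w)) (fun=> 1).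
Proof.
apply/op_rate_prob => eps eps0.
apply: prob_to_oneS (proj1 (op_rate_prob P _ _) X_expansion _ eps0); near=> n => w /=.
have n0 : (0 < n)%N by near: n; exact: nbhs_infty_gt.
have np : 0 < Num.sqrt n%:R :> R by rewrite sqrtr_gt0 ltr0n.
have -> : Xn n w - Gn n w = Num.sqrt n%:R *: (X n w - (smean Z psi n w - smean Z phi n w)).
  rewrite /Xn /Gn -scalerBr; congr (_ *: _).
  have -> : smean Z g n w = smean Z psi n w - smean Z phi n w - meanvec Q psi.
    have -> : meanvec Q psi = avgv (fun _ : 'I_n => meanvec Q psi) by rewrite avgv_cst.
    by rewrite -!avgvB.
  by rewrite [X in _ + X = _]opprB addrA subrK.
rewrite vnormZ !ger0_norm ?mulr_ge0 ?vnorm_ge0 ?(ltW np) // mulr1.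
by rewrite ler_pdivlMr // mulrC.
Unshelve. all: by end_near. Qed.

Let Gn_cos t a : \int[P]_w cos (dot t (Gn n w) + a) @[n --> \oo] -->
  expR (- ((t^T *m (covmx Q psi - covmx Q phi) *m t) 0 0 / 2)) * cos a.
Proof.
rewrite -(dot_residual_sqr Q v psi phi sv mean0 spsi hphi).
have := charfn_clt P Q Z _ a iid (sqint_dot_residual Q v psi phi spsi hphi t)
  (dot_residual_mean0 Q v psi phi sv mean0 spsi hphi t).
have e n w : dot t (Gn n w) = (Num.sqrt n%:R)^-1 * \sum_(i < n) dot t (g (Z i w)).
  rewrite /Gn /smean dotZr dotZr mulrA (dotC t) dot_suml; congr (_ * _).
    (* For [n = 0] both factors are 0 by the convention for the inverse of 0. *)
    have [->|n0] := posnP n; first by rewrite sqrtr0 invr0 mul0r.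
    have np : 0 < Num.sqrt n%:R :> R by rewrite sqrtr_gt0 ltr0n.
    by rewrite -[X in _ / X](@sqr_sqrtr R n%:R) ?ler0n // expr2 invfM mulrA mulfV ?mul1r // gt_eqF.
  by apply: eq_bigr => i _; rewrite dotC.
by under [in X in _ -> X]eq_fun do under eq_Rintegral do rewrite e.
Qed.

Let Gn_Op : Op P (fun n w => vnorm (Gn n w) ^+ 2) (fun=> 1).
Proof.
apply: (Op_markov P _ _ (\int[Q]_z (vnorm (g z) ^+ 2))); near=> n.
have n0 : (0 < n)%N by near: n; exact: nbhs_infty_gt.
have [i1 e1] := expect_smean_sqr P Q Z iid n _ _ n0 sg g0.
have e w : vnorm (Gn n w) ^+ 2 = n%:R * vnorm (smean Z g n w) ^+ 2.
  by rewrite vnormZ exprMn real_normK ?num_real // sqr_sqrtr ?ler0n.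
split=> //; [|by move=> w; exact: sqr_ge0|].
  by apply: eq_integ (integZ P n%:R _ i1) => w; rewrite e.
rewrite (eq_expect P _ _ e) expectZ // e1 mulrA mulfV ?mul1r ?mulr1 //.
by rewrite pnatr_eq0 -lt0n.
Unshelve. all: by end_near. Qed.

Lemma conv_to_gaussian_residual : conv_to_gaussian P Xn (covmx Q psi - covmx Q phi).
Proof.
move=> f cf [M fM] d' T' P' Y gY; have mY := gY.1.
have mfX n := continuous_vector_measurable (Xn n) (mXn n) f M cf fM.
have mfY := continuous_vector_measurable Y mY f M cf fM.
rewrite -EFin_expect; last by apply: (integ_bnd P' _ M).
apply: cvg_EFin.
  by apply: filterE => n; apply: integrable_fin_num => //; apply: (integ_bnd P _ M).
apply: (weak_convergence P P' Xn Y mXn mY _ _ _ f M cf fM).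
(* The variance of the limit in direction [t] is nonnegative because it is the second moment of
   [dot t (residual z)]. *)
- move=> t a; rewrite (gaussian_expect_cos P' Y mY _ gY t); last first.
    by rewrite -(dot_residual_sqr Q v psi phi sv mean0 spsi hphi) expect_ge0 // => z; exact: sqr_ge0.
  exact: (slutsky_expect_cos P Xn Gn mXn mGn close).
- exact: (slutsky_tight P Xn Gn mXn close).
- exact: random_vector_tight.
Qed.

End Clt.

(** * Measurability of the estimator, and the theorem *)

Lemma el_estimate_measurable (R : realType) dO dT (Om : measurableType dO)
    (T : measurableType dT) (Z : nat -> Om -> T) (r k n : nat) (psi : T -> 'cV[R]_r)
    (uh : Om -> T -> 'cV[R]_k) (zeta : Om -> 'cV[R]_k) i :
  (forall j, measurable_fun setT (Z j)) ->
  (forall q, measurable_fun setT (fun z => psi z q 0)) ->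
  (forall j q, measurable_fun setT (fun w => uh w (Z j w) q 0)) ->
  (forall q, measurable_fun setT (fun w => zeta w q 0)) ->
  measurable_fun setT (fun w => el_estimate Z psi (uh) n w (zeta w) i 0).
Proof.
move=> mZ mpsi muh mzeta.
apply: (eq_measurable_fun (fun w => n%:R^-1 * \sum_(j < n)
  ((1 + \sum_q uh w (Z j w) q 0 * zeta w q 0)^-1 * psi (Z j w) i 0))) => [w _|].
  rewrite [RHS]mxE summxE; congr (_ * _); apply: eq_bigr => j _.
  by rewrite [RHS]mxE mxdotE.
apply: measurable_funM => //; apply: measurable_sum => j; apply: measurable_funM.
  apply: measurableT_comp; first exact: measurable_invr.
  by apply: measurable_funD => //; apply: measurable_sum => q; apply: measurable_funM.
exact: measurableT_comp (mpsi i) (mZ j).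
Qed.

Theorem theorem4 (R : realType)
  (dO : measure_display) (Om : measurableType dO) (P : probability Om R)
  (dZ : measure_display) (T : measurableType dZ) (Q : probability T R)
  (Z : nat -> Om -> T) (r : nat) (psi : T -> 'cV[R]_r)
  (m : nat -> nat) (u v : nat -> T -> R)
  (uhat : forall n : nat, Om -> T -> 'cV[R]_(m n)) :
  iid_seq P Z Q ->
  (forall k : 'I_r, measurable_fun setT (fun z => psi z k 0)) ->
  (\int[Q]_z (vnorm (psi z) ^+ 2)%:E < +oo)%E ->
  (forall N : nat, \forall n \near \oo, (N <= m n)%N) ->
  (* the u_i *)
  (forall i, measurable_fun setT (u i)) ->
  (forall n, (\int[Q]_z (vnorm (colfun u (m n) z) ^+ 2)%:E < +oo)%E) ->
  (forall n (i : 'I_(m n)), (\int[Q]_z (u i z)%:E = 0)%E) ->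
  (forall n, gram Q u (m n) \in unitmx) ->
  regular_seq (fun n => gram Q u (m n)) ->
  (* the estimator hat u_n is a random function *)
  (forall n (j : nat) (i : 'I_(m n)),
     measurable_fun setT (fun w => uhat n w (Z j w) i 0)) ->
  (* (i) *)
  op_rate P (fun n w => \big[Num.max/0]_(j < n) vnorm (uhat n w (Z j w)))
    (fun n => Num.sqrt n%:R / ((m n)%:R * Num.sqrt (m n)%:R)) ->
  (* (ii) *)
  op_rate P (fun n w => opnorm ((n%:R)^-1 *:
                 \sum_(j < n) (uhat n w (Z j w) *m (uhat n w (Z j w))^T)
               - gram Q u (m n)))
    (fun n => ((m n)%:R)^-1) ->
  (* (iii) *)
  op_rate P (fun n w => frob ((n%:R)^-1 *: \sum_(j < n)
                 (psi (Z j w) *m (uhat n w (Z j w))^T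
                  - Emx P (fun w' => psi (Z j w') *m (uhat n w' (Z j w'))^T))))
    (fun n => (Num.sqrt (m n)%:R)^-1) ->
  (* the v_i *)
  (forall i, measurable_fun setT (v i)) ->
  (forall n, (\int[Q]_z (vnorm (colfun v (m n) z) ^+ 2)%:E < +oo)%E) ->
  (forall n (i : 'I_(m n)), (\int[Q]_z (v i z)%:E = 0)%E) ->
  (forall n, gram Q v (m n) \in unitmx) ->
  (exists C : R, forall n, exists S : 'M[R]_(m n),
       inv_sqrt_of S (gram Q u (m n)) /\ opnorm (S *m gram Q v (m n) *m S) <= C) ->
  (* (iv) *)
  (forall eps : R, 0 < eps -> \forall n \near \oo,
     ((m n)%:R%:E * ((n%:R)^-1%:E * \sum_(j < n)
        \int[P]_w (vnorm (uhat n w (Z j w) - colfun v (m n) (Z j w)) ^+ 2)%:E)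
      <= eps%:E)%E) ->
  (* (v) *)
  op_rate P (fun n w => vnorm ((n%:R)^-1 *: \sum_(j < n) uhat n w (Z j w)
                               - smean Z (colfun v (m n)) n w))
    (fun n => (Num.sqrt (m n)%:R * Num.sqrt n%:R)^-1) ->
  (* conclusions *)
  prob_to_one P (fun n => [set w | exists! zeta, el_solution Z (uhat n) n w zeta])
  /\
  forall zh : forall n : nat, Om -> 'cV[R]_(m n),
    (forall n w, (exists! zeta, el_solution Z (uhat n) n w zeta) ->
                 el_solution Z (uhat n) n w (zh n w)) ->
    forall phi : T -> 'cV[R]_r,
      (forall k : 'I_r, L2proj Q v (fun z => psi z k 0) (fun z => phi z k 0)) ->
      op_rate P (fun n w => vnorm (el_estimate Z psi (uhat n) n w (zh n w)
                                   - (smean Z psi n w - smean Z phi n w)))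
        (fun n => (Num.sqrt n%:R)^-1)
      /\
      (covmx Q psi - covmx Q phi \in unitmx ->
       (forall n (i : 'I_(m n)), measurable_fun setT (fun w => zh n w i 0)) ->
       conv_to_gaussian P
         (fun n w => Num.sqrt n%:R *: (el_estimate Z psi (uhat n) n w (zh n w)
                                        - meanvec Q psi))
         (covmx Q psi - covmx Q phi)).
Proof.
move=> iid mpsi psi2 m_infty mu u2 u0 W_unit W_regular muhat max_rate What_rate cross_rate
  mv v2 v0 V_unit _ uhat_close mean_rate.
split.
  exact: (el_exists_unique P Q Z r psi m u v uhat).
move=> zh zh_sol phi hphi.
have expansion := el_estimate_expansion P Q Z r psi m u v uhat iid mpsi psi2 m_infty W_unit
  W_regular muhat max_rate What_rate cross_rate mv v2 v0 uhat_close mean_rate zh phi zh_sol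
  V_unit hphi.
split=> // _ mzh.
have [mZ _] := iid.
apply: (conv_to_gaussian_residual P Q Z r psi phi v _ iid (sqint_v Q m v m_infty mv v2)
  (mean_v Q m v m_infty v0) (sqint_coord _ _ _ _ _ _ mpsi psi2) hphi) => // n i.
by apply: el_estimate_measurable.
Qed.
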